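(* There exists a small constant $\delta_0\in(0,\tfrac12)$ such that the following holds. Let $\sigma=0$, let $W_{in}|_{y=\pm1}=\omega_{in}|_{y=\pm1}=0$, and let $(\omega,\theta)$ be the solution of the linearized Boussinesq system around $(U(t,y),0)$, i.e. its Fourier modes $(\omega_k,\theta_k)$ in $x$ satisfy, for $y\in[-1,1]$, $$\begin{cases}\partial_t \omega_k+ ik U \omega_k - ik U'' \psi_k - \mu \partial_y^2 \omega_k = -i k \theta_k,\\ \partial_t \theta_k + i k U \theta_k - \nu \partial_y^2 \theta_k = 0,\\ (-k^2+\partial_y^2)\psi_k=\omega_k,\\ \psi_k(t,\pm1)=\omega_k(t,\pm1)=\theta_k(t,\pm1)=0,\end{cases}$$ with initial data $\omega_{in}(k,y),\theta_{in}(k,y)$. If $\|W_{in}\|_{H^4_y}\le\delta_0$, then for all integers $k\ne0$ and any $t>0$, $$\|\theta_k\|_{L^2}^2+\nu^{\frac23}|k|^{-\frac23}\|\partial_y\theta_k\|_{L^2}^2\le C_0\,\Phi_{\theta_{in}}\,e^{-c_0\nu^{\frac13}|k|^{\frac23}t},$$ and $$\|\omega_k\|_{L^2}^2+\mu^{\frac23}|k|^{-\frac23}\|\partial_y\omega_k\|_{L^2}^2\le C_0\,\Phi_{\omega_{in}}\,e^{-c_0\mu^{\frac13}|k|^{\frac23}t}+C_0\min\{\mu,\nu\}^{-\frac23}|k|^{\frac23}\,\Phi_{\theta_{in}}\,e^{-c_0\min\{\mu,\nu\}^{\frac13}|k|^{\frac23}t},$$ where $C_0,c_0$ are two positive constants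 independent of $k$ and $t$, and $$\Phi_{\omega_{in}}=\|\omega_{in}(k,\cdot)\|_{L^2}^2+\mu^{\frac23}|k|^{-\frac23}\|\partial_y\omega_{in}(k,\cdot)\|_{L^2}^2,\qquad \Phi_{\theta_{in}}=\|\theta_{in}(k,\cdot)\|_{L^2}^2+\nu^{\frac23}|k|^{-\frac23}\|\partial_y\theta_{in}(k,\cdot)\|_{L^2}^2.$$
   Context: The domain is $(x,y)\in\mathbb T\times[-1,1]$; $\mu,\nu>0$ are the viscosity and the thermal diffusivity. Fourier modes: $f_k(t,y)=\frac1{2\pi}\int_{-\pi}^{\pi}f(t,x,y)e^{-ikx}\,dx$. $\|\cdot\|_{L^2}$ of a mode is the $L^2([-1,1])$ norm in $y$; primes on $U$ are $y$-derivatives. Background shear flow: $W(t,y)$ solves the heat equation $\partial_tW-\mu\partial_y^2W=0$ on $[-1,1]$ with $W|_{t=0}=W_{in}(y)$ and $W(t,\pm1)=0$, and $U(t,y)=y+\partial_y\int_{-1}^1G(y,y')W(t,y')\,dy'$, where $G$ is the Green's function of $\partial_y^2$ on $[-1,1]$ with homogeneous Dirichlet conditions, so that $U'=1+W$. *)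

(* Defs.v *)
From HB Require Import structures.
From mathcomp Require Import all_boot all_order all_algebra.
From mathcomp Require Import complex.
From mathcomp Require Import all_classical all_reals all_analysis.

Set Implicit Arguments.
Unset Strict Implicit.
Unset Printing Implicit Defensive.

Import Order.TTheory GRing.Theory Num.Theory.
Import numFieldNormedType.Exports.

Local Open Scope classical_set_scope.
Local Open Scope complex_scope.
Local Open Scope ring_scope.

Section Defs.
Context {R : realType}.
Implicit Types (t x y z : R) (k : int).

Local Notation leb := (@lebesgue_measure R).

Definition chan : set R := `[-1, 1].

(* Norms take values in \bar R: a function outside the space has norm +oo. *)
Definition L2sq (f : R -> R) : \bar R :=
  (\int[leb]_(y in chan) ((f y) ^+ 2)%:E)%E.

Definition cL2sq (f : R -> R[i]) : \bar R :=
  (\int[leb]_(y in chan) (complex.Re (f y) ^+ 2 + complex.Im (f y) ^+ 2)%:E)%E.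

Definition in_L2 (f : R -> R) : Prop :=
  measurable_fun chan f /\ (L2sq f < +oo)%E.

(* [f] is in H^1 with weak derivative [g]; elements of H^1 are identified with
   their absolutely continuous representatives, so that boundary values make
   sense pointwise. *)
Definition weak_deriv (f g : R -> R) : Prop :=
  in_L2 g /\
  (forall y, chan y -> f y = f (-1) + \int[leb]_(z in `[-1, y]) g z).

Definition cweak_deriv (f g : R -> R[i]) : Prop :=
  weak_deriv (fun y => complex.Re (f y)) (fun y => complex.Re (g y)) /\
  weak_deriv (fun y => complex.Im (f y)) (fun y => complex.Im (g y)).

(* [f] is in H^m, and [D j] is its [j]-th derivative for [j <= m]. *)
Definition in_H (m : nat) (f : R -> R) (D : nat -> R -> R) : Prop :=
  (forall y, chan y -> D 0%N y = f y) /\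
  (forall j, (j < m)%N -> weak_deriv (D j) (D j.+1)).

Definition Hnorm (m : nat) (D : nat -> R -> R) : \bar R :=
  ((\sum_(j < m.+1) L2sq (D j)) `^ (2^-1)%R)%E.

Definition dt (f : R -> R -> R) t y : R := derive1 (f ^~ y) t.
Definition dy (f : R -> R -> R) t y : R := derive1 (f t) y.

Definition re (f : R -> R -> R[i]) t y : R := complex.Re (f t y).
Definition im (f : R -> R -> R[i]) t y : R := complex.Im (f t y).

Definition cdt (f : R -> R -> R[i]) t y : R[i] :=
  Complex (dt (re f) t y) (dt (im f) t y).
Definition cdy (f : R -> R -> R[i]) t y : R[i] :=
  Complex (dy (re f) t y) (dy (im f) t y).

Definition interior_dom : set (R * R) :=
  [set p | 0 < p.1 /\ -1 < p.2 < 1].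
Definition closed_dom : set (R * R) :=
  [set p | 0 < p.1 /\ -1 <= p.2 <= 1].

(* Continuous on the open strip, with a continuous extension to t > 0,
   y in [-1, 1]. The extension avoids two-sided derivatives at y = -1, 1, which
   would depend on values outside of the channel. *)
Definition continuous_upto_bdry (h : R -> R -> R) : Prop :=
  exists g : R * R -> R,
    {within closed_dom, continuous g} /\
    (forall t y, interior_dom (t, y) -> g (t, y) = h t y).

(* C^1 in t and C^2 in y on (0, oo) x [-1, 1]. *)
Definition classical (f : R -> R -> R) : Prop :=
  [/\ forall t y, interior_dom (t, y) ->
        [/\ derivable (f ^~ y) t 1,
            derivable (f t) y 1 &
            derivable (dy f t) y 1],
      {within closed_dom, continuous (fun p : R * R => f p.1 p.2)},
      continuous_upto_bdry (dt f),
      continuous_upto_bdry (dy f) &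
      continuous_upto_bdry (dy (dy f))].

Definition cclassical (f : R -> R -> R[i]) : Prop :=
  classical (re f) /\ classical (im f).

(* f(t) --> f0 in H^1 as t --> 0+, where [df0] is the weak derivative of [f0]. *)
Definition H1_initial (f : R -> R -> R) (f0 df0 : R -> R) : Prop :=
  L2sq (fun y => f t y - f0 y) @[t --> (0 : R)^'+] --> 0%E /\
  L2sq (fun y => dy f t y - df0 y) @[t --> (0 : R)^'+] --> 0%E.

Definition cH1_initial (f : R -> R -> R[i]) (f0 df0 : R -> R[i]) : Prop :=
  H1_initial (re f) (fun y => complex.Re (f0 y)) (fun y => complex.Re (df0 y)) /\
  H1_initial (im f) (fun y => complex.Im (f0 y)) (fun y => complex.Im (df0 y)).

Definition green (y z : R) : R :=
  (Num.min y z + 1) * (Num.max y z - 1) / 2.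

(* For z in [-1, 1] the formula for [green] is affine in y outside of (-1, 1),
   and the integral is continuously differentiable in y on the whole line;
   hence the two-sided derivative is the right one at y = -1, 1 as well. *)
Definition shear (W : R -> R -> R) t y : R :=
  y + derive1 (fun y' : R => \int[leb]_(z in chan) (green y' z * W t z)) y.

Definition heat_flow (mu : R) (Win dWin : R -> R) (W : R -> R -> R) : Prop :=
  [/\ classical W,
      forall t y, interior_dom (t, y) -> dt W t y - mu * dy (dy W) t y = 0,
      forall t, 0 <= t -> W t (-1) = 0 /\ W t 1 = 0,
      forall y, chan y -> W 0 y = Win y &
      H1_initial W Win dWin].

(* (2 pi)^-1 int_(-pi)^pi f(x) e^(-ikx) dx, for a real-valued [f]. *)
Definition fourier (f : R -> R) k : R[i] :=
  Complex
    ((2 * pi)^-1 * \int[leb]_(x in `[- pi, pi]) (f x * cos (k%:~R * x)))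
    (- ((2 * pi)^-1 * \int[leb]_(x in `[- pi, pi]) (f x * sin (k%:~R * x)))).

Definition mode (f : R -> R -> R -> R) k t y : R[i] :=
  fourier (fun x => f t x y) k.

Definition mode_in (f : R -> R -> R) k y : R[i] := fourier (fun x => f x y) k.

Definition field (f : R -> R -> R -> R) : Prop :=
  forall t y, 0 <= t -> chan y ->
    (forall x, f t (x + 2 * pi) y = f t x y) /\
    leb.-integrable `[- pi, pi] (fun x => (f t x y)%:E).

Definition ik k : R[i] := Complex 0 k%:~R.

Definition mode_system (mu nu : R) (U : R -> R -> R) k
    (om psi th : R -> R -> R[i]) : Prop :=
  [/\ cclassical om /\ cclassical th,
      (forall t, 0 < t ->
        [/\ {within chan, continuous (re psi t)},
            {within chan, continuous (im psi t)} &
            forall y, -1 < y < 1 ->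
              [/\ derivable (re psi t) y 1, derivable (im psi t) y 1,
                  derivable (dy (re psi) t) y 1 &
                  derivable (dy (im psi) t) y 1]]),
      (forall t y, interior_dom (t, y) ->
        [/\ cdt om t y + ik k * (U t y)%:C * om t y
              - ik k * (dy (dy U) t y)%:C * psi t y
              - mu%:C * cdy (cdy om) t y
            = - (ik k * th t y),
            cdt th t y + ik k * (U t y)%:C * th t y
              - nu%:C * cdy (cdy th) t y = 0 &
            - (k%:~R ^+ 2) * psi t y + cdy (cdy psi) t y = om t y]) &
      (forall t y, 0 <= t -> y = -1 \/ y = 1 ->
        [/\ psi t y = 0, om t y = 0 & th t y = 0])].

(* The modes of the initial data are in H^1, with weak derivatives
   [domega_in k] and [dtheta_in k]. *)
Definition linearized_boussinesq (mu nu : R) (U : R -> R -> R)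
    (omega psi theta : R -> R -> R -> R) (omega_in theta_in : R -> R -> R)
    (domega_in dtheta_in : int -> R -> R[i]) : Prop :=
  [/\ [/\ field omega, field psi & field theta],
      (forall x y, chan y ->
        omega 0 x y = omega_in x y /\ theta 0 x y = theta_in x y),
      (forall k, cweak_deriv (mode_in omega_in k) (domega_in k) /\
                 cweak_deriv (mode_in theta_in k) (dtheta_in k)),
      (forall k, cH1_initial (mode omega k) (mode_in omega_in k) (domega_in k)
              /\ cH1_initial (mode theta k) (mode_in theta_in k) (dtheta_in k)) &
      (forall k, mode_system mu nu U k (mode omega k) (mode psi k)
                   (mode theta k))].

Definition absk (k : int) : R := `|k%:~R|.

(* [df] stands for the derivative of [f]. *)
Definition energy (kappa : R) k (f df : R -> R[i]) : \bar R :=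
  (cL2sq f + (kappa `^ (2 / 3) * absk k `^ (- (2 / 3)))%:E * cL2sq df)%E.

Definition decay (kappa : R) k t (c : R) : R :=
  expR (- c * kappa `^ (1 / 3) * absk k `^ (2 / 3) * t).

End Defs.

(* Main.v *)
(** Since [W] solves the heat equation with data small in [H^2], the shear
    [U] satisfies [U' ~ 1] and [|U''| <= d << 1] for all times; write
    [V = U + const] and [mu = k e^3]. For the scalar [theta], and for
    [omega = p + i q] without the stream-function term, the hypocoercive energy
    [|omega|^2 + (e^2/100) |omega'|^2 + (e/100) Re <i omega, omega'>] decays at
    rate [k e].

    The nonlocal term [U'' psi] costs [k d |psi|_{H^1}^2], which is not bounded by
    the dissipation [k e |omega|^2] uniformly in [e]. It is absorbed by adding
    a small multiple of [Q = Re <omega, T omega>], where [T] has the kernel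
    [h(x) / (e - i x)] with [x = V y - V z] and [h(x) ~ exp (- k |x|)]. Under
    transport, [x h(x) / (e - i x) = i (h(x) - e h(x) / (e - i x))], so that
    [dQ/dt = - k <omega, T_h omega> + k e Q], and the
    quadratic form of [exp (- k |x|)] is, up to constants, [k |psi|_{H^1_k}^2].
    Viscosity and the time dependence of [V] perturb this identity only by
    multiples of [k e] times the hypocoercive dissipation.

    The forcing by [theta] enters Gronwall's inequality as
    [(k / e) |theta|^2], whence the factor [e^{-2}]. *)
Require Import Defs.
From HB Require Import structures.
From mathcomp Require Import all_boot all_order all_algebra.
From mathcomp Require Import complex ring lra.
From mathcomp Require Import all_classical all_reals all_analysis measurable_realfun.
Import Order.TTheory GRing.Theory Num.Theory.
Import numFieldNormedType.Exports.
Set Implicit Arguments.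
Unset Strict Implicit.
Unset Printing Implicit Defensive.
Local Open Scope classical_set_scope.
Local Open Scope complex_scope.
Local Open Scope ring_scope.

(** * Continuous functions on the channel *)

Section ContinuousRing.
Context {R : realType}.

(** The imaginary part of the kernel of [T] behaves like [x / (e^2 + x^2)], a truncated Hilbert
    transform: absolute integration loses a logarithm of [e], so Schur's test does not bound it. The
    lower bound on [Q] and the [L^2] bound on this part both come out of the transport identity
    itself. Along the rotation [exp(-i s V) omega], which preserves [|omega|], the quantity
    [Q + |omega|^2] would run to minus infinity exponentially if it were ever negative, while [Q]
    stays bounded. Classical solutions have one time derivative, two space derivatives and no mixed
    ones. Energies containing space derivatives are therefore differentiated through finite
    differences in time integrated by parts, and the [H^2] bound on [W] is propagated through time
    difference quotients. The viscosity is not assumed small, so [e] may be large; surplus powers of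
    [e] are absorbed with Poincare's inequality. Constants: [Q] enters with weight [kap = 10^-7],
    small enough for its errors (up to [35000]) to be beaten by the hypocoercive dissipation, while
    [d <= 10^-10] makes the stream-function cost [63 d] small compared with [kap]. *)

Definition contp : {pred R -> R} := mem [set f : R -> R | continuous f].
Definition contp_key : pred_key contp. Proof. exact. Qed.
Canonical contp_keyed := KeyedPred contp_key.

Lemma contpP (f : R -> R) : reflect (continuous f) (f \in contp).
Proof. by apply: (iffP idP) => [/set_mem|h]; [|apply/mem_set]. Qed.

Lemma contp_subring : subring_closed contp.
Proof.
split=> [|f g /contpP cf /contpP cg|f g /contpP cf /contpP cg]; apply/contpP => x.
- exact: cvg_cst.
- by apply: continuousB; [exact: cf|exact: cg].
- by apply: continuousM; [exact: cf|exact: cg].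
Qed.
HB.instance Definition _ := GRing.isSubringClosed.Build _ contp contp_subring.

(** Bundling continuity gives a commutative ring, so that [ring] proves equalities of integrands and
    integrability is automatic. The functions live on the whole line; integrals see only their
    values on the channel. *)
Record cfct := CFct { cval : R -> R; _ : cval \in contp }.
HB.instance Definition _ := [isSub for cval].
HB.instance Definition _ := [Choice of cfct by <:].
HB.instance Definition _ := [SubChoice_isSubComNzRing of cfct by <:].
Coercion cval : cfct >-> Funclass.

Definition mkC (f : R -> R) (cf : continuous f) : cfct := CFct (introT (contpP f) cf).

Lemma cfctP (f g : cfct) : f =1 g -> f = g.
Proof. by move=> h; apply: val_inj => /=; apply/funext. Qed.
Lemma cfct_cont (f : cfct) : continuous f.
Proof. by case: f => f /= /contpP. Qed.

Implicit Types f g h : cfct.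

Lemma cfD (f g : cfct) y : (f + g) y = f y + g y. Proof. by []. Qed.
Lemma cfB (f g : cfct) y : (f - g) y = f y - g y. Proof. by []. Qed.
Lemma cfN (f : cfct) y : (- f) y = - f y. Proof. by []. Qed.
Lemma cfM (f g : cfct) y : (f * g) y = f y * g y. Proof. by []. Qed.
Lemma cf0 y : (0 : cfct) y = 0. Proof. by []. Qed.
Lemma cf1 y : (1 : cfct) y = 1. Proof. by []. Qed.

Lemma cst_cont (c : R) : continuous (fun _ : R => c).
Proof. by move=> x; exact: cvg_cst. Qed.
Definition cc (c : R) : cfct := mkC (@cst_cont c).
Lemma ccE c y : cc c y = c. Proof. by []. Qed.
Fact cc_zmod : zmod_morphism cc. Proof. by move=> a b; exact: cfctP. Qed.
Fact cc_monoid : monoid_morphism cc.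
Proof. by split=> [|a b]; exact: cfctP. Qed.
HB.instance Definition _ := GRing.isZmodMorphism.Build R cfct cc cc_zmod.
HB.instance Definition _ := GRing.isMonoidMorphism.Build R cfct cc cc_monoid.

Local Notation leb := (@lebesgue_measure R).

(* [I], and [T] below, are sealed to keep conversion from unfolding integrals. *)
Fact I_sig : {J : cfct -> R | forall f, J f = \int[leb]_(y in `[-1, 1]) f y}.
Proof. by exists (fun f => \int[leb]_(y in `[-1, 1]) f y). Qed.
Definition I : cfct -> R := sval I_sig.
Lemma IE f : I f = \int[leb]_(y in `[-1, 1]) f y.
Proof. exact: (svalP I_sig). Qed.

Lemma cfct_int (f : cfct) a b : leb.-integrable `[a, b] (EFin \o f).
Proof.
apply: continuous_compact_integrable; first exact: segment_compact.
exact/continuous_subspaceT/cfct_cont.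
Qed.

Lemma ID f g : I (f + g) = I f + I g.
Proof. by rewrite !IE -RintegralD//; exact: cfct_int. Qed.
Lemma IB f g : I (f - g) = I f - I g.
Proof. by rewrite !IE -RintegralB//; exact: cfct_int. Qed.
Lemma IZ c f : I (cc c * f) = c * I f.
Proof. by rewrite !IE -RintegralZl//; exact: cfct_int. Qed.
Lemma IN f : I (- f) = - I f.
Proof. by rewrite -[- I f]mulN1r -IZ; congr I; ring. Qed.
Lemma I_cst c : I (cc c) = 2 * c.
Proof.
rewrite IE Rintegral_cst//= lebesgue_measure_itv/= lte_fin ifT; last lra.
by rewrite -EFinB/= opprK mulrC.
Qed.
Lemma I_ge0 f : (forall y, -1 <= y <= 1 -> 0 <= f y) -> 0 <= I f.
Proof. by move=> h; rewrite IE; apply: Rintegral_ge0 => y /=; rewrite in_itv/=; exact: h. Qed.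
Lemma I_le f g : (forall y, -1 <= y <= 1 -> f y <= g y) -> I f <= I g.
Proof.
move=> h; rewrite -subr_ge0 -IB; apply: I_ge0 => y /h; by rewrite cfB subr_ge0.
Qed.
Lemma I_eq f g : (forall y, -1 <= y <= 1 -> f y = g y) -> I f = I g.
Proof.
move=> h; rewrite !IE; apply: eq_Rintegral => y; rewrite inE/= in_itv/=; exact: h.
Qed.

Lemma cfct_ge0_oo (f : cfct) :
  (forall y, -1 < y < 1 -> 0 <= f y) -> forall y, -1 <= y <= 1 -> 0 <= f y.
Proof.
move=> h y /andP[y1 y2]; rewrite leNgt; apply/negP => fy.
have /cvgrPdist_lt/(_ (- f y)) := @cfct_cont f y.
rewrite oppr_gt0 => /(_ fy)[e /= e0 he].
(* Shrinking [y] towards 0 lands strictly inside the channel even from an end point, and moves it by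
   at most [e / 2]. *)
pose z := y - y * Num.min (e / 2) 1.
have m0 : 0 < Num.min (e / 2) 1 by rewrite lt_min; lra.
have m1 : Num.min (e / 2) 1 <= e/2 by rewrite ge_min lexx.
have m2 : Num.min (e / 2) 1 <= 1 by rewrite ge_min lexx orbT.
set m := Num.min _ _ in z m0 m1 m2.
have hz : -1 < z < 1 by apply/andP; split; rewrite /z; nra.
have : `|f y - f z| < - f y.
  apply: he; rewrite /ball_/= /z opprB addrC subrK normrM (gtr0_norm m0).
  have : `|y| <= 1 by rewrite ler_norml; apply/andP; split.
  have := normr_ge0 y; nra.
rewrite ltr_norml; have := h z hz; lra.
Qed.

Lemma cfct_le_oo (f g : cfct) :
  (forall y, -1 < y < 1 -> f y <= g y) -> forall y, -1 <= y <= 1 -> f y <= g y.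
Proof.
move=> h y hy; rewrite -subr_ge0 -cfB; apply: cfct_ge0_oo hy => z hz.
by rewrite cfB subr_ge0 h.
Qed.
Lemma cfct_eq_oo (f g : cfct) :
  (forall y, -1 < y < 1 -> f y = g y) -> forall y, -1 <= y <= 1 -> f y = g y.
Proof.
by move=> h y hy; apply/eqP; rewrite eq_le; apply/andP; split;
  apply: (cfct_le_oo _ hy) => z hz; rewrite h.
Qed.

Lemma absC_cont (f : cfct) : continuous (fun y => `|f y|).
Proof. by move=> y; apply: cvg_norm; exact: cfct_cont. Qed.
Definition absC f := mkC (@absC_cont f).
Lemma absCE f y : absC f y = `|f y|. Proof. by []. Qed.

Lemma I_abs f : `|I f| <= I (absC f).
Proof. by rewrite !IE; apply: le_normr_Rintegral => //; exact: cfct_int. Qed.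

Lemma I_bound f c : (forall y, -1 < y < 1 -> `|f y| <= c) -> `|I f| <= 2 * c.
Proof.
move=> h; apply: le_trans (I_abs f) _; rewrite -I_cst; apply: I_le.
exact: cfct_le_oo.
Qed.

Lemma Isq_ge0 f : 0 <= I (f * f).
Proof. by apply: I_ge0 => y _; rewrite cfM -expr2 sqr_ge0. Qed.

Lemma I_young f g s : 0 < s -> 2 * I (f * g) <= s * I (f * f) + s^-1 * I (g * g).
Proof.
move=> s0; have := Isq_ge0 (cc s * f - g).
have -> : (cc s * f - g) * (cc s * f - g)
  = cc (s ^+ 2) * (f * f) - cc (2 * s) * (f * g) + g * g by ring.
rewrite ID IB !IZ; set a := I (f * f); set b := I (f * g); set c := I (g * g) => hs.
have hs1 : s^-1 * s = 1 by rewrite mulVf// gt_eqF.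
have si : 0 <= s^-1 by rewrite invr_ge0 ltW.
have := mulr_ge0 si hs.
have -> : s^-1 * (s ^+ 2 * a - 2 * s * b + c) =
  (s^-1 * s) * (s * a) - 2 * (s^-1 * s) * b + s^-1 * c by ring.
rewrite hs1; lra.
Qed.

Lemma discr_le (a b c : R) : 0 <= a -> (forall s, 0 <= s ^+ 2 * a - 2 * s * b + c) ->
  b ^+ 2 <= a * c.
Proof.
move=> a0 h; have [a00|an] := eqVneq a 0.
  rewrite {}a00 in a0 h *; rewrite mul0r; have [->|b0] := eqVneq b 0; first by rewrite expr0n.
  (* With [a = 0] the form is affine in [s]; at this [s] it equals [-1]. *)
  have := h ((c + 1) / (2 * b)); rewrite mulr0 add0r.
  have -> : 2 * ((c + 1) / (2 * b)) * b = c + 1 by field.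
  lra.
have ap : 0 < a by rewrite lt_neqAle eq_sym an.
have := h (b / a); rewrite -(pmulr_rge0 _ ap).
have -> : a * ((b / a) ^+ 2 * a - 2 * (b / a) * b + c) = a * c - b ^+ 2 by field.
by rewrite subr_ge0.
Qed.

Lemma I_CS f g : I (f * g) ^+ 2 <= I (f * f) * I (g * g).
Proof.
apply: discr_le (Isq_ge0 f) _ => s.
have := Isq_ge0 (cc s * f - g).
have -> : (cc s * f - g) * (cc s * f - g)
  = cc (s ^+ 2) * (f * f) - cc (2 * s) * (f * g) + g * g by ring.
by rewrite ID IB !IZ.
Qed.

(** The derivative is required in the open channel only, because a two-sided derivative at a wall
    would depend on values outside. Continuity of both functions up to the walls still gives the
    fundamental theorem on the closed interval. *)
Definition der (f g : cfct) := forall y : R, -1 < y < 1 -> is_derive y 1 f (g y).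

Lemma derD f f' g g' : der f f' -> der g g' -> der (f + g) (f' + g').
Proof. by move=> hf hg y hy; apply: is_deriveD; [exact: hf|exact: hg]. Qed.
Lemma derN f f' : der f f' -> der (- f) (- f').
Proof. by move=> hf y hy; apply: is_deriveN; exact: hf. Qed.
Lemma derB f f' g g' : der f f' -> der g g' -> der (f - g) (f' - g').
Proof. by move=> hf /derN; exact: derD. Qed.
Lemma derM f f' g g' : der f f' -> der g g' -> der (f * g) (f' * g + f * g').
Proof.
move=> hf hg y hy.
have := is_deriveM (hf _ hy) (hg _ hy).
rewrite cfD !cfM => h; apply: is_derive_eq h _.
by rewrite /GRing.scale/=; ring.
Qed.
Lemma der_cc c : der (cc c) 0.
Proof. by move=> y _; exact: is_derive_cst. Qed.
Lemma der_eq f g g' : der f g -> g = g' -> der f g'. Proof. by move=> + <-. Qed.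

(** Composition with this projection onto the channel extends a function continuous on [[-1, 1]] to
    a continuous function on the line. *)
Definition cl (y : R) : R := Num.max (-1) (Num.min y 1).
Lemma cl_cont : continuous cl.
Proof.
move=> y; apply: (@continuous_max R R (fun=> -1) (fun y => Num.min y 1 : R^o) y).
  exact: cvg_cst.
by apply: (@continuous_min R R (fun y => y : R^o) (fun=> 1) y); [exact: cvg_id|exact: cvg_cst].
Qed.
Lemma cl_in y : -1 <= cl y <= 1.
Proof. by rewrite /cl le_max lexx /= ge_max ge_min lexx orbT andbT; lra. Qed.
Lemma clE y : -1 <= y <= 1 -> cl y = y.
Proof.
move=> /andP[h1 h2]; by rewrite /cl (min_l h2) (max_r h1).
Qed.

Lemma cl_within (U : topologicalType) (g : R -> U) :
  {within `[-1, 1], continuous g} -> continuous (g \o cl).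
Proof.
move=> /subspace_continuousP h y.
have hc : `[-1, 1]%classic (cl y) by rewrite /= in_itv/= cl_in.
apply: cvg_trans (h _ hc) => A /= hA.
suff : nbhs y (cl @^-1` [set z | `[-1, 1]%classic z -> A (g z)]).
  by apply: filterS => z /=; apply; rewrite /= in_itv/= cl_in.
exact: (@cl_cont y) hA.
Qed.

Lemma prim_cont (f : cfct) : continuous (fun y => \int[leb]_(z in `[-1, cl y]) f z).
Proof.
apply: (@cl_within _ (fun y => \int[leb]_(z in `[-1, y]) f z)).
by apply: parameterized_integral_continuous; [lra|exact: cfct_int].
Qed.
Definition prim (f : cfct) : cfct := mkC (@prim_cont f).

Lemma primE f y : -1 <= y <= 1 -> prim f y = \int[leb]_(z in `[-1, y]) f z.
Proof. by move=> /clE h; rewrite /prim/= h. Qed.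
Lemma prim_l f : prim f (-1) = 0.
Proof. by rewrite primE ?set_itv1 ?Rintegral_set1//; lra. Qed.
Lemma prim_r f : prim f 1 = I f.
Proof. by rewrite primE ?IE//; lra. Qed.

Lemma der_prim f : der (prim f) f.
Proof.
move=> y /andP[y1 y2].
have [] := @continuous_FTC1_closed R f (-1) y 1 y2 (cfct_int _ _ _) y1 (@cfct_cont f y).
set G := fun x => _; move=> h1 h2.
have hd : is_derive y 1 G (f y) by apply: DeriveDef; [exact: h1|rewrite -derive1E h2].
apply: near_eq_is_derive hd.
near=> z; rewrite primE//; apply/andP; split; apply/ltW; near: z.
  exact: lt_nbhsr.
exact: lt_nbhsl.
Unshelve. all: by end_near. Qed.

Lemma der0_const f y : der f 0 -> -1 <= y <= 1 -> f y = f (-1).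
Proof.
move=> h /andP[y1 y2]; have [->//|y1'] := eqVneq y (-1).
have {}y1 : -1 < y by rewrite lt_neqAle eq_sym y1'.
have [|c _ ] := @MVT R f (fun=> 0) (-1) y y1 _ (continuous_subspaceT (@cfct_cont f)).
  move=> z; rewrite in_itv/= => /andP[z1 z2]; apply: h; rewrite z1/=; lra.
by rewrite mul0r => /eqP; rewrite subr_eq0 => /eqP.
Qed.

Lemma der_FTC f g y : der f g -> -1 <= y <= 1 -> f y = f (-1) + prim g y.
Proof.
move=> h hy; have := derB h (der_prim g); rewrite subrr => /der0_const/(_ hy).
by rewrite !cfB prim_l subr0 => <-; rewrite subrK.
Qed.

Lemma I_der f g : der f g -> I g = f 1 - f (-1).
Proof. move=> h; rewrite (der_FTC h (y := 1)) ?prim_r; lra. Qed.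

Lemma IBP f f' g g' : der f f' -> der g g' ->
  I (f' * g) = f 1 * g 1 - f (-1) * g (-1) - I (f * g').
Proof. by move=> hf hg; have := I_der (derM hf hg); rewrite ID !cfM => <-; ring. Qed.
Lemma IBP0 f f' g g' : der f f' -> der g g' -> f (-1) = 0 -> f 1 = 0 ->
  I (f' * g) = - I (f * g').
Proof. by move=> hf hg f0 f1; rewrite (IBP hf hg) f0 f1; ring. Qed.

Lemma prim_abs g y : -1 <= y <= 1 -> `|prim g y| <= I (absC g).
Proof.
move=> hy; rewrite primE//.
apply: (@le_trans _ _ (\int[leb]_(z in `[-1, y]) absC g z)).
  by apply: le_normr_Rintegral => //; exact: cfct_int.
rewrite -primE//.
have h : der (prim (absC g)) (absC g) by exact: der_prim.
have [->|y1] := eqVneq y 1; first by rewrite prim_r.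
have {}y1 : y < 1 by rewrite lt_neqAle y1; case/andP: hy.
rewrite -prim_r -subr_ge0.
have [|c hc ->] := @MVT R _ (absC g) y 1 y1 _ (continuous_subspaceT (@cfct_cont (prim (absC g)))).
  move=> z; rewrite in_itv/= => /andP[z1 z2]; apply: h; rewrite z2 andbT; lra.
by apply: mulr_ge0; [exact: normr_ge0|rewrite subr_ge0 ltW].
Qed.

Lemma Iabs_sq g : I (absC g) ^+ 2 <= 2 * I (g * g).
Proof.
have e1 : 1 = cc 1 by rewrite rmorph1.
have := I_CS (absC g) 1; rewrite !mulr1 [X in _ * I X]e1.
have -> : absC g * absC g = g * g.
  by apply: cfctP => y; rewrite !cfM !absCE -normrM ger0_norm// -expr2 sqr_ge0.
by rewrite I_cst mulrC mulr1.
Qed.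

Lemma sup_sq f g y : der f g -> f (-1) = 0 -> -1 <= y <= 1 -> f y ^+ 2 <= 2 * I (g * g).
Proof.
move=> h f0 hy; rewrite (der_FTC h hy) f0 add0r.
apply: le_trans (Iabs_sq g); rewrite -real_normK ?num_real//.
have := prim_abs g hy; have := normr_ge0 (prim g y); nra.
Qed.

Lemma poincare f g : der f g -> f (-1) = 0 -> I (f * f) <= 4 * I (g * g).
Proof.
move=> h f0; have -> : 4 * I (g * g) = I (cc (2 * I (g * g))) by rewrite I_cst; ring.
by apply: I_le => y hy; rewrite cfM -expr2; exact: sup_sq h f0 hy.
Qed.

(** Meant for the derivative of a function vanishing at both walls: it satisfies no boundary
    condition, but its mean is zero. The mean bounds the value at [-1] by the total variation, hence
    [f] by twice that. *)
Lemma sup_sq_zero f g y : der f g -> I f = 0 -> -1 <= y <= 1 -> f y ^+ 2 <= 8 * I (g * g).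
Proof.
move=> h f0 hy.
have hb z : -1 <= z <= 1 -> `|f z - f (-1)| <= I (absC g).
  by move=> hz; rewrite (der_FTC h hz) addrAC subrr add0r; exact: prim_abs.
have hm : `|f (-1)| <= I (absC g).
  have : `|I (f - cc (f (-1)))| <= 2 * I (absC g).
    by apply: I_bound => z hz; rewrite cfB ccE; apply: hb; lra.
  by rewrite IB f0 I_cst sub0r normrN normrM ger0_norm//; lra.
have : `|f y| <= 2 * I (absC g).
  have := hb y hy; have := ler_normD (f y - f (-1)) (f (-1)); rewrite subrK; lra.
have := Iabs_sq g; rewrite -[f y ^+ 2]real_normK ?num_real//.
have := normr_ge0 (f y); nra.
Qed.

Definition idC : cfct := mkC (fun y : R => @cvg_id _ (nbhs y)).
Lemma idCE y : idC y = y. Proof. by []. Qed.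
Lemma der_id : der idC 1.
Proof. by move=> y _; exact: is_derive_id. Qed.

(* Integrate the derivative of [(1 + y) f^2]; with [trace_l], the weight selects the end point. *)
Lemma trace_r f g : der f g -> f 1 ^+ 2 = 2^-1 * I (f * f) + I ((1 + idC) * (f * g)).
Proof.
move=> h.
have hd : der ((1 + idC) * (f * f)) (f * f + cc 2 * ((1 + idC) * (f * g))).
  apply: der_eq (derM (derD (der_cc 1) der_id) (derM h h)) _; ring.
have := I_der hd; rewrite ID IZ !cfM !cfD !cf1 /=; lra.
Qed.
Lemma trace_l f g : der f g -> f (-1) ^+ 2 = 2^-1 * I (f * f) - I ((1 - idC) * (f * g)).
Proof.
move=> h.
have hd : der ((1 - idC) * (f * f)) (- (f * f) + cc 2 * ((1 - idC) * (f * g))).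
  apply: der_eq (derM (derB (der_cc 1) der_id) (derM h h)) _; ring.
have := I_der hd; rewrite ID IN IZ !cfM !cfB !cf1 /=; lra.
Qed.

(** The weights [1 + y] and [1 - y] are at most 2 on the channel, and Young's inequality does the
    rest. The parameter [s] is an inverse length: [k] for the stream function, [1 / e] for the
    viscous layer. *)
Lemma trace_bound f g s (y : R) : 0 < s -> der f g -> y = 1 \/ y = -1 ->
  f y ^+ 2 <= 2^-1 * I (f * f) + s * I (f * f) + s^-1 * I (g * g).
Proof.
move=> s0 h hy.
have hm (u : cfct) : (forall y, -1 <= y <= 1 -> `|u y| <= 2) ->
    `|I (u * (f * g))| <= s * I (f * f) + s^-1 * I (g * g).
  move=> hu; apply: le_trans (I_abs _) _.
  apply: (@le_trans _ _ (2 * I (absC f * absC g))).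
    rewrite -IZ; apply: I_le => z hz; rewrite absCE !cfM !absCE ccE !normrM.
    by apply: ler_wpM2r; [rewrite mulr_ge0|exact: hu].
  have habs (v : cfct) : absC v * absC v = v * v.
    by apply: cfctP => z; rewrite !cfM !absCE -normrM ger0_norm// -expr2 sqr_ge0.
  by have := I_young (absC f) (absC g) s0; rewrite !habs.
case: hy => ->.
  rewrite (trace_r h) -addrA lerD2l; apply: le_trans (ler_norm _) _; apply: hm => z hz.
  by rewrite cfD cf1/= ler_norml; lra.
rewrite (trace_l h) -addrA lerD2l; apply: le_trans (ler_norm _) _; rewrite normrN.
by apply: hm => z hz; rewrite cfB cf1/= ler_norml; lra.
Qed.

End ContinuousRing.

(** * Integral operators with kernel K (V y - V z) *)

Section Tube.
Context {R : realType}.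
(** Compactness of the segment, in the form of near coverings, turns joint continuity into
    continuity uniform in [y]. *)
Lemma tube (T : topologicalType) (F : T * R -> R) (a b : R) (t0 : T) (e : R) : 0 < e ->
  (forall y, a <= y <= b -> {for (t0, y), continuous F}) ->
  \forall t \near t0, forall y, a <= y <= b -> `|F (t, y) - F (t0, y)| < e.
Proof.
move=> e0 cF.
have cK : near_covering `[a, b]%classic by apply/compact_near_coveringP; exact: segment_compact.
pose P t y := `|F (t, y) - F (t0, y)| < e.
suff : \forall t \near t0, `[a, b]%classic `<=` P t.
  by apply: filterS => t ht y hy; apply: ht; rewrite /= in_itv.
apply: (cK T (nbhs t0) P) => y.
rewrite /= in_itv/= => hy.
have e2 : 0 < e / 2 by lra.
have h : \forall p \near (t0, y), `|F (t0, y) - F p| < e / 2.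
  by have /cvgrPdist_lt := cF y hy; exact.
have h2 : \forall y' \near y, `|F (t0, y) - F (t0, y')| < e / 2.
  case: h => -[A B] /= [hA hB] hAB; apply: filterS hB => y' hy'.
  by apply: (hAB (t0, y')); split => //=; exact: nbhs_singleton.
case: h => -[A B] /= [hA hB] hAB.
exists (B `&` [set y' | `|F (t0, y) - F (t0, y')| < e / 2], A) => /=.
  by split => //; exact: filterI.
move=> [y' t] /= [[hy' h3] ht].
have := hAB (t, y') (conj ht hy') => /= h4.
rewrite /P; have -> : F (t, y') - F (t0, y') = (F (t0, y) - F (t0, y')) - (F (t0, y) - F (t, y')) by ring.
apply: le_lt_trans (ler_normB _ _) _; lra.
Qed.
End Tube.

Section Kernel.
Context {R : realType}.
Local Notation C := (@cfct R).
Local Notation leb := (@lebesgue_measure R).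
Implicit Types f g h K V : C.

Lemma cf_bdd f a b : exists2 M, 0 < M & forall y, a <= y <= b -> `|f y| <= M.
Proof.
have [ab|ba] := leP a b; last by exists 1 => // y; lra.
have [c hc hM] := EVT_max ab (continuous_subspaceT (@cfct_cont _ (absC f))).
exists (`|f c| + 1); first by have := normr_ge0 (f c); lra.
move=> y hy; have := hM y; rewrite in_itv/= => /(_ hy); rewrite /=; lra.
Qed.

Lemma I_small f e : (forall y, -1 <= y <= 1 -> `|f y| <= e) -> `|I f| <= 2 * e.
Proof. by move=> h; apply: I_bound => y hy; apply: h; lra. Qed.

Lemma ker_cont K V (y : R) : continuous (fun y' => K (V y - V y')).
Proof.
move=> z; apply: (@continuous_comp _ _ _ (fun y' => V y - V y') K); last exact: cfct_cont.
by apply: cvgB; [exact: cvg_cst|exact: cfct_cont].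
Qed.
Definition ker K V y : C := mkC (@ker_cont K V y).

Lemma kerE K V y z : ker K V y z = K (V y - V z). Proof. by []. Qed.

Lemma ker_cont2 K V (p : R * R) : {for p, continuous (fun p : R * R => K (V p.1 - V p.2))}.
Proof.
apply: (@continuous_comp _ _ _ (fun p : R * R => V p.1 - V p.2) K); last exact: cfct_cont.
apply: cvgB; apply: continuous_comp; [exact: cvg_fst|exact: cfct_cont|exact: cvg_snd|exact: cfct_cont].
Qed.

Lemma T_cont K V f : continuous (fun y => I (ker K V y * f)).
Proof.
move=> y0; apply/cvgrPdist_lt => e e0.
have [M M0 hM] := cf_bdd f (-1) 1.
have e' : 0 < e / (4 * M) by apply: divr_gt0 => //; lra.
have := tube e' (fun y (_ : -1 <= y <= 1) => @ker_cont2 K V (y0, y)).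
apply: filterS => y hy /=.
rewrite distrC -IB -mulrBl.
apply: le_lt_trans (_ : 2 * (e / (4 * M) * M) < e); last first.
  rewrite (_ : 2 * _ = e / 2); first lra.
  by field; rewrite gt_eqF.
apply: I_small => z hz; rewrite cfM normrM; apply: ler_pM => //.
  by apply/ltW; exact: hy.
exact: hM.
Qed.
Fact T_sig : {S : C -> C -> C -> C | forall K V f y, S K V f y = I (ker K V y * f)}.
Proof. by exists (fun K V f => mkC (@T_cont K V f)). Qed.
Definition T : C -> C -> C -> C := sval T_sig.
Lemma TE K V f y : T K V f y = I (ker K V y * f).
Proof. exact: (svalP T_sig). Qed.

Lemma TZ K V c f : T K V (cc c * f) = cc c * T K V f.
Proof. by apply: cfctP => y; rewrite cfM !TE -IZ; congr I; ring. Qed.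
Lemma TN K V f : T K V (- f) = - T K V f.
Proof. by apply: cfctP => y; rewrite cfN !TE mulrN IN. Qed.
Lemma TBK K1 K2 V f : T (K1 - K2) V f = T K1 V f - T K2 V f.
Proof. by apply: cfctP => y; rewrite cfB !TE -IB -mulrBl; congr I; congr (_ * _); exact: cfctP. Qed.
Lemma TZK c K V f : T (cc c * K) V f = cc c * T K V f.
Proof. by apply: cfctP => y; rewrite cfM !TE -IZ; congr I; rewrite mulrA; congr (_ * _); exact: cfctP. Qed.

(** Exchanging [y] and [z] reflects the argument of the kernel. Even kernels thus give symmetric
    operators and odd kernels antisymmetric ones. *)
Lemma T_fubini K K' V f g : (forall x, K' x = K (- x)) ->
  I (g * T K V f) = I (f * T K' V g).
Proof.
move=> hK.
pose F (p : measurableTypeR R * measurableTypeR R) : R := g p.1 * (K (V p.1 - V p.2) * f p.2).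
pose J : set (measurableTypeR R) := `[-1, 1]%classic.
pose D : set (measurableTypeR R * measurableTypeR R) := J `*` J.
have mJ : measurable J by exact: measurable_itv.
have mD : measurable D by exact: measurableX.
have mf (u : C) : measurable_fun (setT : set (measurableTypeR R)) (u : measurableTypeR R -> measurableTypeR R).
  by apply: continuous_measurable_fun; exact: cfct_cont.
have mF : measurable_fun setT F.
  apply: measurable_funM; first by apply: measurableT_comp; [exact: mf|exact: measurable_fst].
  apply: measurable_funM; last by apply: measurableT_comp; [exact: mf|exact: measurable_snd].
  apply: measurableT_comp; first exact: mf.
  by apply: measurable_funB; apply: measurableT_comp;
    [exact: mf|exact: measurable_fst|exact: mf|exact: measurable_snd].
have [Mf Mf0 hMf] := cf_bdd f (-1) 1.
have [Mg Mg0 hMg] := cf_bdd g (-1) 1.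
have [MV MV0 hMV] := cf_bdd V (-1) 1.
have [MK MK0 hMK] := cf_bdd K (- (2 * MV)) (2 * MV).
have iF : (leb \x leb)%E.-integrable D (EFin \o F).
  apply: measurable_bounded_integrable => //.
  - have e : ((leb \x leb) D = leb J * leb J)%E by exact: product_measure1E.
    suff h' : ((leb \x leb) D < +oo)%E by exact: h'.
    rewrite e lebesgue_measure_itv/= lte_fin ifT; last lra.
    by rewrite -EFinB -EFinM ltry.
  - exact: measurable_funTS.
  - exists (Mg * (MK * Mf)); split; first exact: num_real.
    move=> x hx -[y z] [/=]; rewrite /J/= !in_itv/= => hy hz; apply: le_trans (ltW hx).
    rewrite /F/= !normrM; apply: ler_pM => //; first exact: hMg.
    apply: ler_pM => //; last exact: hMf.
    apply: hMK; have := hMV y hy; have := hMV z hz; rewrite !ler_norml; lra.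
(* Fubini is applied on the whole plane to the extension of [F] by zero off the square. *)
have iF' : (leb \x leb)%E.-integrable setT ((EFin \o F) \_ D).
  exact: (integrable_mkcond (EFin \o F) mD).1 iF.
have H := Fubini iF'.
have inner (u : C) : (\int[leb]_(y in J) (u y)%:E = (I u)%:E)%E.
  rewrite IE fineK//; apply: integrable_fin_num => //; exact: cfct_int.
have L : (\int[leb]_x \int[leb]_y ((EFin \o F) \_ D) (x, y) = (I (g * T K V f))%:E)%E.
  rewrite -inner [RHS]integral_mkcond; apply: eq_integral => x _.
  rewrite patchE; case: ifPn => [/set_mem hx|/negP hx].
    rewrite cfM TE -IZ -inner [RHS]integral_mkcond; apply: eq_integral => y _.
    rewrite !patchE; case: ifPn => [/set_mem [_ hy]|/negP hy].
      by rewrite ifT; [|exact: mem_set].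
    rewrite ifF//; apply/negP => /set_mem hy'; apply: hy; exact/mem_set.
  apply: integral0_eq => y _; rewrite patchE ifF//; apply/negP => /set_mem [hx' _].
  by apply: hx; exact: mem_set.
have L' : (\int[leb]_y \int[leb]_x ((EFin \o F) \_ D) (x, y) = (I (f * T K' V g))%:E)%E.
  rewrite -inner [RHS]integral_mkcond; apply: eq_integral => x _.
  rewrite patchE; case: ifPn => [/set_mem hx|/negP hx].
    rewrite cfM TE -IZ -inner [RHS]integral_mkcond; apply: eq_integral => y _.
    rewrite !patchE; case: ifPn => [/set_mem [hy _]|/negP hy].
      rewrite ifT; last exact: mem_set.
      have h : F (y, x) = (cc (f x) * (ker K' V x * g)) y.
        by rewrite !cfM ccE /F [ker _ _ _ _]/= hK opprB /=; ring.
      by rewrite /comp h.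
    rewrite ifF//; apply/negP => /set_mem hy'; apply: hy; exact/mem_set.
  apply: integral0_eq => y _; rewrite patchE ifF//; apply/negP => /set_mem [_ hx'].
  by apply: hx; exact: mem_set.
by move: H; rewrite L L' => -[].
Qed.

(** Duality: the form is tested on [q = T f] and [p = 2 m f]. This scaling gives [2 m |T f|^2] on
    the left, of which the right side takes back only half. *)
Lemma T_norm K V m f : 0 < m ->
  (forall p q, I (q * T K V p) <= m * (I (p * p) + I (q * q))) ->
  I (T K V f * T K V f) <= 4 * m ^+ 2 * I (f * f).
Proof.
move=> m0 h; set g := T K V f.
have := h (cc (2 * m) * f) g.
rewrite TZ -/g.
have -> : g * (cc (2 * m) * g) = cc (2 * m) * (g * g) by ring.
have -> : cc (2 * m) * f * (cc (2 * m) * f) = cc (4 * m ^+ 2) * (f * f) by ring.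
rewrite !IZ; set a := I (f * f); set b := I (g * g) => h2.
by rewrite -(ler_pM2l m0); lra.
Qed.

Definition derR K K1 := forall x : R, is_derive x (1 : R) K (K1 x).

Lemma T_der K K1 V V' f : derR K K1 -> der V V' -> der (T K V f) (V' * T K1 V f).
Proof.
move=> hK hV y hy.
pose F (x z : R) := K (V x - V z) * f z.
have E : (T K V f : R -> R) = (fun x => \int[leb]_(z in `[-1, 1]) F x z).
  by apply/funext => x; rewrite TE IE.
have hd (x z : R) : -1 < x < 1 -> is_derive x (1 : R) (F ^~ z) (K1 (V x - V z) * V' x * f z).
  move=> hx.
  have h1 : is_derive x (1 : R) (fun x => V x - V z) (V' x).
    have := is_deriveB (hV _ hx) (is_derive_cst (V z) x 1); rewrite subr0; exact.
  have := @is_derive1_comp R K (fun x => V x - V z) x _ _ (hK (V x - V z)) h1 => h2.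
  have := is_deriveM h2 (is_derive_cst (f z) x 1).
  move=> h3; apply: is_derive_eq h3 _.
  by rewrite /GRing.scale/=; ring.
have d1 (x z : R) : -1 < x < 1 -> derive1 (F ^~ z) x = K1 (V x - V z) * V' x * f z.
  by move=> hx; rewrite derive1E; have [] := hd x z hx.
have [Mf Mf0 hMf] := cf_bdd f (-1) 1.
have [MV MV0 hMV] := cf_bdd V (-1) 1.
have [MV' MV'0 hMV'] := cf_bdd V' (-1) 1.
have [MK MK0 hMK] := cf_bdd K1 (- (2 * MV)) (2 * MV).
pose G (z : R) := MK * MV' * Mf.
have Ia : `]-1, 1[%classic y by rewrite /= in_itv.
have intf x : `]-1, 1[%classic x -> leb.-integrable `[-1, 1] (EFin \o F x).
  by move=> _; exact: (cfct_int (ker K V x * f)).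
have derf x z : `]-1, 1[%classic x -> `[-1, 1]%classic z -> derivable (F ^~ z) x 1.
  by rewrite /= !in_itv/= => hx hz; have [] := hd x z hx.
have G0 z : 0 <= G z by rewrite /G !mulr_ge0// ltW.
have iG : leb.-integrable `[-1, 1] (EFin \o G) by exact: (cfct_int (cc (MK * MV' * Mf))).
have Gub x z : `]-1, 1[%classic x -> `[-1, 1]%classic z -> `|derive1 (F ^~ z) x| <= G z.
  rewrite /= !in_itv/= => hx hz; rewrite d1// /G !normrM.
  have hx' : -1 <= x <= 1 by lra.
  apply: ler_pM; [exact: mulr_ge0|exact: normr_ge0| |exact: hMf].
  apply: ler_pM => //; last exact: hMV'.
  by apply: hMK; have := hMV x hx'; have := hMV z hz; rewrite !ler_norml; lra.
have mB : measurable (`[-1, 1]%classic : set (measurableTypeR R)) by [].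
rewrite E; apply: DeriveDef.
  have := (derivable_under_integral mB Ia intf derf G0 iG Gub). apply.
rewrite -derive1E (differentiation_under_integral mB Ia intf derf G0 iG Gub).
rewrite cfM TE -IZ IE; apply: eq_Rintegral => z _.
by rewrite /partial1of2 d1// !cfM ccE/=; ring.
Qed.

Lemma ker_der K K1 V V' y : derR K K1 -> der V V' -> der (ker K V y) (- (V' * ker K1 V y)).
Proof.
move=> hK hV z hz.
have h1 : is_derive z (1 : R) (fun z => V y - V z) (- V' z).
  have := is_deriveB (is_derive_cst (V y) z 1) (hV _ hz); rewrite sub0r; exact.
have := @is_derive1_comp R K (fun z => V y - V z) z _ _ (hK (V y - V z)) h1 => h2.
by apply: is_derive_eq h2 _; rewrite cfN cfM/=; ring.
Qed.

(** The function [K1 (V y - V z)] is [-1 / V' z] times the [z]-derivative of [K (V y - V z)]. Moving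
    that derivative onto [f / V'] lets bounds for the kernel [K] serve for its derivative, with no
    loss in [e]. *)
Lemma T_ibp K K1 V V' iV f g : derR K K1 -> der V V' -> iV * V' = 1 ->
  der (f * iV) g -> f (-1) = 0 -> f 1 = 0 -> T K1 V f = T K V g.
Proof.
move=> hK hV hi hg f0 f1; apply: cfctP => y; rewrite !TE.
have := IBP0 hg (ker_der y hK hV); rewrite !cfM f0 f1 !mul0r => /(_ erefl erefl).
rewrite [ker K V y * g]mulrC => ->; rewrite -IN; congr I.
have -> : ker K1 V y * f = ker K1 V y * f * (iV * V') by rewrite hi mulr1.
ring.
Qed.

End Kernel.

(** * Time derivatives that are uniform in y *)

Section UniformDerivative.
Context {R : realType} {X : Type} (D : X -> Prop).
Implicit Types (F G : R -> X -> R) (f g : X -> R) (t e : R).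

(* [uc F t] and [ud F t f]: continuity and differentiability in time, uniformly over [D]. *)
Definition bdd f := exists2 M, 0 < M & forall x, D x -> `|f x| <= M.
Definition uc F t := bdd (F t) /\
  forall e, 0 < e -> \forall s \near t, forall x, D x -> `|F s x - F t x| <= e.
Definition ud F t f := [/\ bdd (F t), bdd f &
  forall e, 0 < e -> \forall s \near t, forall x, D x ->
    `|F s x - F t x - (s - t) * f x| <= e * `|s - t|].

Lemma bddD f g : bdd f -> bdd g -> bdd (fun x => f x + g x).
Proof.
move=> [M M0 hM] [N N0 hN]; exists (M + N); first exact: addr_gt0.
by move=> x Dx; apply: le_trans (ler_normD _ _) _; apply: lerD; [exact: hM|exact: hN].
Qed.
Lemma bddM f g : bdd f -> bdd g -> bdd (fun x => f x * g x).
Proof.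
move=> [M M0 hM] [N N0 hN]; exists (M * N); first exact: mulr_gt0.
by move=> x Dx; rewrite normrM; apply: ler_pM => //; [exact: hM|exact: hN].
Qed.
Lemma bdd_cst c : bdd (fun=> c).
Proof. by exists (`|c| + 1) => [|x _]; have := normr_ge0 c; lra. Qed.

Lemma near_norm_small t d : 0 < d -> \forall s \near t, `|s - t| < d.
Proof. by move=> d0; exists d => //= s; rewrite distrC. Qed.

Lemma ud_uc F t f : ud F t f -> uc F t.
Proof.
move=> [bF [M M0 hM] hF]; split=> // e e0.
have e' : 0 < e / (1 + M) by apply: divr_gt0 => //; lra.
near=> s.
have H1 : forall x, D x -> `|F s x - F t x - (s - t) * f x| <= 1 * `|s - t|.
  by near: s; exact: hF.
move=> x Dx; have h1 := H1 x Dx.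
have h2 : `|s - t| < e / (1 + M) by near: s; exact: near_norm_small.
have h3 := hM x Dx.
have -> : F s x - F t x = (F s x - F t x - (s - t) * f x) + (s - t) * f x by ring.
apply: le_trans (ler_normD _ _) _; rewrite normrM.
rewrite ltr_pdivlMr in h2; last lra.
have := normr_ge0 (s - t); nra.
Unshelve. all: by end_near. Qed.

Lemma ud_cst t f : bdd f -> ud (fun=> f) t (fun=> 0).
Proof.
move=> bf; split=> //; first exact: bdd_cst.
move=> e e0; near=> s => x Dx; rewrite subrr mulr0 subr0 normr0 mulr_ge0//; lra.
Unshelve. all: by end_near. Qed.

Lemma udD F G t f g : ud F t f -> ud G t g ->
  ud (fun s x => F s x + G s x) t (fun x => f x + g x).
Proof.
move=> [bF bf hF] [bG bg hG]; split; [exact: bddD|exact: bddD|] => e e0.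
have e2 : 0 < e / 2 by lra.
near=> s.
have H1 : forall x, D x -> `|F s x - F t x - (s - t) * f x| <= e / 2 * `|s - t|.
  by near: s; exact: hF.
have H2 : forall x, D x -> `|G s x - G t x - (s - t) * g x| <= e / 2 * `|s - t|.
  by near: s; exact: hG.
move=> x Dx; have h1 := H1 x Dx; have h2 := H2 x Dx.
have -> : F s x + G s x - (F t x + G t x) - (s - t) * (f x + g x) =
  (F s x - F t x - (s - t) * f x) + (G s x - G t x - (s - t) * g x) by ring.
apply: le_trans (ler_normD _ _) _; lra.
Unshelve. all: by end_near. Qed.

(** Continuity of [G] suffices, since [F s - F t] already carries the factor [s - t]. This is what
    makes energies with space derivatives differentiable in time, although those derivatives are
    only continuous in time. *)
Lemma udM0 F G t f : ud F t f -> uc G t ->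
  ud (fun s x => (F s x - F t x) * G s x) t (fun x => f x * G t x).
Proof.
move=> hF [[N N0 hN] hG]; have [_ hFc] := ud_uc hF; case: hF => bF [M M0 hM] hF.
split.
- by exists 1 => // x _; rewrite subrr mul0r normr0.
- by apply: bddM; [exists M|exists N].
move=> e e0.
have e1 : 0 < e / (2 * (N + 1)) by apply: divr_gt0 => //; lra.
have e2 : 0 < Num.min 1 (e / (2 * M)) by rewrite lt_min ltr01 divr_gt0//; lra.
near=> s.
have H1 : forall x, D x -> `|F s x - F t x - (s - t) * f x| <= e / (2 * (N + 1)) * `|s - t|.
  by near: s; exact: hF.
have H2 : forall x, D x -> `|G s x - G t x| <= Num.min 1 (e / (2 * M)).
  by near: s; exact: hG.
move=> x Dx; have h1 := H1 x Dx; have := H2 x Dx; rewrite le_min => /andP[h2 h3].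
have hN' : `|G s x| <= N + 1.
  have -> : G s x = G t x + (G s x - G t x) by ring.
  by apply: le_trans (ler_normD _ _) _; have := hN x Dx; lra.
have -> : (F s x - F t x) * G s x - (F t x - F t x) * G t x - (s - t) * (f x * G t x)
  = (F s x - F t x - (s - t) * f x) * G s x + (s - t) * f x * (G s x - G t x) by ring.
apply: le_trans (ler_normD _ _) _; rewrite !normrM.
have a1 : `|F s x - F t x - (s - t) * f x| * `|G s x| <= e / 2 * `|s - t|.
  have -> : e / 2 * `|s - t| = (e / (2 * (N + 1)) * `|s - t|) * (N + 1).
    by field; rewrite gt_eqF//; lra.
  by apply: ler_pM.
have a2 : `|s - t| * `|f x| * `|G s x - G t x| <= e / 2 * `|s - t|.
  have -> : e / 2 * `|s - t| = `|s - t| * M * (e / (2 * M)).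
    by field; rewrite gt_eqF.
  apply: ler_pM; [exact: mulr_ge0|exact: normr_ge0| |exact: h3].
  by apply: ler_wpM2l => //; exact: hM.
lra.
Unshelve. all: by end_near. Qed.

Lemma ud_shift F t f g : bdd g -> ud F t f -> ud (fun s x => F s x + g x) t f.
Proof.
move=> bg [bF bf hF]; split=> //; first exact: bddD.
move=> e e0; apply: filterS (hF e e0) => s hs x Dx.
by have := hs x Dx; congr (`| _ | <= _); ring.
Qed.

Lemma ud_ext F G t f g : (forall s x, D x -> F s x = G s x) -> (forall x, D x -> f x = g x) ->
  ud F t f -> ud G t g.
Proof.
move=> hF hf [[M M0 hM] [N N0 hN] h]; split.
- by exists M => // x Dx; rewrite -hF//; exact: hM.
- by exists N => // x Dx; rewrite -hf//; exact: hN.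
- move=> e /h; apply: filterS => s hs x Dx; have := hs x Dx.
  by rewrite !hF// hf.
Qed.

Lemma udM F G t f g : ud F t f -> ud G t g ->
  ud (fun s x => F s x * G s x) t (fun x => f x * G t x + F t x * g x).
Proof.
move=> hF hG.
have h1 := udM0 hF (ud_uc hG).
have [bF _ _] := hF; have [bG _ _] := hG.
have ucF : uc (fun=> F t) t.
  by split=> // e e0; near=> s => x _; rewrite subrr normr0 ltW.
have h2 := udM0 hG ucF.
apply: ud_ext (ud_shift (bddM bF bG) (udD h1 h2)) => [s x Dx|x Dx]; ring.
Unshelve. all: by end_near. Qed.

Lemma udN F t f : ud F t f -> ud (fun s x => - F s x) t (fun x => - f x).
Proof.
move=> hF; have := udM (ud_cst t (bdd_cst (-1))) hF.
by apply: ud_ext => [s x _|x _]; ring.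
Qed.
Lemma udB F G t f g : ud F t f -> ud G t g ->
  ud (fun s x => F s x - G s x) t (fun x => f x - g x).
Proof. by move=> hF /udN; exact: udD. Qed.

End UniformDerivative.

Section UdReal.
Context {R : realType}.

Lemma ud_is_derive (f : R -> R) t d :
  ud (fun _ : unit => True) (fun s _ => f s) t (fun=> d) <-> is_derive t (1 : R) f d.
Proof.
split=> [[_ _ h]|hd].
  have hc : h^-1 *: ((f \o shift t) (h *: (1 : R)) - f t) @[h --> 0^'] --> d.
    apply/cvgrPdist_le => e e0.
    have := h e e0; case=> r /= r0 hr.
    exists r => //= u; rewrite /ball_/= sub0r normrN => ur u0.
    have := hr (u + t) _ tt Logic.I; rewrite /= /GRing.scale/= mulr1 opprD addrCA subrr addr0 normrN.
    move=> /(_ ur); rewrite addrK.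
    have -> : f (u + t) - f t - u * d = - u * (d - u^-1 * (f (u + t) - f t)) by field.
    rewrite normrM normrN mulrC ler_pM2r ?normr_gt0//.
  by apply: DeriveDef; [apply/cvg_ex; exists d|exact/cvg_lim].
have h1 := @ex_derive _ _ _ _ _ _ _ hd.
have h2 := @derive_val _ _ _ _ _ _ _ hd.
split; [exact: bdd_cst|exact: bdd_cst|] => e e0.
have : h^-1 *: ((f \o shift t) (h *: (1 : R)) - f t) @[h --> 0^'] --> d.
  by rewrite -h2; exact: h1.
move=> /cvgrPdist_le/(_ _ e0); case=> r /= r0 hr.
exists r => //= s; rewrite /ball_/= => hs _ _.
have [->|st] := eqVneq s t; first by rewrite !subrr mul0r subr0 normr0 mulr0.
have st0 : s - t != 0 by rewrite subr_eq0.
have := hr (s - t); rewrite /ball_/= sub0r normrN distrC => /(_ hs st0).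
rewrite /GRing.scale/= mulr1 subrK => hh.
have -> : f s - f t - (s - t) * d = - (s - t) * (d - (s - t)^-1 * (f s - f t)) by field.
by rewrite normrM normrN mulrC [in leRHS]distrC; apply: ler_wpM2r.
Qed.

Definition inI (y : R) : Prop := -1 <= y <= 1.
Local Notation C := (@cfct R).

Lemma bdd_cfct (f : C) : bdd inI f.
Proof. by have [M M0 hM] := cf_bdd f (-1) 1; exists M. Qed.

Lemma ud_I (F : R -> C) t (f : C) : ud inI F t f -> is_derive t (1 : R) (fun s => I (F s)) (I f).
Proof.
move=> [_ _ h]; apply/ud_is_derive; split; [exact: bdd_cst|exact: bdd_cst|] => e e0.
have e2 : 0 < e / 2 by lra.
apply: filterS (h _ e2) => s hs _ _.
rewrite -IZ -!IB.
have -> : e * `|s - t| = 2 * (e / 2 * `|s - t|) by field.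
by apply: I_small => y hy; rewrite !cfB cfM ccE; exact: hs.
Qed.

Lemma ud_I_eq (F : R -> C) (G : R -> R) t (f : C) d : ud inI F t f ->
  (forall s, G s = I (F s)) -> d = I f -> is_derive t (1 : R) G d.
Proof. by move=> h hG ->; rewrite (_ : G = (fun s => I (F s))); [exact: ud_I|exact/funext]. Qed.

End UdReal.

Section KernelCalculus.
Context {R : realType}.
Local Notation C := (@cfct R).
Implicit Types f g h K V u : C.

Lemma invC_cont u (hu : forall x, u x != 0) : continuous (fun x => (u x)^-1).
Proof. by move=> x; apply: continuousV; [exact: hu|exact: cfct_cont]. Qed.
Definition invC u hu : C := mkC (@invC_cont u hu).
Lemma invCE u hu x : @invC u hu x = (u x)^-1. Proof. by []. Qed.
Lemma mulVC u hu : @invC u hu * u = 1.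
Proof. by apply: cfctP => x; rewrite cfM cf1 /= mulVf. Qed.
Lemma expC_cont u : continuous (fun x => expR (u x)).
Proof. by move=> x; apply: continuous_comp; [exact: cfct_cont|exact: continuous_expR]. Qed.
Definition expC u : C := mkC (@expC_cont u).
Lemma csqrt_cont u : continuous (fun x => Num.sqrt (u x)).
Proof. by move=> x; apply: continuous_comp; [exact: cfct_cont|exact: sqrt_continuous]. Qed.
Definition csqrt u : C := mkC (@csqrt_cont u).
Lemma atanC_cont u : continuous (fun x => atan (u x)).
Proof. by move=> x; apply: continuous_comp; [exact: cfct_cont|exact: continuous_atan]. Qed.
Definition atanC u : C := mkC (@atanC_cont u).
Lemma cosC_cont u : continuous (fun x => cos (u x)).
Proof. by move=> x; apply: continuous_comp; [exact: cfct_cont|exact: continuous_cos]. Qed.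
Definition cosC u : C := mkC (@cosC_cont u).
Lemma sinC_cont u : continuous (fun x => sin (u x)).
Proof. by move=> x; apply: continuous_comp; [exact: cfct_cont|exact: continuous_sin]. Qed.
Definition sinC u : C := mkC (@sinC_cont u).

Lemma expCE u x : expC u x = expR (u x). Proof. by []. Qed.
Lemma atanCE u x : atanC u x = atan (u x). Proof. by []. Qed.
Lemma cosCE u x : cosC u x = cos (u x). Proof. by []. Qed.
Lemma sinCE u x : sinC u x = sin (u x). Proof. by []. Qed.

Lemma derR_id : derR (idC : C) 1.
Proof. by move=> x; exact: is_derive_id. Qed.
Lemma derR_cc c : derR (cc c : C) 0.
Proof. by move=> x; exact: is_derive_cst. Qed.
Lemma derRD f f' g g' : derR f f' -> derR g g' -> derR (f + g) (f' + g').
Proof. by move=> hf hg x; apply: is_deriveD. Qed.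
Lemma derRN f f' : derR f f' -> derR (- f) (- f').
Proof. by move=> hf x; apply: is_deriveN. Qed.
Lemma derRM f f' g g' : derR f f' -> derR g g' -> derR (f * g) (f' * g + f * g').
Proof.
move=> hf hg y; have := is_deriveM (hf y) (hg y).
by rewrite cfD !cfM => h; apply: is_derive_eq h _; rewrite /GRing.scale/=; ring.
Qed.
Lemma derR_inv f f' hf : derR f f' -> derR (@invC f hf) (- (f' * (@invC f hf * @invC f hf))).
Proof.
move=> h x; apply: is_derive_eq (is_deriveV (hf x) (h x)) _.
by rewrite cfN !cfM/= /GRing.scale/= -exprVn; ring.
Qed.
Lemma derR_comp (G : R -> R) f f' (g : C) (Gf : C) : (forall x, Gf x = G (f x)) ->
  (forall x, is_derive (f x) (1 : R) G (g x)) -> derR f f' -> derR Gf (f' * g).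
Proof.
move=> hG hg hf x; have := @is_derive1_comp R G f x _ _ (hg x) (hf x).
rewrite (_ : G \o f = Gf); last by apply/funext => y /=; rewrite hG.
by move=> h; apply: is_derive_eq h _; rewrite cfM mulrC.
Qed.

(** The mean value theorem on the segment from [x] to [x + u] reduces the claim to continuity of
    [K1], made uniform over the compact set by [tube]. *)
Lemma unif_frechet K K1 (M e : R) : derR K K1 -> 0 < e ->
  exists2 d, 0 < d & forall x u : R, `|x| <= M -> `|u| < d ->
    `|K (x + u) - K x - K1 x * u| <= e * `|u|.
Proof.
move=> hK e0.
have hc (y : R) : - M <= y <= M -> {for (0, y), continuous (fun p : R * R => K1 (p.2 + p.1))}.
  move=> _; apply: (@continuous_comp _ _ _ (fun p : R * R => p.2 + p.1) K1); last exact: cfct_cont.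
  by apply: cvgD; [exact: cvg_snd|exact: cvg_fst].
have := tube e0 hc; case=> d /= d0 hd; exists d => // x u xM ud.
have hphi (z : R) : z \in `]0, 1[ ->
    is_derive z (1 : R) (fun z => K (x + z * u)) (K1 (x + z * u) * u).
  move=> _.
  have h1 : is_derive z (1 : R) (fun z => x + z * u) u.
    have h := is_deriveD (is_derive_cst x z (1 : R)) (is_deriveM (is_derive_id z (1 : R)) (is_derive_cst u z (1 : R))).
    by apply: is_derive_eq h _; rewrite /GRing.scale/=; ring.
  exact: (@is_derive1_comp R K (fun z => x + z * u) z _ _ (hK _) h1).
have hcont : {within `[0, 1], continuous (fun z => K (x + z * u))}.
  apply: continuous_subspaceT => z.
  apply: (@continuous_comp R R R (fun z : R => x + z * u) K z); last exact: cfct_cont.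
  apply: cvgD; first exact: cvg_cst.
  by apply: cvgM; [exact: cvg_id|exact: cvg_cst].
have [c hc1 E] := MVT ltr01 hphi hcont.
move: E; rewrite mul1r mul0r addr0 subr0 mulr1 => ->.
rewrite -mulrBl normrM; apply: ler_wpM2r => //; apply: ltW.
have hcu : ball_ Num.norm 0 d (c * u).
  move: hc1; rewrite in_itv/= => /andP[c0 c1]; rewrite /ball_/= sub0r normrN.
  by rewrite normrM gtr0_norm//; apply: le_lt_trans ud; rewrite ler_piMl// ltW.
have hx : - M <= x <= M by rewrite -ler_norml.
by have := hd _ hcu x hx; rewrite /= addr0.
Qed.

Lemma ud_comp (X : Type) (D : X -> Prop) (F : R -> X -> R) t (f : X -> R) K K1 : derR K K1 ->
  ud D F t f -> ud D (fun s x => K (F s x)) t (fun x => K1 (F t x) * f x).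
Proof.
move=> hK hF; have [_ hc] := ud_uc hF; have [[M M0 hM] [N N0 hN] hf] := hF.
have [B B0 hB] := cf_bdd K (- M) M.
have [B1 B10 hB1] := cf_bdd K1 (- M) M.
split.
- by exists B => // x Dx; apply: hB; rewrite -ler_norml; exact: hM.
- by apply: bddM; [exists B1 => // x Dx; apply: hB1; rewrite -ler_norml; exact: hM|exists N].
move=> e e0.
have e1 : 0 < e / (2 * (N + 1)) by apply: divr_gt0 => //; lra.
have e2 : 0 < e / (2 * B1) by apply: divr_gt0 => //; lra.
have [d d0 hd] := unif_frechet M hK e1.
have d2 : 0 < d / 2 by lra.
near=> s.
have H1 : forall x, D x -> `|F s x - F t x| <= d / 2 by near: s; exact: hc.
have H2 : forall x, D x -> `|F s x - F t x - (s - t) * f x| <= e / (2 * B1) * `|s - t|.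
  by near: s; exact: hf.
have H3 : forall x, D x -> `|F s x - F t x - (s - t) * f x| <= 1 * `|s - t|.
  by near: s; exact: hf.
move=> x Dx; have h1 := H1 x Dx; have h2 := H2 x Dx; have h3 := H3 x Dx.
have hu : `|F s x - F t x| <= (N + 1) * `|s - t|.
  have -> : F s x - F t x = (F s x - F t x - (s - t) * f x) + (s - t) * f x by ring.
  apply: le_trans (ler_normD _ _) _; rewrite normrM.
  have := hN x Dx; have := normr_ge0 (s - t); nra.
have h4 : `|K (F s x) - K (F t x) - K1 (F t x) * (F s x - F t x)| <= e / 2 * `|s - t|.
  have := hd (F t x) (F s x - F t x) (hM x Dx); rewrite (_ : F t x + (F s x - F t x) = F s x); last by ring.
  move=> h; apply: le_trans (h _) _; first lra.
  have -> : e / 2 * `|s - t| = e / (2 * (N + 1)) * ((N + 1) * `|s - t|).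
    by field; rewrite gt_eqF//; lra.
  by apply: ler_wpM2l => //; exact: ltW.
have h5 : `|K1 (F t x) * (F s x - F t x - (s - t) * f x)| <= e / 2 * `|s - t|.
  have -> : e / 2 * `|s - t| = B1 * (e / (2 * B1) * `|s - t|) by field; rewrite gt_eqF.
  rewrite normrM; apply: ler_pM => //; apply: hB1; rewrite -ler_norml; exact: hM.
have -> : K (F s x) - K (F t x) - (s - t) * (K1 (F t x) * f x) =
  (K (F s x) - K (F t x) - K1 (F t x) * (F s x - F t x))
  + K1 (F t x) * (F s x - F t x - (s - t) * f x) by ring.
apply: le_trans (ler_normD _ _) _; lra.
Unshelve. all: by end_near. Qed.

Definition inI2 (p : R * R) : Prop := inI p.1 /\ inI p.2.

Lemma ud_fst (F : R -> R -> R) t (f : R -> R) : ud inI F t f -> ud inI2 (fun s p => F s p.1) t (fun p => f p.1).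
Proof.
move=> [[M M0 hM] [N N0 hN] h]; split.
- by exists M => // p [Dp _]; exact: hM.
- by exists N => // p [Dp _]; exact: hN.
- by move=> e e0; apply: filterS (h e e0) => s hs p [Dp _]; exact: hs.
Qed.
Lemma ud_snd (F : R -> R -> R) t (f : R -> R) : ud inI F t f -> ud inI2 (fun s p => F s p.2) t (fun p => f p.2).
Proof.
move=> [[M M0 hM] [N N0 hN] h]; split.
- by exists M => // p [_ Dp]; exact: hM.
- by exists N => // p [_ Dp]; exact: hN.
- by move=> e e0; apply: filterS (h e e0) => s hs p [_ Dp]; exact: hs.
Qed.

Lemma ud_int (Phi : R -> R -> C) (phi : R -> C) (G : R -> C) (g : C) t :
  ud inI2 (fun s p => Phi s p.1 p.2) t (fun p => phi p.1 p.2) ->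
  (forall s y, G s y = I (Phi s y)) -> (forall y, g y = I (phi y)) ->
  ud inI G t g.
Proof.
move=> [_ _ h] hG hg; split; [exact: bdd_cfct|exact: bdd_cfct|] => e e0.
have e2 : 0 < e / 2 by lra.
apply: filterS (h _ e2) => s hs y hy.
rewrite !hG hg -IZ -!IB (_ : e * `|s - t| = 2 * (e / 2 * `|s - t|)); last by field.
by apply: I_small => z hz; rewrite !cfB cfM ccE; exact: (hs (y, z)).
Qed.

(** The kernel [K (V y - V z)] varies in time by [K1] times [V1 y - V1 z], whence one term with [V1]
    outside the operator and one with [V1] inside. *)
Lemma T_ud K K1 (V F : R -> C) t (V1 f : C) : derR K K1 -> ud inI V t V1 -> ud inI F t f ->
  ud inI (fun s => T K (V s) (F s)) t
    (T K (V t) f + V1 * T K1 (V t) (F t) - T K1 (V t) (V1 * F t)).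
Proof.
move=> hK hV hF.
have h1 := ud_comp hK (udB (ud_fst hV) (ud_snd hV)).
have h2 := udM h1 (ud_snd hF).
pose phi (y : R) := ker K (V t) y * f + (cc (V1 y) * (ker K1 (V t) y * F t) - ker K1 (V t) y * (V1 * F t)).
apply: (@ud_int (fun s y => ker K (V s) y * F s) phi) => //.
  by apply: ud_ext h2 => // -[y z] _; rewrite /phi !(cfD, cfM, cfN, ccE)/=; ring.
  by move=> s y; exact: TE.
by move=> y; rewrite !(cfD, cfM, cfN) !TE /phi ID IB IZ; ring.
Qed.

End KernelCalculus.

(** * The kernels *)

(* Products of continuous functions elaborated through different structure paths are
   convertible but not syntactically equal, whence the [change]. *)
Ltac genI := repeat match goal with |- context [I ?f] =>
  let x := fresh "x" in pose x := I f;
  repeat match goal with |- context [I ?g] => progress change (I g) with x end;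
  clearbody x end.
Ltac ilra := repeat match goal with H : context [I _] |- _ => revert H end;
  repeat match goal with H : context [cval _ _] |- _ => clear H end;
  genI; repeat match goal with |- context [cval ?f ?y] => generalize (cval f y) end; intros; lra.

#[global] Arguments cval : simpl never.
Section KernelBounds.
Context {R : realType}.
Local Notation C := (@cfct R).
Local Notation leb := (@lebesgue_measure R).
Implicit Types f g h p q K V u : C.

Lemma cmulDr f g h : f * (g + h) = f * g + f * h. Proof. exact: mulrDr. Qed.
Lemma cmulBr f g h : f * (g - h) = f * g - f * h. Proof. exact: mulrBr. Qed.
Lemma cmulDl f g h : (g + h) * f = g * f + h * f. Proof. exact: mulrDl. Qed.
Lemma cmulBl f g h : (g - h) * f = g * f - h * f. Proof. exact: mulrBl. Qed.
Lemma cmulC f g : f * g = g * f. Proof. exact: mulrC. Qed.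

Lemma prim_eq_l f g y : -1 <= y <= 1 -> (forall z, -1 <= z <= y -> f z = g z) ->
  prim f y = prim g y.
Proof.
move=> hy h; rewrite !primE//; apply: eq_Rintegral => z; rewrite inE/= in_itv/=; exact: h.
Qed.
Lemma prim_eq_r f g y : -1 <= y <= 1 -> (forall z, y <= z <= 1 -> f z = g z) ->
  I f - prim f y = I g - prim g y.
Proof.
move=> hy h; rewrite -!prim_r.
have [->|y1] := eqVneq y 1; first by rewrite !subrr.
have {}y1 : y < 1 by rewrite lt_neqAle y1; case/andP: hy.
pose u := f - g; pose v := prim f - prim g.
have hd : der v u := derB (der_prim f) (der_prim g).
have [|c hc] := @MVT R v u y 1 y1 _ (continuous_subspaceT (@cfct_cont R v)).
  by move=> z; rewrite in_itv/= => /andP[z1 z2]; apply: hd; rewrite z2 andbT; lra.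
move: hc; rewrite in_itv/= => /andP[c1 c2].
have -> : u c = 0 by rewrite cfB h ?subrr//; apply/andP; split; lra.
by rewrite mul0r => /eqP; rewrite subr_eq0 !cfB => /eqP; lra.
Qed.

Lemma primZ c f y : prim (cc c * f) y = c * prim f y.
Proof. by rewrite -RintegralZl//; exact: cfct_int. Qed.

Lemma der_incr V V' y z : der V V' -> (forall y, -1 <= y <= 1 -> 0 <= V' y) ->
  -1 <= z -> z <= y -> y <= 1 -> V z <= V y.
Proof.
move=> hV hp h1 h2 h3; have [->//|zy] := eqVneq z y.
have {}zy : z < y by rewrite lt_neqAle zy.
have [|c hc] := @MVT R V V' z y zy _ (continuous_subspaceT (@cfct_cont R V)).
  by move=> x; rewrite in_itv/= => /andP[z1 z2]; apply: hV; apply/andP; split; lra.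
move: hc; rewrite in_itv/= => /andP[c1 c2] E.
rewrite -subr_ge0 E; apply: mulr_ge0; last lra.
by apply: hp; apply/andP; split; lra.
Qed.

(** On an interval of length 2 the squared [L^1] norm is at most twice the squared [L^2] norm. This
    serves where uniformity in [e] is not at stake or where [B] is small. *)
Lemma T_crude K V p q B : 0 <= B ->
  (forall y z, -1 <= y <= 1 -> -1 <= z <= 1 -> `|K (V y - V z)| <= B) ->
  `|I (q * T K V p)| <= B * (I (p * p) + I (q * q)).
Proof.
move=> B0 hB.
have h1 : `|I (q * T K V p)| <= I (absC q) * (B * I (absC p)).
  apply: le_trans (I_abs _) _.
  have -> : I (absC q) * (B * I (absC p)) = I (cc (B * I (absC p)) * absC q) by rewrite IZ mulrC.
  apply: I_le => y hy.
  rewrite absCE !cfM ccE absCE normrM mulrC; apply: ler_wpM2r => //.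
  rewrite TE; apply: le_trans (I_abs _) _; rewrite -IZ; apply: I_le => z hz.
  rewrite absCE !cfM ccE absCE normrM; apply: ler_wpM2r => //; exact: hB.
apply: le_trans h1 _; have := Iabs_sq p; have := Iabs_sq q.
set a := I (absC p); set b := I (absC q); set P := I _; set Q := I _ => hq hp.
have := sqr_ge0 (a - b); nra.
Qed.

Definition kexp (k : R) : C := expC (- (cc k * absC idC)).
Lemma kexpE k x : kexp k x = expR (- (k * `|x|)). Proof. by []. Qed.

(* [T (kexp k) V p = P + Q] with [P' = p - k V' P] and [Q' = k V' Q - p], so that
   [p * (P + Q)] is a derivative plus [k V' (P^2 + Q^2)]. *)
Lemma D_lower k V V' p : 0 < k -> der V V' -> (forall y, -1 <= y <= 1 -> 0 <= V' y) ->
  exists P : C, [/\ der P (p - cc k * (V' * P)), P (-1) = 0 &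
    P 1 ^+ 2 / 2 + k * I (V' * (P * P)) <= I (p * T (kexp k) V p)].
Proof.
move=> k0 hV hp.
have dE (c : R) : der (expC (cc c * V)) (cc c * (V' * expC (cc c * V))).
  move=> y hy.
  have h1 : is_derive y (1 : R) (cc c * V) (c * V' y).
    have := derM (der_cc c) hV hy; rewrite mul0r add0r; exact.
  have := @is_derive1_comp R expR (cc c * V) y _ _ (is_derive_expR _) h1.
  by move=> h; apply: is_derive_eq h _; rewrite !(cfM, ccE, expCE); ring.
have EE (c : R) : expC (cc c * V) * expC (cc (- c) * V) = 1.
  by apply: cfctP => y; rewrite cfM /= -expRD -mulrDl subrr mul0r expR0.
pose Ep := expC (cc k * V); pose Em := expC (cc (- k) * V).
have E1 : Em * Ep = 1 by rewrite mulrC; exact: EE.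
have dp : der Ep (cc k * (V' * Ep)) by exact: dE.
have dm : der Em (- (cc k * (V' * Em))).
  by apply: der_eq (dE (- k)) _; rewrite -/Em; clearbody Em; rewrite rmorphN mulNr.
(* As [V] is increasing, [exp (- k |V y - V z|)] factors on either side of the diagonal: [P]
   collects the part [z <= y] and [Q] the part [z >= y]. *)
pose P := Em * prim (p * Ep).
pose Q := Ep * (cc (I (p * Em)) - prim (p * Em)).
have dP : der P (p - cc k * (V' * P)).
  apply: der_eq (derM dm (der_prim _)) _; rewrite /P.
  have -> : Em * (p * Ep) = p by rewrite mulrCA E1 mulr1.
  ring.
have dQ : der Q (cc k * (V' * Q) - p).
  apply: der_eq (derM dp (derB (der_cc _) (der_prim _))) _; rewrite /Q.
  have e2 : Ep * (0 - p * Em) = - p by rewrite sub0r mulrN mulrCA [Ep * Em]mulrC E1 mulr1.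
  rewrite e2; ring.
have P0 : P (-1) = 0 by rewrite cfM prim_l mulr0.
have Q0 : Q 1 = 0 by rewrite cfM cfB prim_r subrr mulr0.
exists P; split => //.
have TPQ y : -1 <= y <= 1 -> T (kexp k) V p y = P y + Q y.
  move=> hy; rewrite TE; set g := ker _ V y * p.
  have h1 : prim g y = P y.
    have -> : prim g y = prim (cc (Em y) * (p * Ep)) y.
      apply: prim_eq_l => // z hz; rewrite /g !cfM !ccE kerE kexpE mulrC.
      rewrite ger0_norm; last by rewrite subr_ge0; apply: (der_incr hV hp); lra.
      rewrite !expCE !cfM !ccE mulrCA -expRD; congr (_ * expR _); ring.
    by rewrite primZ [P y]cfM.
  have h2 : I g - prim g y = Q y.
    rewrite (@prim_eq_r g (cc (Ep y) * (p * Em)))//.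
      by rewrite IZ primZ [Q y]cfM cfB ccE mulrBr.
    move=> z hz; rewrite /g !cfM !ccE kerE kexpE mulrC.
    rewrite ler0_norm; last by rewrite subr_le0; apply: (der_incr hV hp); lra.
    rewrite !expCE !cfM !ccE mulrCA -expRD; congr (_ * expR _); ring.
  by rewrite -h1 -h2 addrC subrK.
clearbody P Q.
have -> : I (p * T (kexp k) V p) = I (p * P) + I (p * Q).
  rewrite -(ID (p * P)); apply: I_eq => y hy.
  by rewrite cfD !cfM (TPQ y hy) mulrDr.
have iP : I (p * P) = P 1 ^+ 2 / 2 + k * I (V' * (P * P)).
  have := I_der (derM dP dP); rewrite !cfM P0 => h.
  have := h; have -> : (p - cc k * (V' * P)) * P + P * (p - cc k * (V' * P)) =
    cc 2 * (p * P) - cc (2 * k) * (V' * (P * P)) by ring.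
  rewrite IB !IZ; lra.
have iQ : I (p * Q) = Q (-1) ^+ 2 / 2 + k * I (V' * (Q * Q)).
  have := I_der (derM dQ dQ); rewrite !cfM Q0 => h.
  have := h; have -> : (cc k * (V' * Q) - p) * Q + Q * (cc k * (V' * Q) - p) =
    cc (2 * k) * (V' * (Q * Q)) - cc 2 * (p * Q) by ring.
  rewrite IB !IZ; lra.
rewrite iP iQ lerDl addr_ge0 ?divr_ge0 ?sqr_ge0//.
apply: mulr_ge0; first exact: ltW.
apply: I_ge0 => y hy; rewrite !cfM; apply: mulr_ge0; first exact: hp.
by rewrite -expr2 sqr_ge0.
Qed.

Lemma derR_even_odd K K1 : derR K K1 -> (forall x, K (- x) = K x) -> forall x, K1 (- x) = - K1 x.
Proof.
move=> h hK x.
have h1 : is_derive x (1 : R) (fun z : R => K (- z)) (- K1 (- x)).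
  have := @is_derive1_comp R K (fun z => - z) x _ _ (h (- x)) (is_deriveN (is_derive_id x (1 : R))).
  by move=> h2; apply: is_derive_eq h2 _; rewrite mulrN1.
have e : (fun z : R => K (- z)) = K by apply/funext.
rewrite e in h1.
by have := @derive_val _ _ _ _ _ _ _ h1; rewrite (@derive_val _ _ _ _ _ _ _ (h x)) => ->; rewrite opprK.
Qed.
Lemma derR_odd_even K K1 : derR K K1 -> (forall x, K (- x) = - K x) -> forall x, K1 (- x) = K1 x.
Proof.
move=> h hK x.
have h1 : is_derive x (1 : R) (fun z : R => K (- z)) (- K1 (- x)).
  have := @is_derive1_comp R K (fun z => - z) x _ _ (h (- x)) (is_deriveN (is_derive_id x (1 : R))).
  by move=> h2; apply: is_derive_eq h2 _; rewrite mulrN1.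
have e : (fun z : R => K (- z)) = - K :> (R -> R) by apply/funext.
rewrite e in h1.
have h3 := is_deriveN (h x).
have := @derive_val _ _ _ _ _ _ _ h1; rewrite (@derive_val _ _ _ _ _ _ _ h3).
by move=> /oppr_inj ->.
Qed.

Section CauchyKernels.
Variables (k e eta : R).
Hypotheses (k0 : 0 < k) (e0 : 0 < e) (eta0 : 0 < eta).

Definition den : C := cc (e ^+ 2) + idC * idC.
Lemma den_gt0 x : 0 < den x.
Proof. by rewrite cfD cfM ccE/= -expr2 ltr_wpDr ?sqr_ge0// exprn_gt0. Qed.
Lemma den_even x : den (- x) = den x.
Proof. by rewrite !cfD !cfM /= mulrNN. Qed.
Lemma den_neq0 x : den x != 0. Proof. by rewrite gt_eqF// den_gt0. Qed.
Definition iden : C := invC den_neq0.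
Definition rad : C := cc (eta ^+ 2) + idC * idC.
Definition hk : C := expC (- (cc k * csqrt rad)).
(** The Poisson kernel up to the factor [1 / pi]. *)
Definition Kp : C := cc e * iden.
Definition Kc : C := hk * Kp.
Definition Ks : C := idC * (hk * iden).

Lemma idC_Kc : idC * Kc = cc e * Ks.
Proof. rewrite /Kc /Ks /Kp; ring. Qed.
Lemma idC_Ks : idC * Ks = hk - cc e * Kc.
Proof.
have h : iden * den = 1 by exact: mulVC.
rewrite /Ks /Kc /Kp -[X in X - _]mulr1 -h /den; ring.
Qed.

Lemma radE x : rad x = eta ^+ 2 + x ^+ 2. Proof. by rewrite cfD cfM ccE/= expr2. Qed.
Lemma rad_gt0 x : 0 < rad x.
Proof. by rewrite radE ltr_wpDr ?sqr_ge0// exprn_gt0. Qed.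
Lemma hkE x : hk x = expR (- (k * Num.sqrt (rad x))). Proof. by []. Qed.
Lemma hk_even x : hk (- x) = hk x. Proof. by rewrite !hkE !radE sqrrN. Qed.
Lemma iden_even x : iden (- x) = iden x.
Proof. by rewrite !invCE den_even. Qed.
Lemma Kc_even x : Kc (- x) = Kc x. Proof. by rewrite !cfM hk_even iden_even !ccE. Qed.
Lemma Ks_odd x : Ks (- x) = - Ks x. Proof. by rewrite !cfM hk_even iden_even mulNr. Qed.
Lemma iden_gt0 x : 0 < iden x. Proof. by rewrite /= invr_gt0 den_gt0. Qed.
Lemma hk_gt0 x : 0 < hk x. Proof. exact: expR_gt0. Qed.
Lemma hk_le1 x : hk x <= 1.
Proof. by rewrite hkE -expR0 ler_expR oppr_le0 mulr_ge0 ?sqrtr_ge0 ?ltW. Qed.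

(** The square root exceeds [|x|] by at most [eta], and the exponential is 1-Lipschitz on the
    negative half-line. *)
Lemma hk_kexp x : `|hk x - kexp k x| <= k * eta.
Proof.
rewrite hkE kexpE radE; set r := Num.sqrt _.
have r0 : 0 <= r by exact: sqrtr_ge0.
have r2 : r ^+ 2 = eta ^+ 2 + x ^+ 2 by rewrite sqr_sqrtr// addr_ge0 ?sqr_ge0.
have h1 : `|x| <= r.
  have := normr_ge0 x; have := real_normK (num_real x); have := sqr_ge0 eta; nra.
have h2 : r <= `|x| + eta.
  have n0 := normr_ge0 x.
  have n1 : r ^+ 2 <= (`|x| + eta) ^+ 2.
    by rewrite r2 -[x ^+ 2]real_normK ?num_real//; have := mulr_ge0 n0 (ltW eta0); nra.
  rewrite leNgt; apply/negP => hlt.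
  have := ltr_pXn2r (isT : (0 < 2)%N) (addr_ge0 n0 (ltW eta0) : _ \is Num.nneg) (r0 : r \is Num.nneg).
  by rewrite hlt ltNge n1.
have a1 : expR (- (k * r)) <= expR (- (k * `|x|)) by rewrite ler_expR lerN2 ler_wpM2l// ltW.
rewrite distrC ger0_norm ?subr_ge0//.
have := expR_ge1Dx (- (k * (r - `|x|))).
have -> : expR (- (k * r)) = expR (- (k * `|x|)) * expR (- (k * (r - `|x|))).
  by rewrite -expRD; congr expR; ring.
have : expR (- (k * `|x|)) <= 1 by rewrite -expR0 ler_expR oppr_le0; apply: mulr_ge0 => //; exact: ltW.
have := expR_gt0 (- (k * `|x|)).
set a := expR _; set b := expR _ => ap al b1.
have : k * (r - `|x|) <= k * eta by apply: ler_wpM2l; [exact: ltW|lra].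
have : 0 <= k * (r - `|x|) by apply: mulr_ge0; [exact: ltW|lra].
nra.
Qed.

Lemma derR_hk : exists h1 : C, derR hk h1.
Proof.
have s0 x : (cc 2 * csqrt rad) x != 0 by rewrite cfM ccE gt_eqF// mulr_gt0//= sqrtr_gt0 rad_gt0.
have d1 : derR rad (1 * idC + idC * 1).
  by have := derRD (derR_cc (eta ^+ 2)) (derRM derR_id derR_id); rewrite add0r.
have d2 : derR (csqrt rad) ((1 * idC + idC * 1) * invC s0).
  apply: (@derR_comp _ Num.sqrt _ _ _ _ _ _ d1) => // x /=.
  exact: is_derive1_sqrt (rad_gt0 x).
have d3 := derRN (derRM (derR_cc k) d2).
eexists; apply: (@derR_comp _ (@expR R) _ _ hk _ _ _ d3) => // x; exact: is_derive_expR.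
Qed.

Lemma derR_iden : derR iden (- ((1 * idC + idC * 1) * (iden * iden))).
Proof.
apply: derR_inv.
by have := derRD (derR_cc (e ^+ 2)) (derRM derR_id derR_id); rewrite add0r.
Qed.

Lemma derR_Kc : exists K1 : C, derR Kc K1.
Proof.
have [h1 dh] := derR_hk.
by eexists; exact: (derRM dh (derRM (derR_cc e) derR_iden)).
Qed.
Lemma derR_Ks : exists K1 : C, derR Ks K1.
Proof.
have [h1 dh] := derR_hk.
by eexists; exact: (derRM derR_id (derRM dh derR_iden)).
Qed.

Lemma derR_atan : derR (atanC (cc e^-1 * idC)) Kp.
Proof.
move=> x; pose u : C := cc e^-1 * idC.
have h1 : is_derive x (1 : R) u e^-1.
  by have := derRM (derR_cc e^-1) derR_id x; rewrite mul0r add0r mulr1 ccE.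
have := @is_derive1_comp R (@atan R) u x _ _ (is_derive1_atan _) h1.
move=> h2; apply: is_derive_eq h2 _.
have hd : den x = e ^+ 2 + x * x by rewrite /den cfD cfM ccE.
have en : e != 0 by rewrite gt_eqF.
have dp : 1 + (e^-1 * x) ^+ 2 != 0 by rewrite gt_eqF// ltr_wpDr ?sqr_ge0.
rewrite /u !(cfM, ccE, invCE, idCE) hd.
have -> : e ^+ 2 + x * x = e ^+ 2 * (1 + (e^-1 * x) ^+ 2) by field.
have aux (d : R) : d != 0 -> d^-1 / e = e / (e ^+ 2 * d) by move=> dn; field; rewrite dn.
exact: aux dp.
Qed.

Variables (V V' : C).
Hypotheses (hV : der V V') (hV' : forall y, -1 <= y <= 1 -> 1 / 2 <= V' y <= 3 / 2).

(** With the weight [V'], the integrand is minus the [z]-derivative of an arctangent, so the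
    integral is at most [pi], hence 4, whatever [e] is. Removing the weight costs a factor 2 because
    [V' >= 1 / 2]. *)
Lemma Kp_int y : T Kp V 1 y <= 8.
Proof.
rewrite TE mulr1.
have := I_der (ker_der y derR_atan hV).
rewrite IN !kerE !atanCE => h.
have h1 : I (V' * ker Kp V y) <= 4.
  have a1 := atan_gtNpi2 ((cc e^-1 * idC) (V y - V 1)).
  have a2 := atan_ltpi2 ((cc e^-1 * idC) (V y - V (-1))).
  have p2 := pihalf_lt2 R.
  move: h a1 a2; lra.
apply: (@le_trans _ _ (2 * I (V' * ker Kp V y))); last lra.
rewrite -IZ; apply: I_le => z hz; rewrite !cfM ccE.
have := hV' hz; have : 0 < ker Kp V y z by rewrite /= mulr_gt0//= invr_gt0 den_gt0.
set a := ker _ _ _ _; nra.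
Qed.

(** Schur's test: [q p <= (q^2 + p^2) / 2] under the kernel, whose rows and, by evenness, columns
    have mass at most 8. *)
Lemma schur K p q : (forall x, K (- x) = K x) -> (forall x, 0 <= K x <= Kp x) ->
  I (q * T K V p) <= 4 * (I (p * p) + I (q * q)).
Proof.
move=> Ke hK.
have h1 y : T K V 1 y <= 8.
  apply: le_trans (Kp_int y); rewrite !TE; apply: I_le => z hz.
  by rewrite !mulr1; have /andP[] := hK (V y - V z).
have h2 : I (q * T K V p) <= I (cc (1/2) * ((q * q) * T K V 1 + T K V (p * p))).
  apply: I_le => y hy; rewrite !(cfM, cfD) ccE !TE mulr1.
  have -> : q y * I (ker K V y * p) = I (ker K V y * (cc (q y) * p)).
    by rewrite -IZ; congr I; ring.
  have -> : 1 / 2 * (q y * q y * I (ker K V y) + I (ker K V y * (p * p))) =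
     I (ker K V y * (cc (1/2 * (q y * q y)) + cc (1/2) * (p * p))).
    rewrite -!IZ -ID -IZ; congr I.
    rewrite mulrDr [in RHS]rmorphM; ring.
  apply: I_le => z hz; rewrite !(cfM, cfD) !ccE; apply: ler_wpM2l.
    by have /andP[] := hK (V y - V z).
  have := sqr_ge0 (q y - p z); nra.
apply: le_trans h2 _; rewrite IZ ID.
have h3 : I (T K V (p * p)) = I ((p * p) * T K V 1).
  by rewrite -[T K V (p * p)]mul1r (T_fubini (K' := K))// => x; rewrite Ke.
have h4 u : I (u * u * T K V 1) <= 8 * I (u * u).
  rewrite -IZ; apply: I_le => y hy; rewrite !(cfM, ccE) mulrC.
  by apply: ler_wpM2r; [rewrite -expr2 sqr_ge0|exact: h1].
rewrite h3; have := h4 p; have := h4 q; ilra.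
Qed.

Lemma Kc_bounds x : 0 <= Kc x <= Kp x.
Proof.
have := hk_gt0 x; have := hk_le1 x; have : 0 < Kp x by rewrite cfM ccE mulr_gt0// iden_gt0.
rewrite [Kc x]cfM; set a := Kp x; set b := hk x; nra.
Qed.

Lemma Tc_bound p q : I (q * T Kc V p) <= 4 * (I (p * p) + I (q * q)).
Proof. apply: schur; [exact: Kc_even|exact: Kc_bounds]. Qed.

(** The commutator of [T] with multiplication by [V] multiplies the kernel by its argument; this is
    how transport acts on the quadratic form [Q]. *)
Lemma T_idK K f : T (idC * K) V f = V * T K V f - T K V (V * f).
Proof.
apply: cfctP => y; rewrite cfB cfM !TE -IZ -IB; congr I.
apply: cfctP => z; rewrite !(cfB, cfM, ccE, kerE, idCE); ring.
Qed.

Lemma Dh_lower p : I (p * T (kexp k) V p) - 2 * (k * eta) * I (p * p) <= I (p * T hk V p).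
Proof.
have h : `|I (p * T (hk - kexp k) V p)| <= (k * eta) * (I (p * p) + I (p * p)).
  apply: T_crude; first by rewrite mulr_ge0 ?ltW.
  by move=> y z _ _; rewrite cfB; exact: hk_kexp.
move: h; rewrite TBK cmulBr IB ler_norml => /andP[h _]; ilra.
Qed.

Lemma Dk_ge0 p : 0 <= I (p * T (kexp k) V p).
Proof.
have [|P [_ _]] := @D_lower k V V' p k0 hV.
  by move=> y hy; have := hV' hy; lra.
apply: le_trans; apply: addr_ge0; first by rewrite divr_ge0 ?sqr_ge0.
apply: mulr_ge0; first exact: ltW.
apply: I_ge0 => y hy; rewrite !cfM; apply: mulr_ge0; first by have := hV' hy; lra.
by rewrite -expr2 sqr_ge0.
Qed.

End CauchyKernels.
End KernelBounds.

(** * Coercivity and boundedness of the form [Q] *)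

Section GoodKernels.
Context {R : realType}.
Local Notation C := (@cfct R).
Implicit Types f g h p q K V u : C.

Definition shear_ok (V V' : C) := der V V' /\ forall y, -1 <= y <= 1 -> 1 / 2 <= V' y <= 3 / 2.

(* [Kc] and [Ks] are the real and imaginary parts of [h(x) / (e - i x)], where
   [h(x) = exp (- k sqrt (x^2 + eta^2))] is a smooth approximation of [exp (- k |x|)]. *)
Record kernels (k e : R) (Kc Ks h Kc1 Ks1 : C) : Prop := Kernels {
  kn_c1 : derR Kc Kc1;
  kn_s1 : derR Ks Ks1;
  kn_even : forall x, Kc (- x) = Kc x;
  kn_odd : forall x, Ks (- x) = - Ks x;
  kn_idc : idC * Kc = cc e * Ks;
  kn_ids : idC * Ks = h - cc e * Kc;
  kn_schur : forall V V' p q, shear_ok V V' ->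
    I (q * T Kc V p) <= 4 * (I (p * p) + I (q * q));
  kn_D : forall V p, I (p * T (kexp k) V p) - e * I (p * p) <= I (p * T h V p) }.

Lemma kernels_exist (k e : R) : 0 < k -> 0 < e ->
  exists Kc Ks h Kc1 Ks1, kernels k e Kc Ks h Kc1 Ks1.
Proof.
(* This [eta] makes the smoothing error [2 k eta] of [Dh_lower] equal to [e]. *)
move=> k0 e0; pose eta := e / (2 * k).
have eta0 : 0 < eta by rewrite divr_gt0// mulr_gt0.
have [Kc1 hc] := derR_Kc k e0 eta0; have [Ks1 hs] := derR_Ks k e0 eta0.
exists (Kc k eta e0), (Ks k eta e0), (hk k eta), Kc1, Ks1; split => //.
- exact: Kc_even.
- exact: Ks_odd.
- exact: idC_Kc.
- exact: idC_Ks.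
- by move=> V V' p q [hV hV']; exact: (Tc_bound eta k0 e0 hV hV').
- move=> V p; have := Dh_lower k0 eta0 V p.
  have -> : 2 * (k * eta) = e by rewrite /eta; field; rewrite gt_eqF.
  exact.
Qed.

Lemma shear_ok_der V V' : shear_ok V V' -> der V V'. Proof. by case. Qed.
Lemma shear_ok_ge0 V V' : shear_ok V V' -> forall y, -1 <= y <= 1 -> 0 <= V' y.
Proof. by move=> [_ h] y /h; lra. Qed.

Section Fixed.
Variables (k e : R) (Kc Ks h Kc1 Ks1 : C).
Hypotheses (k0 : 0 < k) (e0 : 0 < e) (KN : kernels k e Kc Ks h Kc1 Ks1).

(** Here [omega = p + i q] and the kernel of [T] is [Kc + i Ks]. The two cross terms of
    [Re <omega, T omega>] coincide because [Ks] is odd, which accounts for the factor 2. *)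
Definition Q V p q := I (p * T Kc V p) + I (q * T Kc V q) + 2 * I (q * T Ks V p).

Lemma symc V p q : I (q * T Kc V p) = I (p * T Kc V q).
Proof. by apply: T_fubini => x; rewrite (kn_even KN). Qed.
Lemma antis V p q : I (q * T Ks V p) = - I (p * T Ks V q).
Proof.
rewrite (T_fubini (K' := cc (-1) * Ks)); last by move=> x; rewrite cfM ccE (kn_odd KN) mulN1r.
by rewrite TZK -[RHS]mulN1r -IZ; congr I; ring.
Qed.
Lemma antic1 V p q : I (q * T Kc1 V p) = - I (p * T Kc1 V q).
Proof.
rewrite (T_fubini (K' := cc (-1) * Kc1)); last first.
  by move=> x; rewrite cfM ccE (derR_even_odd (kn_c1 KN) (kn_even KN)) mulN1r.
by rewrite TZK -[RHS]mulN1r -IZ; congr I; ring.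
Qed.
Lemma syms1 V p q : I (q * T Ks1 V p) = I (p * T Ks1 V q).
Proof. by apply: T_fubini => x; rewrite (derR_odd_even (kn_s1 KN) (kn_odd KN)). Qed.

(** The left side is the derivative of [Q] along [p' = V q], [q' = - V p]. Symmetry of [Kc] and
    antisymmetry of [Ks] turn it into commutators with [V], that is, into the kernels [x Kc] and
    [x Ks], which [kn_idc] and [kn_ids] evaluate. *)
Lemma transportQ V p q :
  2 * I (V * q * (T Kc V p - T Ks V q)) - 2 * I (V * p * (T Kc V q + T Ks V p)) =
  e * Q V p q - (I (p * T h V p) + I (q * T h V q)).
Proof.
have h1 : I (V * q * T Kc V p) - I (V * p * T Kc V q) = e * I (q * T Ks V p).
  rewrite -(symc V (V * p) q) -(IB (V * q * _)).
  have -> : V * q * T Kc V p - q * T Kc V (V * p) = q * T (idC * Kc) V p.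
    by rewrite T_idK; ring.
  by rewrite (kn_idc KN) TZK -IZ; congr I; ring.
have h2 u : 2 * I (V * u * T Ks V u) = I (u * T h V u) - e * I (u * T Kc V u).
  have -> : 2 * I (V * u * T Ks V u) = I (V * u * T Ks V u - u * T Ks V (V * u)).
    by rewrite IB (antis V (V * u) u); ring.
  have -> : V * u * T Ks V u - u * T Ks V (V * u) = u * T (idC * Ks) V u.
    by rewrite T_idK; ring.
  rewrite (kn_ids KN) TBK TZK -IZ -(IB (u * _)); congr I; ring.
rewrite cmulBr cmulDr IB ID; have := h2 p; have := h2 q; clear h2; rewrite /Q; ilra.
Qed.

Lemma Q_deriv (V P S : R -> C) t (V1 P1 S1 : C) :
  ud inI V t V1 -> ud inI P t P1 -> ud inI S t S1 ->
  is_derive t (1 : R) (fun s => Q (V s) (P s) (S s))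
   (2 * I (P1 * (T Kc (V t) (P t) - T Ks (V t) (S t)))
    + 2 * I (S1 * (T Kc (V t) (S t) + T Ks (V t) (P t)))
    + 2 * (I (V1 * P t * T Kc1 (V t) (P t)) + I (V1 * S t * T Kc1 (V t) (S t))
           + I (V1 * S t * T Ks1 (V t) (P t)) - I (V1 * P t * T Ks1 (V t) (S t)))).
Proof.
move=> hV hP hS.
have a1 := udM hP (T_ud (kn_c1 KN) hV hP).
have a2 := udM hS (T_ud (kn_c1 KN) hV hS).
have a3 := udM hS (T_ud (kn_s1 KN) hV hP).
have b1 := @ud_I _ (fun s => P s * T Kc (V s) (P s)) t (P1 * T Kc (V t) (P t) + P t * (T Kc (V t) P1 + V1 * T Kc1 (V t) (P t) - T Kc1 (V t) (V1 * P t))) a1.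
have b2 := @ud_I _ (fun s => S s * T Kc (V s) (S s)) t (S1 * T Kc (V t) (S t) + S t * (T Kc (V t) S1 + V1 * T Kc1 (V t) (S t) - T Kc1 (V t) (V1 * S t))) a2.
have b3 := @ud_I _ (fun s => S s * T Ks (V s) (P s)) t (S1 * T Ks (V t) (P t) + S t * (T Ks (V t) P1 + V1 * T Ks1 (V t) (P t) - T Ks1 (V t) (V1 * P t))) a3.
have b4 := is_deriveD (is_deriveD b1 b2) (is_deriveZ 2 b3).
apply: is_derive_eq b4 _; rewrite /GRing.scale/=.
have e1 u u1 v : I (u1 * T Kc v u + u * (T Kc v u1 + V1 * T Kc1 v u - T Kc1 v (V1 * u)))
  = 2 * I (u1 * T Kc v u) + 2 * I (V1 * u * T Kc1 v u).
  rewrite ID cmulBr IB cmulDr ID (symc v u1 u) (antic1 v (V1 * u) u).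
  have -> : u * (V1 * T Kc1 v u) = V1 * u * T Kc1 v u by ring.
  ring.
have e3 v : I (S1 * T Ks v (P t) + S t * (T Ks v P1 + V1 * T Ks1 v (P t) - T Ks1 v (V1 * P t)))
  = I (S1 * T Ks v (P t)) - I (P1 * T Ks v (S t)) + I (V1 * S t * T Ks1 v (P t)) - I (V1 * P t * T Ks1 v (S t)).
  rewrite ID cmulBr IB cmulDr ID (antis v P1 (S t)) (syms1 v (V1 * P t) (S t)).
  have -> : S t * (V1 * T Ks1 v (P t)) = V1 * S t * T Ks1 v (P t) by ring.
  ring.
rewrite !e1 e3 cmulBr cmulDr IB ID; ring.
Qed.

(** The pair is rotated to [P s + i S s = exp(-i s V) (p + i q)], which keeps the norm [N]. By
    [transportQ] and the near positivity of the form of [h], [(Q + N)' <= e (Q + N)], so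
    [G s = exp(- e s) (Q + N)] does not increase. A negative [G 0] would force [Q] to minus
    infinity, against its boundedness in [s]. *)
Lemma Q_ge V V' p q : shear_ok V V' -> - (I (p * p) + I (q * q)) <= Q V p q.
Proof.
move=> hV.
pose c s := cosC (cc s * V); pose n s := sinC (cc s * V).
pose P s := p * c s + q * n s; pose S s := q * c s - p * n s.
have hcn s : c s * c s + n s * n s = 1.
  by apply: cfctP => y; rewrite cfD !cfM !cosCE !sinCE -!expr2 cos2Dsin2.
have udV s : ud inI (fun s => cc s * V) s V.
  split; [exact: bdd_cfct|exact: bdd_cfct|] => d d0; near=> r => y _.
  rewrite !cfM !ccE (_ : _ - _ = 0); last ring.
  by rewrite normr0 mulr_ge0// ltW.
have udc s : ud inI c s (- (V * n s)).
  have h1 := ud_comp (derR_comp (Gf := cosC idC) (g := - sinC idC) (fun x => erefl)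
     (fun x => is_derive_cos (idC x)) derR_id) (udV s).
  apply: ud_ext h1 => // y _; rewrite cfN cfM mul1r cfN mulNr; congr (- _); exact: mulrC.
have udn s : ud inI n s (V * c s).
  have h1 := ud_comp (derR_comp (Gf := sinC idC) (g := cosC idC) (fun x => erefl)
     (fun x => is_derive_sin (idC x)) derR_id) (udV s).
  apply: ud_ext h1 => // y _; rewrite cfM mul1r; exact: mulrC.
have udP s : ud inI P s (V * S s).
  have := udD (udM (ud_cst s (bdd_cfct p)) (udc s)) (udM (ud_cst s (bdd_cfct q)) (udn s)).
  apply: ud_ext => // y _; rewrite /S !(cfM, cfB, cfN); ring.
have udS s : ud inI S s (- (V * P s)).
  have := udB (udM (ud_cst s (bdd_cfct q)) (udc s)) (udM (ud_cst s (bdd_cfct p)) (udn s)).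
  apply: ud_ext => // y _; rewrite /P !(cfM, cfD, cfN); ring.
have udVc s : ud inI (fun _ : R => V) s (0 : C) := ud_cst s (bdd_cfct V).
pose N := I (p * p) + I (q * q).
have hN s : I (P s * P s) + I (S s * S s) = N.
  rewrite -(ID (P s * P s)) /N -ID; congr I; rewrite /P /S.
  have -> : (p * c s + q * n s) * (p * c s + q * n s) + (q * c s - p * n s) * (q * c s - p * n s)
    = (p * p + q * q) * (c s * c s + n s * n s) by ring.
  by rewrite hcn mulr1.
have dQ s : is_derive s (1 : R) (fun s => Q V (P s) (S s))
   (e * Q V (P s) (S s) - (I (P s * T h V (P s)) + I (S s * T h V (S s)))).
  apply: is_derive_eq (Q_deriv (udVc s) (udP s) (udS s)) _.
  rewrite -transportQ.
  have z u v : I (0 * u * v) = 0 by rewrite !mul0r -(rmorph0 cc) I_cst mulr0.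
  rewrite !z; have -> : - (V * P s) * (T Kc V (S s) + T Ks V (P s)) =
    - (V * P s * (T Kc V (S s) + T Ks V (P s))) by ring.
  rewrite IN; ring.
pose G s := expR (- e * s) * (Q V (P s) (S s) + N).
have dG s : is_derive s (1 : R) G (- expR (- e * s) * (I (P s * T h V (P s)) + I (S s * T h V (S s)) + e * N)).
  have h1 : is_derive s (1 : R) (fun s => - e * s) (- e).
    by have := is_deriveZ (- e) (is_derive_id s (1 : R)); rewrite /GRing.scale/= mulr1.
  have h2 := @is_derive1_comp R (@expR R) (fun s => - e * s) s _ _ (is_derive_expR _) h1.
  have h3 := is_deriveM h2 (is_deriveD (dQ s) (is_derive_cst N s (1 : R))).
  apply: is_derive_eq h3 _; rewrite ?fctE /GRing.scale/= /comp; ring.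
have G'le s : - expR (- e * s) * (I (P s * T h V (P s)) + I (S s * T h V (S s)) + e * N) <= 0.
  rewrite mulNr oppr_le0; apply: mulr_ge0; first exact: expR_ge0.
  have := kn_D KN V (P s); have := kn_D KN V (S s).
  have := Dk_ge0 k0 (shear_ok_der hV) (proj2 hV) (P s).
  have := Dk_ge0 k0 (shear_ok_der hV) (proj2 hV) (S s).
  rewrite -(hN s); ilra.
(* This bound may depend on [e]; only its uniformity in [s] matters. *)
have [MK MK0 hMK] : exists2 M, 0 < M & forall s, `|Q V (P s) (S s)| <= M.
  have [MV MV0 hMV] := cf_bdd V (-1) 1.
  have hb y z : -1 <= y <= 1 -> -1 <= z <= 1 -> - (2 * MV) <= V y - V z <= 2 * MV.
    by move=> hy hz; have := hMV y hy; have := hMV z hz; rewrite !ler_norml; lra.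
  have [B B0 hB] := cf_bdd Kc (- (2 * MV)) (2 * MV).
  have [B' B'0 hB'] := cf_bdd Ks (- (2 * MV)) (2 * MV).
  exists (2 * (B + B') * (N + 1)).
    apply: mulr_gt0; first by apply: mulr_gt0 => //; exact: addr_gt0.
    have N0 : 0 <= N by rewrite addr_ge0 ?Isq_ge0.
    lra.
  move=> s.
  have c1 u v := @T_crude _ Kc V u v B (ltW B0) (fun y z hy hz => hB _ (hb y z hy hz)).
  have c2 u v := @T_crude _ Ks V u v B' (ltW B'0) (fun y z hy hz => hB' _ (hb y z hy hz)).
  have := c1 (P s) (P s); have := c1 (S s) (S s); have := c2 (P s) (S s).
  clear c1 c2; have := hN s; have := Isq_ge0 (P s); have := Isq_ge0 (S s).
  have aux (x1 x2 x3 x4 x5 : R) : 0 <= x2 -> 0 <= x1 -> x1 + x2 = N ->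
      `|x5| <= B' * (x1 + x2) -> `|x4| <= B * (x2 + x2) -> `|x3| <= B * (x1 + x1) ->
      `|x3 + x4 + 2 * x5| <= 2 * (B + B') * (N + 1).
    move=> y1 y2 <-; rewrite !ler_norml => /andP[z1 z2] /andP[z3 z4] /andP[z5 z6].
    have w1 : 0 <= B * x1 by apply: mulr_ge0 => //; exact: ltW.
    have w2 : 0 <= B * x2 by apply: mulr_ge0 => //; exact: ltW.
    have w3 : 0 <= B' * x1 by apply: mulr_ge0 => //; exact: ltW.
    have w4 : 0 <= B' * x2 by apply: mulr_ge0 => //; exact: ltW.
    apply/andP; split; lra.
  exact: aux.
have G0 : G 0 = Q V p q + N.
  rewrite /G mulr0 expR0 mul1r; congr (Q V _ _ + N); rewrite /P /S /c /n; apply: cfctP => y.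
    by rewrite cfD !cfM cosCE sinCE cfM ccE mul0r cos0 sin0 mulr1 mulr0 addr0.
  by rewrite cfB !cfM cosCE sinCE cfM ccE mul0r cos0 sin0 mulr1 mulr0 subr0.
rewrite -/N -subr_ge0 opprK -G0 leNgt; apply/negP => Gneg.
have Gmono s : 0 < s -> G s <= G 0.
  move=> s0.
  have [|c0 _ E] := MVT s0 (fun x _ => dG x).
    by apply: continuous_subspaceT => x; apply/differentiable_continuous/derivable1_diffP; have [] := dG x.
  rewrite -subr_le0 E; apply: mulr_le0_ge0; first exact: G'le.
  by rewrite subr0 ltW.
(* At this time [- G 0 * (1 + e s)] equals [MK - G 0], so [exp (e s) >= 1 + e s] would push [Q + N]
   below [- MK]. *)
pose s := MK / (e * - G 0).
have gp : 0 < - G 0 by rewrite oppr_gt0.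
have s0 : 0 < s by rewrite divr_gt0// mulr_gt0.
have := Gmono s s0; apply/negP; rewrite -ltNge.
have N0 : 0 <= N by rewrite addr_ge0 ?Isq_ge0.
have h1 : - MK <= Q V (P s) (S s) + N by have := hMK s; rewrite ler_norml; lra.
have h2 : expR (- e * s) * (1 + e * s) <= 1.
  have := expR_ge1Dx (e * s); have := expR_gt0 (- e * s) => a b.
  have : expR (- e * s) * expR (e * s) = 1 by rewrite -expRD mulNr addNr expR0.
  nra.
have h3 : (- G 0) * (e * s) = MK.
  have aux (g x : R) : g != 0 -> x != 0 -> - g * (x * (MK / (x * - g))) = MK.
    by move=> gn xn; field; rewrite xn gn.
  by apply: aux; [rewrite lt_eqF|rewrite gt_eqF].
have x0 := expR_gt0 (- e * s).
have es0 : 0 < e * s by rewrite mulr_gt0.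
rewrite [ltRHS]/G.
move: h1 h2 h3 x0 es0 gp; set X := expR _; set Y := e * s; set g0 := G 0; set Z := Q V _ _ + N.
move=> h1 h2 h3 x0 es0 gp.
have : X * - MK <= X * Z by rewrite ler_pM2l.
rewrite -h3; nra.
Unshelve. all: by end_near. Qed.

(** Changing the sign of [q] flips only the cross term, so [Q_ge] at [(p, - q)] bounds that term by
    [8 + 1] times the norm; the two diagonal terms add another 8. *)
Lemma Q_le V V' p q : shear_ok V V' -> Q V p q <= 17 * (I (p * p) + I (q * q)).
Proof.
move=> hV.
have := Q_ge p (- q) hV; have := kn_schur KN p p hV; have := kn_schur KN q q hV.
rewrite /Q.
have -> : - q * - q = q * q by ring.
have -> : - q * T Kc V (- q) = q * T Kc V q by rewrite TN; ring.
have -> : - q * T Ks V p = - (q * T Ks V p) by ring.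
rewrite IN; ilra.
Qed.

(** The uniform [L^2] bound for the Hilbert-type kernel is deduced from [Q_ge] at [(p, - q)], where
    the cross term appears with the opposite sign; [9 / 2] is rounded up to 5. *)
Lemma Ts_bound V V' p q : shear_ok V V' -> I (q * T Ks V p) <= 5 * (I (p * p) + I (q * q)).
Proof.
move=> hV.
have := Q_ge p (- q) hV; have := kn_schur KN p p hV; have := kn_schur KN q q hV.
rewrite /Q.
have -> : - q * - q = q * q by ring.
have -> : - q * T Kc V (- q) = q * T Kc V q by rewrite TN; ring.
have -> : - q * T Ks V p = - (q * T Ks V p) by ring.
rewrite IN; have := Isq_ge0 p; have := Isq_ge0 q; ilra.
Qed.

Lemma Tc_norm V V' p : shear_ok V V' -> I (T Kc V p * T Kc V p) <= 100 * I (p * p).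
Proof.
move=> hV; have -> : 100 = 4 * 5 ^+ 2 :> R by lra.
apply: T_norm => // u v; have := kn_schur KN u v hV; have := Isq_ge0 u; have := Isq_ge0 v; ilra.
Qed.
Lemma Ts_norm V V' p : shear_ok V V' -> I (T Ks V p * T Ks V p) <= 100 * I (p * p).
Proof.
move=> hV; have -> : 100 = 4 * 5 ^+ 2 :> R by lra.
by apply: T_norm => // u v; exact: Ts_bound hV.
Qed.

End Fixed.
End GoodKernels.

(** * Bounds at a fixed time *)

Section StaticBounds.
Context {R : realType}.
Local Notation C := (@cfct R).
Implicit Types f g h p q K V u : C.

Lemma I_youngA f g s : 0 < s -> `|2 * I (f * g)| <= s * I (f * f) + s^-1 * I (g * g).
Proof.
move=> s0; rewrite ler_norml; have := I_young f g s0; have := I_young (- f) g s0.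
have -> : - f * - f = f * f by ring.
have -> : - f * g = - (f * g) by ring.
rewrite IN => h1 h2; apply/andP; split; ilra.
Qed.

Lemma I_mulb u f m : (forall y, -1 <= y <= 1 -> `|u y| <= m) ->
  I (u * f * (u * f)) <= m * m * I (f * f).
Proof.
move=> h; rewrite -IZ; apply: I_le => y hy; rewrite !(cfM, ccE).
have -> : u y * f y * (u y * f y) = (u y) ^+ 2 * (f y * f y) by ring.
apply: ler_wpM2r; first by rewrite -expr2 sqr_ge0.
rewrite -real_normK ?num_real// expr2; have := h y hy; have := normr_ge0 (u y); nra.
Qed.

Lemma I_sqD f g : I ((f + g) * (f + g)) <= 2 * I (f * f) + 2 * I (g * g).
Proof.
rewrite -!IZ -ID; apply: I_le => y hy; rewrite !(cfM, cfD, ccE).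
have := sqr_ge0 (f y - g y); nra.
Qed.
Lemma I_sqB f g : I ((f - g) * (f - g)) <= 2 * I (f * f) + 2 * I (g * g).
Proof.
rewrite -!IZ -ID; apply: I_le => y hy; rewrite !(cfM, cfD, cfN, ccE).
have := sqr_ge0 (f y + g y); nra.
Qed.

Definition dirich f := f (-1) = 0 /\ f 1 = 0.

Lemma sup_mul f f1 g : der f f1 -> f (-1) = 0 ->
  I (g * f * (g * f)) <= 2 * I (f1 * f1) * I (g * g).
Proof.
move=> hf f0; rewrite -IZ; apply: I_le => y hy; rewrite !(cfM, ccE).
have := sup_sq hf f0 hy; set s := 2 * _ => hs.
have -> : g y * f y * (g y * f y) = f y ^+ 2 * (g y * g y) by ring.
by apply: ler_wpM2r => //; rewrite -expr2 sqr_ge0.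
Qed.

Section Shear.
Variables (V W W1 W2 : C) (d : R).
Hypotheses (d0 : 0 < d) (d1 : d <= 1 / 10).
Hypotheses (hV : der V (1 + W)) (hW : der W W1) (hW1 : der W1 W2).
Hypotheses (W_half : forall y, - (1 / 2) <= W y <= 1 / 2).
Hypotheses (W1_d : forall y, -1 <= y <= 1 -> `|W1 y| <= d) (W2_d : I (W2 * W2) <= d ^+ 2).

Lemma V'E y : (1 + W) y = 1 + W y. Proof. by rewrite cfD cf1. Qed.
Lemma shear_okV : shear_ok V (1 + W).
Proof. by split=> // y _; rewrite V'E; have := W_half y; lra. Qed.
Lemma V'_neq0 y : (1 + W) y != 0.
Proof. by rewrite V'E gt_eqF//; have := W_half y; lra. Qed.
(** The pinching of [W] is assumed on the whole line so that this reciprocal is a continuous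
    function there. *)
Definition iV : C := invC V'_neq0.
Lemma iV_mul : iV * (1 + W) = 1. Proof. exact: mulVC. Qed.
Lemma iV_le y : `|iV y| <= 2.
Proof.
rewrite invCE V'E; have := W_half y => h.
have h0 : 0 < 1 + W y by lra.
by rewrite gtr0_norm ?invr_gt0// invf_ple ?posrE//; lra.
Qed.
Lemma iV_der : der iV (- (W1 * (iV * iV))).
Proof.
move=> y hy.
have h1 : is_derive y (1 : R) (1 + W : C) (W1 y).
  by have := derD (der_cc 1) hW hy; rewrite rmorph1 add0r.
apply: is_derive_eq (is_deriveV (V'_neq0 y) h1) _.
by rewrite !(cfN, cfM, invCE) /GRing.scale/= -exprVn; ring.
Qed.

(** By [T_ibp], [T K1 V f] equals [T K V g] with [g = (f / V')'], so the [L^2] bound for [T] becomes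
    an [H^1] bound. The norm of [g] costs at most 10, by Poincare and [|W1| <= 1 / 10], and [V']
    another [9 / 4]. *)
Lemma T_H1 K K1 f f1 : derR K K1 ->
  (forall g, I (T K V g * T K V g) <= 100 * I (g * g)) ->
  der f f1 -> dirich f ->
  [/\ der (T K V f) ((1 + W) * T K1 V f),
      I (T K1 V f * T K1 V f) <= 1000 * I (f1 * f1) &
      I ((1 + W) * T K1 V f * ((1 + W) * T K1 V f)) <= 2500 * I (f1 * f1)].
Proof.
move=> hK hT hf [f0 f1']; have hd := T_der f hK hV.
pose g := f1 * iV + f * (- (W1 * (iV * iV))).
have hg : der (f * iV) g := derM hf iV_der.
have E : T K1 V f = T K V g := T_ibp hK hV iV_mul hg f0 f1'.
have hgn : I (g * g) <= 10 * I (f1 * f1).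
  have a1 : I (f1 * iV * (f1 * iV)) <= 4 * I (f1 * f1).
    have := @I_mulb iV f1 2 (fun y _ => iV_le y).
    by rewrite (cmulC iV f1) (_ : 2 * 2 = 4) //; lra.
  have a2 : I (f * (- (W1 * (iV * iV))) * (f * (- (W1 * (iV * iV))))) <= 1 / 10 * 4 * (1 / 10 * 4) * I (f * f).
    rewrite (cmulC f); apply: I_mulb => y hy; rewrite cfN normrN !cfM !normrM.
    have h1 := W1_d hy; have h2 := iV_le y; have := normr_ge0 (W1 y); have := normr_ge0 (iV y).
    move=> h3 h4; have h5 : `|iV y| * `|iV y| <= 4 by nra.
    apply: ler_pM => //; exact: le_trans h1 d1.
  have a3 := poincare hf f0.
  have a4 := I_sqD (f1 * iV) (f * (- (W1 * (iV * iV)))).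
  rewrite -/g in a4; have := Isq_ge0 f1; ilra.
have hTg : I (T K1 V f * T K1 V f) <= 1000 * I (f1 * f1).
  by rewrite E; have := hT g; ilra.
split => //.
have := @I_mulb (1 + W) (T K1 V f) (3 / 2).
have h : forall y, -1 <= y <= 1 -> `|(1 + W) y| <= 3 / 2.
  by move=> y _; rewrite V'E ler_norml; have := W_half y; lra.
move=> /(_ h); have := Isq_ge0 f1; ilra.
Qed.

(** In [(W1 b)' = W2 b + W1 b1] the factor [W2] is only controlled in [L^2], so [b] is taken in the
    sup norm: [2 (2 + 1) d^2 = 6 d^2]. *)
Lemma W1_H1 b b1 k : der b b1 -> dirich b ->
  exists2 f1, der (W1 * b) f1 &
   I (f1 * f1) <= 6 * d ^+ 2 * I (b1 * b1) /\
   k ^+ 2 * I (W1 * b * (W1 * b)) <= d ^+ 2 * (k ^+ 2 * I (b * b)).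
Proof.
move=> hb [b0 b1'].
exists (W2 * b + W1 * b1); first exact: derM.
split.
  have a1 := sup_mul W2 hb b0.
  have a2 := I_mulb b1 W1_d.
  have a3 := I_sqD (W2 * b) (W1 * b1).
  have : 2 * I (b1 * b1) * I (W2 * W2) <= 2 * I (b1 * b1) * d ^+ 2.
    by apply: ler_wpM2l => //; rewrite mulr_ge0// Isq_ge0.
  move: a1 a2 a3; move: (I (b1 * b1)) (I (W2 * W2)) (I (W2 * b * (W2 * b))) (I (W1 * b1 * (W1 * b1))) (I _).
  move=> x1 x2 x3 x4 x5; lra.
have := I_mulb b W1_d; have := sqr_ge0 k.
move: (I _) (I _) (k ^+ 2) => x y z; nra.
Qed.

Lemma W1_dirich b : dirich b -> dirich (W1 * b).
Proof. by move=> [h1 h2]; split; rewrite cfM ?h1 ?h2 mulr0. Qed.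

Section Stream.
Variables (k : R) (k1 : 1 <= k).

(* [N] is the squared [H^{-1}] norm of [p]; writing [p = P' + k V' P] bounds [I (p * a)] by
   [sqrt N] times the [L^2] norm of [P], which [D_lower] controls. *)
Lemma stream_bounds p a a1 : der a a1 -> der a1 (p + cc (k ^+ 2) * a) -> dirich a ->
  let N := I (a1 * a1) + k ^+ 2 * I (a * a) in
  [/\ 0 <= N, N <= I (p * p) & k * N <= 9 * I (p * T (kexp k) V p)].
Proof.
move=> ha ha1 [a0 a1'] N.
have k0 : 0 < k := lt_le_trans ltr01 k1.
have N0 : 0 <= N.
  apply: addr_ge0; first exact: Isq_ge0.
  by apply: mulr_ge0; [exact: sqr_ge0|exact: Isq_ge0].
have NE : N = - I (p * a).
  have := IBP0 ha ha1 a0 a1'; rewrite cmulDr ID.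
  have -> : a * (cc (k ^+ 2) * a) = cc (k ^+ 2) * (a * a) by ring.
  rewrite IZ (cmulC a p) /N => ->; ring.
split => //.
  have : - 2 * I (p * a) <= I (p * p) + I (a * a).
    have := @I_youngA p a 1 ltr01; rewrite invr1 ler_norml; ilra.
  have : I (a * a) <= k ^+ 2 * I (a * a).
    by rewrite ler_peMl ?Isq_ge0// exprn_ege1.
  have := Isq_ge0 a1; move: NE; rewrite /N; ilra.
have [P [hP P0 hD]] := D_lower p k0 hV (shear_ok_ge0 shear_okV).
have e1 : I (p * a) = - I (P * a1) + k * I ((1 + W) * P * a).
  have := IBP hP ha; rewrite a0 a1' !mulr0 subrr sub0r cmulBl IB.
  have -> : cc k * ((1 + W) * P) * a = cc k * ((1 + W) * P * a) by ring.
  by rewrite IZ; ilra.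
have e2 : I (P * P) <= 2 * I ((1 + W) * (P * P)).
  rewrite -IZ; apply: I_le => y _; rewrite !(cfM, ccE) V'E.
  have := W_half y; have := sqr_ge0 (P y); rewrite expr2; nra.
have e3 := @I_youngA P a1 2 (ltr0n _ 2).
have e4 := @I_youngA ((1 + W) * P) (cc k * a) 2 (ltr0n _ 2).
have e5 : I ((1 + W) * P * ((1 + W) * P)) <= 3 / 2 * (3 / 2) * I (P * P).
  by apply: I_mulb => y _; rewrite V'E ler_norml; have := W_half y; lra.
move: e4.
have -> : (1 + W) * P * (cc k * a) = cc k * ((1 + W) * P * a) by ring.
have -> : cc k * a * (cc k * a) = cc (k ^+ 2) * (a * a) by ring.
rewrite !IZ => e4.
have e6 : N <= 9 / 2 * I (P * P).
  move: e3 e4; rewrite !ler_norml => /andP[_ e3] /andP[e4 _].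
  have := Isq_ge0 P; move: NE; rewrite e1; move: e3 e4 e5; rewrite /N; ilra.
have := Isq_ge0 P; have : 0 <= P 1 ^+ 2 by exact: sqr_ge0.
clearbody N; clear NE N0.
move: hD e2 e6; move: N (I ((1 + W) * (P * P))) (I (P * P)) (I (p * T (kexp k) V p)) (P 1 ^+ 2) => n x y z w hD e2 e6 w0 y0.
have : k * n <= k * (9 / 2 * y) by rewrite ler_pM2l.
have : k * y <= k * (2 * x) by rewrite ler_pM2l.
nra.
Qed.

(** A duality estimate: the positive form of [exp (- k |x|)] controls [p] against [H^1] functions.
    As [g] need not vanish at the walls, writing [p = P' + k V' P] and integrating by parts leaves
    [P 1 * g 1]; this is why [D_lower] keeps [P 1 ^+ 2]. The trace of [g] is taken at length scale
    [1 / k]. *)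
Lemma pair_bound p g g1 s : 0 < s -> der g g1 ->
  2 * I (p * g) <= 6 * s * I (p * T (kexp k) V p)
    + s^-1 * (4 * k * I (g * g) + 2 * k^-1 * I (g1 * g1)).
Proof.
move=> s0 hg.
have k0 : 0 < k := lt_le_trans ltr01 k1.
have [P [hP P0 hD]] := D_lower p k0 hV (shear_ok_ge0 shear_okV).
have e1 : I (p * g) = P 1 * g 1 - I (P * g1) + k * I ((1 + W) * P * g).
  have := IBP hP hg; rewrite P0 mul0r subr0 cmulBl IB.
  have -> : cc k * ((1 + W) * P) * g = cc k * ((1 + W) * P * g) by ring.
  by rewrite IZ; ilra.
have e2 : I (P * P) <= 2 * I ((1 + W) * (P * P)).
  rewrite -IZ; apply: I_le => y _; rewrite !(cfM, ccE) V'E.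
  have := W_half y; have := sqr_ge0 (P y); rewrite expr2; nra.
have sk0 : 0 < s * k by rewrite mulr_gt0.
have e3 := @I_youngA P g1 (s * k) sk0.
have e4 := @I_youngA P ((1 + W) * g) s s0.
have e5 : I ((1 + W) * g * ((1 + W) * g)) <= 3 / 2 * (3 / 2) * I (g * g).
  by apply: I_mulb => y _; rewrite V'E ler_norml; have := W_half y; lra.
have e6 := @trace_bound _ g g1 k 1 k0 hg (or_introl erefl).
have e7 : 2 * (P 1 * g 1) <= s * P 1 ^+ 2 + s^-1 * g 1 ^+ 2.
  have := sqr_ge0 (s * P 1 - g 1); rewrite -subr_ge0 => h.
  rewrite -subr_ge0 (_ : _ - _ = s^-1 * (s * P 1 - g 1) ^+ 2); last by field; rewrite gt_eqF.
  by apply: mulr_ge0; [rewrite invr_ge0 ltW|exact: sqr_ge0].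
have e8 : P * ((1 + W) * g) = (1 + W) * P * g by ring.
rewrite e8 in e4.
have si : 0 < s^-1 by rewrite invr_gt0.
have ki : 0 < k^-1 by rewrite invr_gt0.
have kk : k * k^-1 = 1 by rewrite divff// gt_eqF.
rewrite invfM in e3.
rewrite e1.
move: e3 e4; rewrite !ler_norml => /andP[e3 _] /andP[_ e4].
have P10 : 0 <= P 1 ^+ 2 by exact: sqr_ge0.
have PP0 := Isq_ge0 P; have gg0 := Isq_ge0 g; have gg1 := Isq_ge0 g1.
move: e2 e3 e4 e5 e6 e7 hD P10 PP0 gg0 gg1.
move: (I (p * T (kexp k) V p)) (I (g * g)) (I (g1 * g1)) (I (P * P)) (I ((1 + W) * (P * P)))
  (I (P * g1)) (I ((1 + W) * P * g)) (I ((1 + W) * g * ((1 + W) * g))) (P 1 * g 1) (P 1 ^+ 2) (g 1 ^+ 2).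
move=> D G G1 PP VPP Pg1 VPg VgVg Pg Pq gq e2 e3 e4 e5 e6 e7 hD P10 PP0 gg0 gg1.
have k2 : k * PP <= 2 * D by have : k * PP <= k * (2 * VPP) by [rewrite ler_pM2l]; lra.
have u1 : Pq <= 2 * D by have : 0 <= k * PP by [rewrite mulr_ge0// ltW]; have : k * PP <= k * (2 * VPP) by [rewrite ler_pM2l]; lra.
have u2 : s * Pq <= s * (2 * D) by rewrite ler_pM2l.
have u3 : s * (k * PP) <= s * (2 * D) by rewrite ler_pM2l.
have u4 : s^-1 * gq <= s^-1 * (2^-1 * G + k * G + k^-1 * G1) by rewrite ler_pM2l.
have u5 : s^-1 * VgVg <= s^-1 * (3 / 2 * (3 / 2) * G) by rewrite ler_pM2l.
have u6 : G <= k * G by rewrite ler_peMl.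
have u7 : k * (2 * VPg) <= k * (s * PP + s^-1 * VgVg) by rewrite ler_pM2l.
have u8 : s^-1 * G <= s^-1 * (k * G) by rewrite ler_pM2l.
have u9 : k * (s^-1 * VgVg) <= k * (s^-1 * (3 / 2 * (3 / 2) * G)) by rewrite ler_pM2l.
have u10 : 0 <= s^-1 * (k * G) by apply: mulr_ge0; [exact: ltW|apply: mulr_ge0 => //; exact: ltW].
have := e3; lra.
Qed.

End Stream.
End Shear.
End StaticBounds.

(** * The hypocoercive energy *)

Section Energy.
Context {R : realType}.
Local Notation C := (@cfct R).
Implicit Types f g h p q K V u : C.

Section Hypo.
Variables (V V' : C) (k e c : R) (p p1 p2 q q1 q2 : C).
Hypotheses (hV : shear_ok V V') (k0 : 0 < k) (e0 : 0 < e).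
Hypotheses (hp : der p p1) (hp1 : der p1 p2) (hp0 : dirich p).
Hypotheses (hq : der q q1) (hq1 : der q1 q2) (hq0 : dirich q).

Definition E0 p p1 q q1 := I (p * p) + I (q * q)
  + e ^+ 2 / 100 * (I (p1 * p1) + I (q1 * q1)) + e / 100 * (I (p * q1) - I (q * p1)).
(** The time derivative of [E0] when [p] and [q] have time derivatives [pt] and [qt], arranged by
    integration by parts so that [pt] and [qt] are never differentiated in [y]. *)
Definition dE0 pt qt := 2 * I (p * pt) + 2 * I (q * qt)
  + e ^+ 2 / 100 * (- 2 * I (pt * p2) - 2 * I (qt * q2))
  + e / 100 * (2 * I (pt * q1) - 2 * I (qt * p1)).
(** Each [y]-derivative is weighted by the layer width [e]; with this scaling [nA], [nB] and [nC]
    are all dissipated at the common rate [k e]. *)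
Definition nA := I (cc e * p1 * (cc e * p1)) + I (cc e * q1 * (cc e * q1)).
Definition nB := I (p * p) + I (q * q).
Definition nC := I (cc (e ^+ 2) * p2 * (cc (e ^+ 2) * p2)) + I (cc (e ^+ 2) * q2 * (cc (e ^+ 2) * q2)).

Lemma nAE : nA = e ^+ 2 * (I (p1 * p1) + I (q1 * q1)).
Proof.
rewrite /nA; have h u : cc e * u * (cc e * u) = cc (e ^+ 2) * (u * u) by ring.
by rewrite !h !IZ; ring.
Qed.

Lemma E0_bounds : 1 / 2 * nB + 4 / 1000 * nA <= E0 p p1 q q1 <= 2 * (nA + nB).
Proof.
have h1 := @I_youngA _ p (cc e * q1) 1 ltr01.
have h2 := @I_youngA _ q (cc e * p1) 1 ltr01.
have e1 : p * (cc e * q1) = cc e * (p * q1) by ring.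
have e2 : q * (cc e * p1) = cc e * (q * p1) by ring.
move: h1 h2; rewrite e1 e2 !IZ invr1 !ler_norml => /andP[h1 h2] /andP[h3 h4].
have b1 := Isq_ge0 p; have b2 := Isq_ge0 q.
have b3 := Isq_ge0 (cc e * p1); have b4 := Isq_ge0 (cc e * q1).
have : e ^+ 2 / 100 * (I (p1 * p1) + I (q1 * q1)) = nA / 100 by rewrite nAE; field.
rewrite /E0 => ->; rewrite /nA /nB.
apply/andP; split; ilra.
Qed.

Variables (F1 F2 : C).
Let U : C := V + cc c.
Let pt : C := cc k * (U * q) + cc (k * e ^+ 3) * p2 + F1.
Let qt : C := - (cc k * (U * p)) + cc (k * e ^+ 3) * q2 + F2.
Definition Src := 2 * I (p * F1) + 2 * I (q * F2)
  + e ^+ 2 / 100 * (- 2 * I (F1 * p2) - 2 * I (F2 * q2))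
  + e / 100 * (2 * I (F1 * q1) - 2 * I (F2 * p1)).
(** The decisive term is the one in [V' * (p * p + q * q)]: transport acting on the cross term of
    [E0] produces damping of [nB], which viscosity alone does not give. The terms with [nA] and [nC]
    are viscous dissipation, the remaining two are commutator errors. *)
Definition BR := - 2 * nA - 2 / 100 * nC + 2 / 100 * (I (V' * q * (cc e * p1)) - I (V' * p * (cc e * q1)))
  - 1 / 100 * I (V' * (p * p + q * q))
  + 2 / 100 * (I (cc (e ^+ 2) * p2 * (cc e * q1)) - I (cc (e ^+ 2) * q2 * (cc e * p1))).

(** After integration by parts the undifferentiated [U] cancels and only [U' = V'] survives, so the
    additive constant [c] disappears. *)
Lemma dE0_id : dE0 pt qt = k * e * BR + Src.
Proof.
have [p0 p0'] := hp0; have [q0 q0'] := hq0; have hVd := shear_ok_der hV.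
have hU : der U V' by apply: der_eq (derD hVd (der_cc c)) _; rewrite addr0.
have i1 u (F G : C) m : I (u * (cc k * F + cc m * G + F1)) = k * I (u * F) + m * I (u * G) + I (u * F1).
  by rewrite 2!cmulDr 2!ID -!IZ; congr (I _ + I _ + _); ring.
have i2 u (F G : C) m : I (u * (- (cc k * F) + cc m * G + F2)) = - (k * I (u * F)) + m * I (u * G) + I (u * F2).
  by rewrite 2!cmulDr 2!ID -!IZ -IN; congr (I _ + I _ + _); ring.
have j1 := IBP0 hp hp1 p0 p0'; have j2 := IBP0 hq hq1 q0 q0'.
have Uq0 : (U * q) (-1) = 0 by rewrite cfM q0 mulr0.
have Uq0' : (U * q) 1 = 0 by rewrite cfM q0' mulr0.
have Up0 : (U * p) (-1) = 0 by rewrite cfM p0 mulr0.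
have Up0' : (U * p) 1 = 0 by rewrite cfM p0' mulr0.
have j3 := IBP0 (derM hU hq) hp1 Uq0 Uq0'.
have j4 := IBP0 (derM hU hp) hq1 Up0 Up0'.
have j5 : I (V' * (q * q)) + 2 * I (U * (q * q1)) = 0.
  have := I_der (derM hU (derM hq hq)); rewrite !cfM q0 q0' !mulr0 subrr.
  have -> : V' * (q * q) + U * (q1 * q + q * q1) = V' * (q * q) + cc 2 * (U * (q * q1)) by ring.
  by rewrite ID IZ.
have j6 : I (V' * (p * p)) + 2 * I (U * (p * p1)) = 0.
  have := I_der (derM hU (derM hp hp)); rewrite !cfM p0 p0' !mulr0 subrr.
  have -> : V' * (p * p) + U * (p1 * p + p * p1) = V' * (p * p) + cc 2 * (U * (p * p1)) by ring.
  by rewrite ID IZ.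
pose m := k * e ^+ 3.
have y1 : I (p * pt) = k * I (p * (U * q)) + m * I (p * p2) + I (p * F1) := i1 p _ _ _.
have y2 : I (p2 * pt) = k * I (p2 * (U * q)) + m * I (p2 * p2) + I (p2 * F1) := i1 p2 _ _ _.
have y3 : I (q1 * pt) = k * I (q1 * (U * q)) + m * I (q1 * p2) + I (q1 * F1) := i1 q1 _ _ _.
have y4 : I (q * qt) = - (k * I (q * (U * p))) + m * I (q * q2) + I (q * F2) := i2 q _ _ _.
have y5 : I (q2 * qt) = - (k * I (q2 * (U * p))) + m * I (q2 * q2) + I (q2 * F2) := i2 q2 _ _ _.
have y6 : I (p1 * qt) = - (k * I (p1 * (U * p))) + m * I (p1 * q2) + I (p1 * F2) := i2 p1 _ _ _.
rewrite /dE0 (cmulC pt p2) (cmulC qt q2) (cmulC pt q1) (cmulC qt p1) y1 y2 y3 y4 y5 y6.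
clear y1 y2 y3 y4 y5 y6 i1 i2.
rewrite cmulDl ID in j3; rewrite cmulDl ID in j4.
have r1 : p2 * (U * q) = U * q * p2 by ring.
have r2 : q2 * (U * p) = U * p * q2 by ring.
have r3 : q1 * (U * q) = U * (q * q1) by ring.
have r4 : p1 * (U * p) = U * (p * p1) by ring.
have r5 : q * (U * p) = p * (U * q) by ring.
have r6 : U * q1 * p1 = U * p1 * q1 by ring.
rewrite r1 r2 r3 r4 r5 /Src (cmulC F1 p2) (cmulC F2 q2) (cmulC F1 q1) (cmulC F2 p1).
rewrite r6 in j3.
have j3' : I (U * q * p2) = - (I (V' * q * p1) + I (U * p1 * q1)) by ilra.
have j4' : I (U * p * q2) = - (I (V' * p * q1) + I (U * p1 * q1)) by ilra.
have j1' : I (p * p2) = - I (p1 * p1) by ilra.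
have j2' : I (q * q2) = - I (q1 * q1) by ilra.
have j5' : I (U * (q * q1)) = - (I (V' * (q * q)) / 2) by ilra.
have j6' : I (U * (p * p1)) = - (I (V' * (p * p)) / 2) by ilra.
rewrite j3' j4' j1' j2' j5' j6' /BR nAE /nC.
have w1 u v : cc (e ^+ 2) * u * (cc (e ^+ 2) * v) = cc (e ^+ 4) * (u * v) by ring.
have w2 u v : V' * u * (cc e * v) = cc e * (V' * u * v) by ring.
have w3 u v : cc (e ^+ 2) * u * (cc e * v) = cc (e ^+ 3) * (u * v) by ring.
rewrite !w1 !w2 !w3 !IZ cmulDr /m ID (cmulC q1 p2) (cmulC p1 q2).
by genI; intros; field.
Qed.

(** The weight [1 / 20] in Young's inequality keeps the cost of the shear commutator, [0.001125 nB],
    well below the gain [0.005 nB]; the price of [0.2 nA] is covered by [2 nA]. *)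
Lemma BR_le : BR <= - (17 / 10) * nA - 15 / 1000 * nC - 387 / 1000 / 100 * nB.
Proof.
have s1 : 0 < (1 / 20 : R) by lra.
have s2 : 0 < (1 / 2 : R) by lra.
have a1 := @I_youngA _ (V' * q) (cc e * p1) (1 / 20) s1.
have a2 := @I_youngA _ (V' * p) (cc e * q1) (1 / 20) s1.
have a3 := @I_youngA _ (cc (e ^+ 2) * p2) (cc e * q1) (1 / 2) s2.
have a4 := @I_youngA _ (cc (e ^+ 2) * q2) (cc e * p1) (1 / 2) s2.
have hb : forall y, -1 <= y <= 1 -> `|V' y| <= 3 / 2.
  by move=> y hy; have := hV.2 y hy; rewrite ler_norml; lra.
have b1 := I_mulb p hb; have b2 := I_mulb q hb.
have b3 : 1 / 2 * (I (p * p) + I (q * q)) <= I (V' * (p * p + q * q)).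
  rewrite -ID -IZ; apply: I_le => y hy; rewrite !(cfM, cfD, ccE).
  have := hV.2 y hy; have := sqr_ge0 (p y); have := sqr_ge0 (q y); rewrite !expr2; nra.
have i20 : (1 / 20 : R)^-1 = 20 by rewrite div1r invrK.
have i2 : (1 / 2 : R)^-1 = 2 by rewrite div1r invrK.
move: a1 a2 a3 a4; rewrite i20 i2 !ler_norml => /andP[_ a1] /andP[a2 _] /andP[_ a3] /andP[a4 _].
have c3 := Isq_ge0 p; have c4 := Isq_ge0 q.
have c1 := Isq_ge0 (cc e * p1); have c2 := Isq_ge0 (cc e * q1).
rewrite /BR /nA /nB /nC; ilra.
Qed.

End Hypo.
End Energy.

(** * The derivative of [Q] along the viscous equation *)

Section FullEnergy.
Context {R : realType}.
Local Notation C := (@cfct R).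
Implicit Types f g h K u : C.

Variables (V W W1 W2 : C) (d : R).
Hypotheses (d0 : 0 < d) (d1 : d <= 1 / 10).
Hypotheses (hV : der V (1 + W)) (hW : der W W1) (hW1 : der W1 W2).
Hypotheses (W_half : forall y, - (1 / 2) <= W y <= 1 / 2).
Hypotheses (W1_d : forall y, -1 <= y <= 1 -> `|W1 y| <= d) (W2_d : I (W2 * W2) <= d ^+ 2).
Variables (k e c : R) (k1 : 1 <= k) (e0 : 0 < e).
Variables (Kc Ks h Kc1 Ks1 : C) (KN : kernels k e Kc Ks h Kc1 Ks1).
Variables (p p1 p2 q q1 q2 : C).
Hypotheses (hp : der p p1) (hp1 : der p1 p2) (hp0 : dirich p).
Hypotheses (hq : der q q1) (hq1 : der q1 q2) (hq0 : dirich q).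

Let V' : C := 1 + W.
Let hVok : shear_ok V V' := shear_okV hV W_half.
Let k0 : 0 < k. Proof. exact: lt_le_trans ltr01 k1. Qed.
Let X1 := T Kc V p - T Ks V q.
Let X2 := T Kc V q + T Ks V p.
Local Notation A := (nA e p1 q1).
Local Notation B := (nB p q).
Local Notation CC := (nC e p2 q2).
Let Dk := I (p * T (kexp k) V p) + I (q * T (kexp k) V q).

Definition dQ (pt qt V1 : C) := 2 * I (pt * (T Kc V p - T Ks V q)) + 2 * I (qt * (T Kc V q + T Ks V p))
  + 2 * (I (V1 * p * T Kc1 V p) + I (V1 * q * T Kc1 V q)
           + I (V1 * q * T Ks1 V p) - I (V1 * p * T Ks1 V q)).

Lemma X_norm : I (X1 * X1) <= 200 * B /\ I (X2 * X2) <= 200 * B.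
Proof.
have a1 := Tc_norm KN p hVok; have a2 := Tc_norm KN q hVok.
have a3 := Ts_norm k0 e0 KN p hVok; have a4 := Ts_norm k0 e0 KN q hVok.
have b1 := I_sqB (T Kc V p) (T Ks V q); have b2 := I_sqD (T Kc V q) (T Ks V p).
by split; rewrite /nB; ilra.
Qed.

Lemma X_der : exists Y1 Y2 : C, [/\ der X1 Y1, der X2 Y2,
  I (cc e * Y1 * (cc e * Y1)) <= (5 * 1000) * A & I (cc e * Y2 * (cc e * Y2)) <= (5 * 1000) * A].
Proof.
have nc f := Tc_norm KN f hVok; have ns f := Ts_norm k0 e0 KN f hVok.
have [t1 _ t1'] := T_H1 d1 hV hW W_half W1_d W2_d (kn_c1 KN) nc hp hp0.
have [t2 _ t2'] := T_H1 d1 hV hW W_half W1_d W2_d (kn_c1 KN) nc hq hq0.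
have [t3 _ t3'] := T_H1 d1 hV hW W_half W1_d W2_d (kn_s1 KN) ns hp hp0.
have [t4 _ t4'] := T_H1 d1 hV hW W_half W1_d W2_d (kn_s1 KN) ns hq hq0.
eexists; eexists; split; [exact: derB t1 t4|exact: derD t2 t3| |].
- have := I_sqB ((1 + W) * T Kc1 V p) ((1 + W) * T Ks1 V q).
  set Y := _ - _; have -> : cc e * Y * (cc e * Y) = cc (e ^+ 2) * (Y * Y) by ring.
  rewrite IZ nAE => hh; rewrite mulrCA; apply: ler_wpM2l; first exact: sqr_ge0.
  clearbody Y; clear nc ns; ilra.
- have := I_sqD ((1 + W) * T Kc1 V q) ((1 + W) * T Ks1 V p).
  set Y := _ + _; have -> : cc e * Y * (cc e * Y) = cc (e ^+ 2) * (Y * Y) by ring.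
  rewrite IZ nAE => hh; rewrite mulrCA; apply: ler_wpM2l; first exact: sqr_ge0.
  clearbody Y; clear nc ns; ilra.
Qed.

(** For large [e] the surplus factor is removed by interpolation, [|r1|^2 = - <r, r2>], followed by
    Poincare's inequality to return from [r] to [r1]. *)
Lemma p1_le (r r1 r2 : C) : der r r1 -> der r1 r2 -> dirich r ->
  e * I (cc e * r1 * (cc e * r1)) <= 1 / 2 * I (cc e * r1 * (cc e * r1)) + 2 * I (cc (e ^+ 2) * r2 * (cc (e ^+ 2) * r2)).
Proof.
move=> hr hr1 [r0 r0'].
have a1 := IBP0 hr hr1 r0 r0'.
have a2 := poincare hr r0.
have s0 : 0 < (1 / 4 : R) by lra.
have i4 : (1 / 4 : R)^-1 = 4 by rewrite div1r invrK.
have := @I_youngA _ (cc e * r) (cc (e ^+ 2) * r2) (1 / 4) s0.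
have -> : cc e * r * (cc (e ^+ 2) * r2) = cc (e ^+ 3) * (r * r2) by ring.
have w1 u v : cc (e ^+ 2) * u * (cc (e ^+ 2) * v) = cc (e ^+ 4) * (u * v) by ring.
have w2 u v : cc e * u * (cc e * v) = cc (e ^+ 2) * (u * v) by ring.
rewrite i4 !w1 !w2 !IZ ler_norml => /andP[a3 _].
have e2 : 0 < e ^+ 2 by rewrite exprn_gt0.
have a4 : e ^+ 2 * I (r * r) <= e ^+ 2 * (4 * I (r1 * r1)) by rewrite ler_pM2l.
have -> : e * (e ^+ 2 * I (r1 * r1)) = e ^+ 3 * I (r1 * r1) by ring.
rewrite a1; have := Isq_ge0 r1; move: a3 a4; clear w1 w2; rewrite a1.
move: (I (r * r)) (I (r * r2)) (I (r2 * r2)) (e ^+ 2) (e ^+ 3) (e ^+ 4); intros; lra.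
Qed.

(** From [2 e <= 1 + e^2] and Poincare's inequality in the form [e^2 nB <= 4 nA]. *)
Lemma eB_le : e * B <= 1 / 2 * B + 2 * A.
Proof.
have [p0 _] := hp0; have [q0 _] := hq0.
have a1 := poincare hp p0; have a2 := poincare hq q0.
have b : 0 <= B by rewrite /nB addr_ge0 ?Isq_ge0.
have h1 : B <= 4 * (I (p1 * p1) + I (q1 * q1)) by rewrite /nB; ilra.
have h2 : e ^+ 2 * B <= 4 * A.
  by rewrite nAE mulrCA; apply: ler_wpM2l; [exact: sqr_ge0|].
have : 0 <= (1 - e) ^+ 2 * B by rewrite mulr_ge0 ?sqr_ge0.
by move: h2; generalize A B; intros; lra.
Qed.

(** In the application [X] is a component of [T omega] and need not vanish at the walls, so moving a
    derivative off [r2] leaves [r1 X] at both ends. The traces are bounded as [e^3 r1^2] and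
    [e X^2], whose geometric mean is the required [e^2 |r1 X|]. *)
Lemma visc_bound (r r1 r2 X Y : C) : der r r1 -> der r1 r2 -> dirich r ->
  I (cc e * r1 * (cc e * r1)) <= A -> I (cc (e ^+ 2) * r2 * (cc (e ^+ 2) * r2)) <= CC ->
  der X Y -> I (X * X) <= 200 * B -> I (cc e * Y * (cc e * Y)) <= (5 * 1000) * A ->
  2 * e ^+ 2 * I (r2 * X) <= (16 * 1000) * A + 500 * B + 4 * CC.
Proof.
move=> hr hr1 hr0 hA hC hX hXB hYA.
have hh := p1_le hr hr1 hr0; have eB := eB_le.
have A0 : 0 <= A by rewrite /nA addr_ge0 ?Isq_ge0.
have ei0 : 0 < e^-1 by rewrite invr_gt0.
have t1 y : y = 1 \/ y = -1 -> e ^+ 3 * r1 y ^+ 2 <= 5 / 4 * A + 2 * CC.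
  move=> hy; have := trace_bound ei0 hr1 hy; rewrite invrK.
  have w1 u v : cc (e ^+ 2) * u * (cc (e ^+ 2) * v) = cc (e ^+ 4) * (u * v) by ring.
  have w2 u v : cc e * u * (cc e * v) = cc (e ^+ 2) * (u * v) by ring.
  move: hh hA hC; rewrite !w1 !w2 !IZ; clear w1 w2.
  move: (I (r1 * r1)) (I (r2 * r2)) (r1 y ^+ 2) A CC => R1 R2 ry a cc0 hh hA hC ht.
  have : e ^+ 3 * ry <= e ^+ 3 * (2^-1 * R1 + e^-1 * R1 + e * R2) by rewrite ler_pM2l ?exprn_gt0.
  have -> : e ^+ 3 * (2^-1 * R1 + e^-1 * R1 + e * R2) =
     1 / 2 * (e * (e ^+ 2 * R1)) + e ^+ 2 * R1 + e ^+ 4 * R2 by field; rewrite gt_eqF.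
  lra.
have t2 y : y = 1 \/ y = -1 -> e * X y ^+ 2 <= 250 * B + (52 * 100) * A.
  move=> hy; have := trace_bound ei0 hX hy; rewrite invrK.
  have w2 u v : cc e * u * (cc e * v) = cc (e ^+ 2) * (u * v) by ring.
  move: hYA; rewrite !w2 !IZ; clear w2.
  move: hXB eB A0; move: (I (X * X)) (I (Y * Y)) (X y ^+ 2) A B => XX YY xy a b hXB eB A0 hYA ht.
  have : e * xy <= e * (2^-1 * XX + e^-1 * XX + e * YY) by rewrite ler_pM2l.
  have -> : e * (2^-1 * XX + e^-1 * XX + e * YY) =
     1 / 2 * (e * XX) + XX + e ^+ 2 * YY by field; rewrite gt_eqF.
  have : e * XX <= e * (200 * b) by rewrite ler_pM2l.
  lra.
have bd y : y = 1 \/ y = -1 -> `|2 * e ^+ 2 * (r1 y * X y)| <= 250 * B + (52 * 100 + 2) * A + 2 * CC.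
  move=> hy; have h1 := t1 y hy; have h2 := t2 y hy.
  have h3 : 0 <= e * (e * r1 y - X y) ^+ 2 by apply: mulr_ge0; [exact: ltW|exact: sqr_ge0].
  have h4 : 0 <= e * (e * r1 y + X y) ^+ 2 by apply: mulr_ge0; [exact: ltW|exact: sqr_ge0].
  clear t1 t2 hX hXB hYA hh eB hA hC ei0; rewrite ler_norml; move: h1 h2 h3 h4 A0; generalize (r1 y) (X y) A B CC; intros.
  apply/andP; split; lra.
have b1 := bd 1 (or_introl erefl); have b2 := bd (-1) (or_intror erefl).
have E := IBP hr1 hX.
have := @I_youngA _ (cc e * r1) (cc e * Y) 1 ltr01; rewrite invr1.
have -> : cc e * r1 * (cc e * Y) = cc (e ^+ 2) * (r1 * Y) by ring.
rewrite IZ E ler_norml => /andP[b3 _].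
move: b1 b2; rewrite !ler_norml => /andP[_ b1] /andP[b2 _].
clear t1 t2 bd E hh eB hC hXB; move: b1 b2 b3 hA hYA A0; genI; generalize A B CC.
move: (r1 1 * X 1) (r1 (-1) * X (-1)) => ? ?; intros; lra.
Qed.

Variables (F1 F2 : C).
Let U : C := V + cc c.
Let m := k * e ^+ 3.
Let pt : C := cc k * (U * q) + cc m * p2 + F1.
Let qt : C := - (cc k * (U * p)) + cc m * q2 + F2.
Let Qv := Q Kc Ks V p q.

Lemma d_sq_le : d * d <= 1 / 100.
Proof. by have := ler_pM (ltW d0) (ltW d0) d1 d1; move: (d * d) => x; lra. Qed.

(** The constant [c] only rotates the phase of [omega], to which [Q] is insensitive: its
    contribution vanishes by the symmetry of [Kc] and the antisymmetry of [Ks]. *)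
Lemma dQ_id : dQ pt qt (cc m * W1) =
  k * (e * Qv - (I (p * T h V p) + I (q * T h V q)))
  + m * (2 * I (p2 * X1) + 2 * I (q2 * X2)) + 2 * I (F1 * X1) + 2 * I (F2 * X2)
  + m * (2 * (I (W1 * p * T Kc1 V p) + I (W1 * q * T Kc1 V q)
           + I (W1 * q * T Ks1 V p) - I (W1 * p * T Ks1 V q))).
Proof.
have h1 : 2 * I (U * q * X1) - 2 * I (U * p * X2) = e * Qv - (I (p * T h V p) + I (q * T h V q)).
  rewrite /Qv -(transportQ KN) /X1 /X2 /U.
  have -> : (V + cc c) * q * (T Kc V p - T Ks V q) =
     V * q * (T Kc V p - T Ks V q) + cc c * (q * T Kc V p - q * T Ks V q) by ring.
  have -> : (V + cc c) * p * (T Kc V q + T Ks V p) =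
     V * p * (T Kc V q + T Ks V p) + cc c * (p * T Kc V q + p * T Ks V p) by ring.
  have z1 : I (p * T Ks V p) = 0 by have := antis KN V p p; ilra.
  have z2 : I (q * T Ks V q) = 0 by have := antis KN V q q; ilra.
  rewrite !ID !IZ !IB !ID (symc KN V p q) z1 z2; ilra.
have e1 (G Hh Z Y : C) : I ((cc k * G + cc m * Hh + Z) * Y) = k * I (G * Y) + m * I (Hh * Y) + I (Z * Y).
  by rewrite 2!cmulDl 2!ID -!IZ; congr (I _ + I _ + _); ring.
have e2 (G Hh Z Y : C) : I ((- (cc k * G) + cc m * Hh + Z) * Y) = - (k * I (G * Y)) + m * I (Hh * Y) + I (Z * Y).
  by rewrite 2!cmulDl 2!ID -!IZ -IN; congr (I _ + I _ + _); ring.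
have y1 : I (pt * X1) = k * I (U * q * X1) + m * I (p2 * X1) + I (F1 * X1) := e1 _ _ _ _.
have y2 : I (qt * X2) = - (k * I (U * p * X2)) + m * I (q2 * X2) + I (F2 * X2) := e2 _ _ _ _.
have e3 u v : cc m * W1 * u * v = cc m * (W1 * u * v) by ring.
rewrite /dQ -/X1 -/X2 y1 y2 !e3 !IZ -h1; clear.
by genI; intros; ring.
Qed.

(** The two viscous pairings contribute [16000], [500] and [4] each, the motion of [V] adds
    [2002 nA], the term [e Q] adds [17 nB], and replacing [h] by [exp (- k |x|)] one more [nB]. *)
Lemma dQ_le : dQ pt qt (cc m * W1) <= - (k * Dk) + k * e * (35 * 1000 * A + 1018 * B + 8 * CC)
  + 2 * I (F1 * X1) + 2 * I (F2 * X2).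
Proof.
rewrite dQ_id; have dd := d_sq_le.
have ns f := Ts_norm k0 e0 KN f hVok; have nc f := Tc_norm KN f hVok.
have [_ t1 _] := T_H1 d1 hV hW W_half W1_d W2_d (kn_c1 KN) nc hp hp0.
have [_ t2 _] := T_H1 d1 hV hW W_half W1_d W2_d (kn_c1 KN) nc hq hq0.
have [_ t3 _] := T_H1 d1 hV hW W_half W1_d W2_d (kn_s1 KN) ns hp hp0.
have [_ t4 _] := T_H1 d1 hV hW W_half W1_d W2_d (kn_s1 KN) ns hq hq0.
clear ns nc.
have [Y1 [Y2 [dX1 dX2 nY1 nY2]]] := X_der; have [nX1 nX2] := X_norm.
have A1 : I (cc e * p1 * (cc e * p1)) <= A by rewrite /nA lerDl Isq_ge0.
have A2 : I (cc e * q1 * (cc e * q1)) <= A by rewrite /nA lerDr Isq_ge0.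
have C1 : I (cc (e ^+ 2) * p2 * (cc (e ^+ 2) * p2)) <= CC by rewrite /nC lerDl Isq_ge0.
have C2 : I (cc (e ^+ 2) * q2 * (cc (e ^+ 2) * q2)) <= CC by rewrite /nC lerDr Isq_ge0.
have v1 := visc_bound hp hp1 hp0 A1 C1 dX1 nX1 nY1.
have v2 := visc_bound hq hq1 hq0 A2 C2 dX2 nX2 nY2.
have Qu := Q_le k0 e0 KN p q hVok.
have D1 := kn_D KN V p; have D2 := kn_D KN V q.
have [p0 _] := hp0; have [q0 _] := hq0.
have o1 := I_mulb p W1_d; have o2 := I_mulb q W1_d.
have c1 := poincare hp p0; have c2 := poincare hq q0.
have g1 : I (W1 * p * (W1 * p)) <= I (p1 * p1).
  apply: le_trans o1 _; apply: (le_trans (ler_wpM2r (Isq_ge0 p) dd)); have := Isq_ge0 p1; ilra.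
have g2 : I (W1 * q * (W1 * q)) <= I (q1 * q1).
  apply: le_trans o2 _; apply: (le_trans (ler_wpM2r (Isq_ge0 q) dd)); have := Isq_ge0 q1; ilra.
have z1 := @I_youngA _ (W1 * p) (T Kc1 V p) 1 ltr01.
have z2 := @I_youngA _ (W1 * q) (T Kc1 V q) 1 ltr01.
have z3 := @I_youngA _ (W1 * q) (T Ks1 V p) 1 ltr01.
have z4 := @I_youngA _ (W1 * p) (T Ks1 V q) 1 ltr01.
move: z1 z2 z3 z4; rewrite invr1 !ler_norml => /andP[_ z1] /andP[_ z2] /andP[_ z3] /andP[z4 _].
pose S := 2 * (I (W1 * p * T Kc1 V p) + I (W1 * q * T Kc1 V q)
           + I (W1 * q * T Ks1 V p) - I (W1 * p * T Ks1 V q)).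
have zS : S <= 2002 * (I (p1 * p1) + I (q1 * q1)).
  rewrite /S; clear Qu D1 D2 o1 o2 c1 c2 v1 v2 nX1 nX2 nY1 nY2 A1 A2 C1 C2 dd; ilra.
have zS' : e ^+ 2 * S <= 2002 * A by rewrite nAE [2002 * _]mulrCA; apply: ler_wpM2l; [exact: sqr_ge0|exact: zS].
rewrite -/S.
(* One factor [k e] is the common rate; the remaining [e^2] pays for the derivatives in the viscous
   terms. *)
have me : m = k * e * e ^+ 2 by rewrite /m; ring.
rewrite me.
have L0 : 0 < k * e by rewrite mulr_gt0.
have u1 : k * e * (e ^+ 2 * S) <= k * e * (2002 * A) by rewrite ler_pM2l.
have u2 : k * e * (2 * e ^+ 2 * I (p2 * X1)) <= k * e * ((16 * 1000) * A + 500 * B + 4 * CC) by rewrite ler_pM2l.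
have u3 : k * e * (2 * e ^+ 2 * I (q2 * X2)) <= k * e * ((16 * 1000) * A + 500 * B + 4 * CC) by rewrite ler_pM2l.
have u4 : k * e * Qv <= k * e * (17 * B) by rewrite ler_pM2l.
have u5 : k * (Dk - e * B) <= k * (I (p * T h V p) + I (q * T h V q)).
  rewrite ler_pM2l// /Dk /nB mulrDr opprD addrACA; exact: lerD D1 D2.
have A0 : 0 <= k * e * A by apply: mulr_ge0; [exact: ltW|exact: le_trans (Isq_ge0 _) A1].
clear zS zS' z1 z2 z3 z4 g1 g2 o1 o2 c1 c2 D1 D2 Qu v1 v2 nX1 nX2 nY1 nY2 A1 A2 C1 C2 t1 t2 t3 t4 me dd; move: u1 u2 u3 u4 u5 A0; generalize S Qv Dk A B CC; genI; intros; lra.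
Qed.

End FullEnergy.

(** * Stream function and buoyancy as sources *)

Section Coupling.
Context {R : realType}.
Local Notation C := (@cfct R).
Implicit Types f g h K u : C.

Lemma I_young_abs f g s : 0 < s ->
  2 * I (f * g) <= s * I (f * f) + s^-1 * I (g * g) /\
  - (2 * I (f * g)) <= s * I (f * f) + s^-1 * I (g * g).
Proof. by move=> s0; have := I_youngA f g s0; rewrite ler_norml => /andP[]; lra. Qed.

Variables (V W W1 W2 : C) (d : R).
Hypotheses (d0 : 0 < d) (d1 : d <= 1 / 10).
Hypotheses (hV : der V (1 + W)) (hW : der W W1) (hW1 : der W1 W2).
Hypotheses (W_half : forall y, - (1 / 2) <= W y <= 1 / 2).
Hypotheses (W1_d : forall y, -1 <= y <= 1 -> `|W1 y| <= d) (W2_d : I (W2 * W2) <= d ^+ 2).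
Variables (k e c : R) (k1 : 1 <= k) (e0 : 0 < e).
Variables (Kc Ks h Kc1 Ks1 : C) (KN : kernels k e Kc Ks h Kc1 Ks1).
Let hVok : shear_ok V (1 + W) := shear_okV hV W_half.
Let k0 : 0 < k. Proof. exact: lt_le_trans ltr01 k1. Qed.

Definition stream_energy (a a1 : C) := I (a1 * a1) + k ^+ 2 * I (a * a).

(** Since [p = a1' - k^2 a], integrating by parts turns the pairing into the [H^1] inner product of
    the stream function [a] with [W1 b]; smallness of the shear curvature then yields the factor
    [d]. *)
Lemma psi_pair p a a1 b b1 : der a a1 -> der a1 (p + cc (k ^+ 2) * a) ->
  der b b1 -> dirich b ->
  2 * I (p * (W1 * b)) <= d * stream_energy a a1 + 6 * d * stream_energy b b1 /\
  - (2 * I (p * (W1 * b))) <= d * stream_energy a a1 + 6 * d * stream_energy b b1.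
Proof.
move=> ha ha1 hb hb0.
have [f1 hf [n1 n2]] := W1_H1 hW1 W1_d W2_d k hb hb0.
have [f0 f0'] := W1_dirich W1 hb0.
have := IBP0 hf ha1 f0 f0'; rewrite cmulDr ID.
have -> : W1 * b * (cc (k ^+ 2) * a) = cc (k ^+ 2) * (a * (W1 * b)) by ring.
rewrite IZ (cmulC (W1 * b) p) => E.
have [y1 y2] := I_young_abs a1 f1 d0.
have [y3 y4] := I_young_abs a (W1 * b) d0.
have kk : 0 <= k ^+ 2 by exact: sqr_ge0.
have z3 := ler_wpM2l kk y3; have z4 := ler_wpM2l kk y4.
have di : 0 <= d^-1 by rewrite invr_ge0 ltW.
have m1 := ler_wpM2l di n1; have m2 := ler_wpM2l di n2.
have e1 x : d^-1 * (6 * d ^+ 2 * x) = 6 * d * x by field; rewrite gt_eqF.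
have e2 x : d^-1 * (d ^+ 2 * x) = d * x by field; rewrite gt_eqF.
move: m1 m2; rewrite e1 e2 /stream_energy => m1 m2.
have b0 : 0 <= d * (k ^+ 2 * I (b * b)).
  by apply: mulr_ge0; [exact: ltW|apply: mulr_ge0 => //; exact: Isq_ge0].
rewrite (cmulC f1 a1) in E.
clear e1 e2 y3 y4 n1 n2.
by split; ilra.
Qed.

Lemma psi_der r r1 b b1 s : 0 < s -> der r r1 -> der b b1 -> dirich b ->
  2 * I (r1 * (W1 * b)) <= s * I (r * r) + s^-1 * (6 * d ^+ 2 * stream_energy b b1) /\
  - (2 * I (r1 * (W1 * b))) <= s * I (r * r) + s^-1 * (6 * d ^+ 2 * stream_energy b b1).
Proof.
move=> s0 hr hb hb0.
have [f1 hf [n1 _]] := W1_H1 hW1 W1_d W2_d k hb hb0.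
have [f0 f0'] := W1_dirich W1 hb0.
have := IBP hr hf; rewrite f0 f0' !mulr0 subr0 sub0r => E.
have [y1 y2] := I_young_abs r f1 s0.
have n2 : I (f1 * f1) <= 6 * d ^+ 2 * stream_energy b b1.
  apply: le_trans n1 _; apply: ler_wpM2l; first by apply: mulr_ge0 => //; exact: sqr_ge0.
  by rewrite /stream_energy lerDl; apply: mulr_ge0; [exact: sqr_ge0|exact: Isq_ge0].
have n3 : s^-1 * I (f1 * f1) <= s^-1 * (6 * d ^+ 2 * stream_energy b b1).
  by apply: ler_wpM2l => //; rewrite invr_ge0 ltW.
by rewrite E; split; clear n2 n1; ilra.
Qed.

(** [pair_bound] is applied to [g = T K V (W1 b)] and to its negative. Multiplied by [k], its right
    side is [4 k^2 |g|^2 + 2 |g1|^2], which [T_H1] and [W1_H1] bound by [2 * 2500 * 6 d^2] times the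
    stream energy. *)
Lemma psi_kernel K K1 r b b1 s : 0 < s -> derR K K1 ->
  (forall g, I (T K V g * T K V g) <= 100 * I (g * g)) ->
  der b b1 -> dirich b ->
  2 * k * I (r * T K V (W1 * b)) <= k * (6 * s * I (r * T (kexp k) V r))
     + s^-1 * (30 * 1000 * d ^+ 2 * stream_energy b b1) /\
  - (2 * k * I (r * T K V (W1 * b))) <= k * (6 * s * I (r * T (kexp k) V r))
     + s^-1 * (30 * 1000 * d ^+ 2 * stream_energy b b1).
Proof.
move=> s0 hK nK hb hb0.
have [f1 hf [n1 n2]] := W1_H1 hW1 W1_d W2_d k hb hb0.
have hf0 := W1_dirich W1 hb0.
have [hT _ t3] := T_H1 d1 hV hW W_half W1_d W2_d hK nK hf hf0.
have t1 := nK (W1 * b).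
have P1 := pair_bound hV W_half W2_d k1 r s0 hT.
have P2 := pair_bound hV W_half W2_d k1 r s0 (derN hT).
have [Ng Ng1] : (forall u, r * - u = - (r * u)) /\ (forall u, - u * - u = u * u) by split=> u; ring.
rewrite Ng !Ng1 IN in P2; clear Ng Ng1.
have S : k * (4 * k * I (T K V (W1 * b) * T K V (W1 * b)) +
   2 * k^-1 * I ((1 + W) * T K1 V (W1 * b) * ((1 + W) * T K1 V (W1 * b))))
   <= 30 * 1000 * d ^+ 2 * stream_energy b b1.
  have kk : 0 <= k ^+ 2 by exact: sqr_ge0.
  have z := ler_wpM2l kk t1.
  have b0 : 0 <= d ^+ 2 * (k ^+ 2 * I (b * b)).
    by apply: mulr_ge0; [exact: sqr_ge0|apply: mulr_ge0 => //; exact: Isq_ge0].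
  rewrite /stream_energy; clear P1 P2 t1; move: n1 n2 t3 z b0.
  move: (I (f1 * f1)) (I (W1 * b * (W1 * b))) (I (T K V (W1 * b) * T K V (W1 * b))) => x1 x2 x3.
  move: (I (_ * (_ * _))) (I (b * b)) (I (b1 * b1)) => x4 x5 x6.
  have -> : k * (4 * k * x3 + 2 * k^-1 * x4) = 4 * (k ^+ 2 * x3) + 2 * x4 by field; rewrite gt_eqF.
  by move: (d ^+ 2) (k ^+ 2) => D K2; lra.
have si : 0 <= s^-1 by rewrite invr_ge0 ltW.
have S' := ler_wpM2l si S.
have Q1 := ler_wpM2l (ltW k0) P1; have Q2 := ler_wpM2l (ltW k0) P2.
move: S' Q1 Q2; clear P1 P2 S t1 t3 n1 n2 nK.
set X := 4 * k * _ + _; move: X => X.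
by split; ilra.
Qed.

(** In this lemma and the next two, the Young weights [e / 1000], [e^3 / 10] and [e^2] are chosen so
    that the forcing always appears with the factor [k / e], whichever norm absorbs the other
    half. *)
Lemma theta_main r g : k * (2 * I (r * g)) <= k * e * (I (r * r) / 1000) + 1000 * (k / e) * I (g * g) /\
  - (k * (2 * I (r * g))) <= k * e * (I (r * r) / 1000) + 1000 * (k / e) * I (g * g).
Proof.
have s0 : 0 < e / 1000 by rewrite divr_gt0 ?ltr0n.
have [y1 y2] := I_young_abs r g s0.
have E x y : k * (e / 1000 * x + (e / 1000)^-1 * y) = k * e * (x / 1000) + 1000 * (k / e) * y.
  by field; rewrite gt_eqF.
by rewrite -E -mulrN !ler_pM2l.
Qed.

Lemma theta_visc r g : k * (e ^+ 2 * (2 * I (g * r))) <=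
   k * e * (I (cc (e ^+ 2) * r * (cc (e ^+ 2) * r)) / 10) + 10 * (k / e) * I (g * g) /\
  - (k * (e ^+ 2 * (2 * I (g * r)))) <=
   k * e * (I (cc (e ^+ 2) * r * (cc (e ^+ 2) * r)) / 10) + 10 * (k / e) * I (g * g).
Proof.
have s0 : 0 < e ^+ 3 / 10 by rewrite divr_gt0 ?exprn_gt0 ?ltr0n.
have [y1 y2] := I_young_abs r g s0; rewrite (cmulC g r).
have -> : cc (e ^+ 2) * r * (cc (e ^+ 2) * r) = cc (e ^+ 4) * (r * r) by ring.
have E x y : k * (e ^+ 2 * (e ^+ 3 / 10 * x + (e ^+ 3 / 10)^-1 * y)) =
   k * e * (e ^+ 4 * x / 10) + 10 * (k / e) * y.
  by field; rewrite gt_eqF.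
have e2 : 0 < e ^+ 2 by rewrite exprn_gt0.
by rewrite IZ -E -2!mulrN !ler_pM2l.
Qed.

Lemma theta_der r g : k * (e * (2 * I (g * r))) <=
   k * e * I (cc e * r * (cc e * r)) + k / e * I (g * g) /\
  - (k * (e * (2 * I (g * r)))) <=
   k * e * I (cc e * r * (cc e * r)) + k / e * I (g * g).
Proof.
have s0 : 0 < e ^+ 2 by rewrite exprn_gt0.
have [y1 y2] := I_young_abs r g s0; rewrite (cmulC g r).
have -> : cc e * r * (cc e * r) = cc (e ^+ 2) * (r * r) by ring.
have E x y : k * (e * (e ^+ 2 * x + (e ^+ 2)^-1 * y)) =
   k * e * (e ^+ 2 * x) + k / e * y.
  by field; rewrite gt_eqF.
by rewrite IZ -E -2!mulrN !ler_pM2l.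
Qed.

Variables (p p1 p2 q q1 q2 a a1 b b1 f g : C).
Hypotheses (hp : der p p1) (hp1 : der p1 p2) (hp0 : dirich p).
Hypotheses (hq : der q q1) (hq1 : der q1 q2) (hq0 : dirich q).
Hypotheses (ha : der a a1) (ha1 : der a1 (p + cc (k ^+ 2) * a)) (ha0 : dirich a).
Hypotheses (hb : der b b1) (hb1 : der b1 (q + cc (k ^+ 2) * b)) (hb0 : dirich b).
Hypothesis d_small : 1000 * 1000 * 1000 * 10 * d <= 1.

Let F1 : C := cc k * (g - W1 * b).
Let F2 : C := cc k * (W1 * a - f).
Local Notation A := (nA e p1 q1).
Local Notation B := (nB p q).
Local Notation CC := (nC e p2 q2).
Local Notation Th := (I (f * f) + I (g * g)).
Let Dk := I (p * T (kexp k) V p) + I (q * T (kexp k) V q).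
Let N2 := stream_energy a a1 + stream_energy b b1.

Lemma d_sq_small : 60 * 1000 * 1000 * 100 * (d * d) <= 1.
Proof.
have h1 : 1000 * 1000 * 1000 * 10 * d * d <= 1 * d by rewrite ler_pM2r.
have h2 := d1; move: h1; rewrite -!mulrA; move: (d * d) => y; lra.
Qed.

Lemma N2_bounds : [/\ 0 <= N2, N2 <= B & N2 <= 9 * Dk].
Proof.
have [x1 x2 x3] := stream_bounds hV W_half W2_d k1 ha ha1 ha0.
have [y1 y2 y3] := stream_bounds hV W_half W2_d k1 hb hb1 hb0.
have n1 : stream_energy a a1 <= k * stream_energy a a1 by rewrite ler_peMl.
have n2 : stream_energy b b1 <= k * stream_energy b b1 by rewrite ler_peMl.
split; first exact: addr_ge0.
  exact: lerD x2 y2.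
by rewrite /Dk mulrDr; apply: lerD; [exact: le_trans n1 x3|exact: le_trans n2 y3].
Qed.

(** This source lacks the factor [e], so it is charged to the positive form [Dk] supplied by [Q]:
    [63] is 7, from the two uses of [psi_pair], times the 9 of [N2_bounds]. *)
Lemma src_psi0 : k * (2 * I (q * (W1 * a)) - 2 * I (p * (W1 * b))) <= 63 * d * (k * Dk).
Proof.
have [_ m1] := psi_pair ha ha1 hb hb0; have [m2 _] := psi_pair hb hb1 ha ha0.
have [_ _ n] := N2_bounds.
have -> : 63 * d * (k * Dk) = k * (7 * d * (9 * Dk)) by ring.
rewrite ler_pM2l//; apply: le_trans (_ : 7 * d * N2 <= _); last by rewrite ler_pM2l// mulr_gt0.
rewrite /N2; lra.
Qed.

Lemma dN2 : 600 * (d ^+ 2 * N2) <= B / 1000.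
Proof.
have [n0 nB _] := N2_bounds; have hd := d_sq_small.
have := ler_wpM2r n0 hd.
by rewrite expr2 -!mulrA; move: (d * (d * N2)) => z; lra.
Qed.

(** One derivative passes from [p2] to [W1 b]. With weight [e], the prefactor [e^2] leaves exactly
    [e (nA + 6 d^2 N2)], and [N2 <= nB] closes the estimate. *)
Lemma src_psi2 : k * (e ^+ 2 * (2 * I (p2 * (W1 * b)) - 2 * I (q2 * (W1 * a)))) <= k * e * (A + B / 1000).
Proof.
have [m1 _] := psi_der e0 hp1 hb hb0; have [_ m2] := psi_der e0 hq1 ha ha0.
have E x y : k * (e ^+ 2 * (e * x + e^-1 * y)) = k * e * (e ^+ 2 * x + y) by field; rewrite gt_eqF.
have kk : 0 < k * e by rewrite mulr_gt0.
have n := dN2; have [n0 _ _] := N2_bounds.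
have h1 : k * (e ^+ 2 * (2 * I (p2 * (W1 * b)) - 2 * I (q2 * (W1 * a)))) <=
  k * (e ^+ 2 * (e * (I (p1 * p1) + I (q1 * q1)) + e^-1 * (6 * d ^+ 2 * N2))).
  rewrite ler_pM2l// ler_pM2l ?exprn_gt0//; apply: le_trans (lerD m1 m2) _.
  rewrite /N2 le_eqVlt; apply/orP; left; apply/eqP; move: (stream_energy _ _) (stream_energy _ _) => ? ?; ring.
apply: le_trans h1 _; rewrite E -nAE ler_pM2l// lerD2l -mulrA.
have : 0 <= d ^+ 2 * N2 by apply: mulr_ge0 => //; exact: sqr_ge0.
by move: n; move: (d ^+ 2 * N2) B => x y; lra.
Qed.

Lemma src_psi1 : k * (e * (- (2 * I (q1 * (W1 * b))) - 2 * I (p1 * (W1 * a)))) <= k * e * (B / 100 + B / 1000).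
Proof.
have s0 : 0 < 1 / 100 :> R by rewrite divr_gt0 ?ltr0n.
have [_ m1] := psi_der s0 hq hb hb0; have [_ m2] := psi_der s0 hp ha ha0.
have kk : 0 < k * e by rewrite mulr_gt0.
have n := dN2.
rewrite mulrA ler_pM2l//.
have si : (1 / 100)^-1 = 100 :> R by rewrite div1r invrK.
move: m1 m2; rewrite si => m1 m2.
have E x : 100 * (6 * d ^+ 2 * x) = 600 * (d ^+ 2 * x) by ring.
move: m1 m2; rewrite !E; move: n; rewrite /N2 {E}.
move: (stream_energy _ _) (stream_energy _ _) => x y; rewrite mulrDr /nB; ilra.
Qed.

Lemma srcE : Src e p p1 p2 q q1 q2 F1 F2 =
  (k * (2 * I (p * g)) - k * (2 * I (q * f)))
  + k * (2 * I (q * (W1 * a)) - 2 * I (p * (W1 * b)))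
  + 1 / 100 * (- (k * (e ^+ 2 * (2 * I (g * p2)))) + k * (e ^+ 2 * (2 * I (f * q2))))
  + 1 / 100 * (k * (e ^+ 2 * (2 * I (p2 * (W1 * b)) - 2 * I (q2 * (W1 * a)))))
  + 1 / 100 * (k * (e * (2 * I (g * q1))) + k * (e * (2 * I (f * p1))))
  + 1 / 100 * (k * (e * (- (2 * I (q1 * (W1 * b))) - 2 * I (p1 * (W1 * a))))).
Proof.
have x1 u : I (u * F1) = k * (I (u * g) - I (u * (W1 * b))).
  by rewrite -IB -IZ; congr I; rewrite /F1; ring.
have x2 u : I (F1 * u) = k * (I (g * u) - I (u * (W1 * b))).
  by rewrite -IB -IZ; congr I; rewrite /F1; ring.
have x3 u : I (u * F2) = k * (I (u * (W1 * a)) - I (u * f)).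
  by rewrite -IB -IZ; congr I; rewrite /F2; ring.
have x4 u : I (F2 * u) = k * (I (u * (W1 * a)) - I (f * u)).
  by rewrite -IB -IZ; congr I; rewrite /F2; ring.
by rewrite /Src !x1 !x2 !x3 !x4; genI; intros; field.
Qed.

Lemma src_le : Src e p p1 p2 q q1 q2 F1 F2 <= 63 * d * (k * Dk)
  + k * e * (2 / 100 * A + 2 / 1000 * B + 1 / 1000 * CC) + 1001 * (k / e * Th).
Proof.
rewrite srcE; have z1 := src_psi0; have z2 := src_psi1; have z3 := src_psi2.
have [t1 _] := theta_main p g; have [_ t2] := theta_main q f.
have [_ v1] := theta_visc p2 g; have [v2 _] := theta_visc q2 f.
have [r1 _] := theta_der q1 g; have [r2 _] := theta_der p1 f.
have h1 : k * (2 * I (p * g)) - k * (2 * I (q * f)) <= k * e * B / 1000 + 1000 * (k / e * Th).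
  by rewrite /nB; move: t1 t2; genI; intros; lra.
have h2 : - (k * (e ^+ 2 * (2 * I (g * p2)))) + k * (e ^+ 2 * (2 * I (f * q2)))
   <= k * e * CC / 10 + 10 * (k / e * Th).
  by rewrite /nC; move: v1 v2; genI; intros; lra.
have h3 : k * (e * (2 * I (g * q1))) + k * (e * (2 * I (f * p1))) <= k * e * A + k / e * Th.
  by rewrite /nA; move: r1 r2; genI; intros; lra.
have B0 : 0 <= k * e * B by apply: mulr_ge0; [rewrite mulr_ge0// ltW|rewrite addr_ge0 ?Isq_ge0].
have T0 : 0 <= k / e * Th by apply: mulr_ge0; [rewrite divr_ge0// ltW|rewrite addr_ge0 ?Isq_ge0].
clear t1 t2 v1 v2 r1 r2; move: h1 h2 h3 z1 z2 z3 B0 T0.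
generalize Dk A B CC Th => Dk' A' B' C' T'.
move: (_ - k * (2 * I (q * f))) (- _ + k * (e ^+ 2 * (2 * I (f * q2)))) (_ + k * (e * (2 * I (f * p1)))) => X1 X2 X3.
move: (k * _) (k * (e * (- _ - _))) (k * (e ^+ 2 * (_ - _))) => X4 X5 X6.
move: (k / e * T') => X7; lra.
Qed.

Let X1 := T Kc V p - T Ks V q.
Let X2 := T Kc V q + T Ks V p.

Lemma kernel_psi : 2 * k * I (W1 * a * X2) - 2 * k * I (W1 * b * X1) <= 13 / 100 * (k * Dk).
Proof.
have s0 : 0 < 1 / 100 :> R by rewrite divr_gt0 ?ltr0n.
have nc u := Tc_norm KN u hVok; have ns u := Ts_norm k0 e0 KN u hVok.
have [_ m1] := psi_kernel p s0 (kn_c1 KN) nc hb hb0.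
have [_ m2] := psi_kernel q s0 (kn_s1 KN) ns hb hb0.
have [m3 _] := psi_kernel q s0 (kn_c1 KN) nc ha ha0.
have [_ m4] := psi_kernel p s0 (kn_s1 KN) ns ha ha0.
have si : (1 / 100)^-1 = 100 :> R by rewrite div1r invrK.
move: m1 m2 m3 m4; rewrite !si => m1 m2 m3 m4.
have S1 := symc KN V (W1 * b) p; have S2 := symc KN V (W1 * a) q.
have S3 := antis KN V (W1 * b) q; have S4 := antis KN V (W1 * a) p.
have -> : I (W1 * a * X2) = I (q * T Kc V (W1 * a)) - I (p * T Ks V (W1 * a)).
  by rewrite /X2 cmulDr ID; clear m1 m2 m3 m4 S1 S3 nc ns; ilra.
have -> : I (W1 * b * X1) = I (p * T Kc V (W1 * b)) + I (q * T Ks V (W1 * b)).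
  by rewrite /X1 cmulBr IB; clear m1 m2 m3 m4 S2 S4 nc ns; ilra.
clear S1 S2 S3 S4 nc ns.
have [n0 _ n9] := N2_bounds; have ds := d_sq_small.
have D0 : 0 <= Dk by lra.
have kD : Dk <= k * Dk by rewrite ler_peMl.
have z := ler_wpM2r n0 ds.
have hN : 100 * (60 * 1000 * d ^+ 2 * N2) <= 1 / 100 * (k * Dk).
  by move: z; rewrite expr2 -!mulrA; move: (d * (d * N2)) (k * Dk) kD => x y kD; lra.
(* Each of [p] and [q] is paired twice with cost [6 / 100], which makes [12 / 100]; the terms
   quadratic in [d] fit into the last hundredth. *)
have -> : 13 / 100 * (k * Dk) = 12 / 100 * (k * Dk) + 1 / 100 * (k * Dk) by lra.
apply: le_trans (lerD (lexx _) hN).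
clear z ds hN kD D0 n0 n9; move: m1 m2 m3 m4; rewrite /N2 /Dk.
move: (stream_energy _ _) (stream_energy _ _) => x y; genI; intros; lra.
Qed.

Lemma kernel_src_le : 2 * I (F1 * X1) + 2 * I (F2 * X2) <= 13 / 100 * (k * Dk) + 400 * (k * e * B) + k / e * Th.
Proof.
have [n1 n2] : I (X1 * X1) <= 200 * B /\ I (X2 * X2) <= 200 * B := X_norm hV W_half W2_d k1 e0 KN p q.
have x2 u : I (F1 * u) = k * (I (u * g) - I (W1 * b * u)).
  by rewrite -IB -IZ; congr I; rewrite /F1; ring.
have x4 u : I (F2 * u) = k * (I (W1 * a * u) - I (u * f)).
  by rewrite -IB -IZ; congr I; rewrite /F2; ring.
rewrite x2 x4; have z := kernel_psi.
have [y1 _] := I_young_abs X1 g e0; have [_ y2] := I_young_abs X2 f e0.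
have h1 : k * (2 * I (X1 * g) - 2 * I (X2 * f)) <= k * (e * (I (X1 * X1) + I (X2 * X2)) + e^-1 * Th).
  by rewrite ler_pM2l//; clear n1 n2 z x2 x4; ilra.
have h2 : k * (e * (I (X1 * X1) + I (X2 * X2))) <= k * (e * (400 * B)).
  by rewrite ler_pM2l// ler_pM2l//; clear y1 y2 h1 z x2 x4; move: n1 n2; generalize B; genI; intros; lra.
clear x2 x4 n1 n2 y1 y2; move: z h1 h2; generalize B Dk Th; genI; intros; lra.
Qed.

(** Two constraints fix this weight. Upwards, [kap (1018 + 400)] must stay below what is left of the
    gain in [nB], about [0.00387 - 0.003]. Downwards, [kap (1 - 13 / 100)] must exceed [63 d], which
    [d <= 10^-10] ensures. *)
Let kap : R := 1 / 1000 / 1000 / 10.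
Let U : C := V + cc c.
Let m := k * e ^+ 3.
Let pt : C := cc k * (U * q) + cc m * p2 + F1.
Let qt : C := - (cc k * (U * p)) + cc m * q2 + F2.

Lemma energy_rate : dE0 e p p1 p2 q q1 q2 pt qt + kap * dQ V Kc Ks Kc1 Ks1 p q pt qt (cc m * W1)
  <= - (1 / 1000) * (k * e * (A + B)) + 1003 * (k / e * Th).
Proof.
have -> : dE0 e p p1 p2 q q1 q2 pt qt = k * e * BR (1 + W) e p p1 p2 q q1 q2 + Src e p p1 p2 q q1 q2 F1 F2.
  exact: dE0_id hVok hp hp1 hp0 hq hq1 hq0 _ _.
have hBR := BR_le e p p1 p2 q q1 q2 hVok.
have hQ : dQ V Kc Ks Kc1 Ks1 p q pt qt (cc m * W1) <= - (k * Dk) +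
   k * e * (35 * 1000 * A + 1018 * B + 8 * CC) + 2 * I (F1 * X1) + 2 * I (F2 * X2).
  exact: (dQ_le d0 d1 hV hW W_half W1_d W2_d c k1 e0 KN hp hp1 hp0 hq hq1 hq0).
have hK := kernel_src_le; have hS := src_le.
have L0 : 0 < k * e by rewrite mulr_gt0.
have hB' := hBR; rewrite -(ler_pM2l L0) in hB'.
have [n0 _ n9] := N2_bounds.
have D0 : 0 <= k * Dk by apply: mulr_ge0; [exact: ltW|lra].
have hd := ler_wpM2r D0 d_small.
have A0 : 0 <= k * e * A by apply: mulr_ge0; [exact: ltW|rewrite addr_ge0 ?Isq_ge0].
have B0 : 0 <= k * e * B by apply: mulr_ge0; [exact: ltW|rewrite addr_ge0 ?Isq_ge0].
have C0 : 0 <= k * e * CC by apply: mulr_ge0; [exact: ltW|rewrite addr_ge0 ?Isq_ge0].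
have T0 : 0 <= k / e * Th by apply: mulr_ge0; [rewrite divr_ge0// ltW|rewrite addr_ge0 ?Isq_ge0].
move: hB' hS hQ hK hd D0 A0 B0 C0 T0; clear hBR n0 n9; rewrite /kap.
move: (BR _ _ _ _ _ _ _ _) (Src _ _ _ _ _ _ _ _ _) (dQ _ _ _ _ _ _ _ _ _ _) => X Y Z.
move: (2 * I (F1 * X1)) (2 * I (F2 * X2)) (k / e * Th) => Q1 Q2 T'.
move: (k * Dk) A B CC => D' A' B' C'; lra.
Qed.

End Coupling.

(** * Evolution of the energies *)

Section Evolution.
Context {R : realType}.
Local Notation C := (@cfct R).
Implicit Types (F G : R -> C).

Lemma ud_I_near F (G : R -> R) t (f : C) d : ud inI F t f ->
  (\forall s \near t, G s = I (F s)) -> d = I f -> is_derive t (1 : R) G d.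
Proof.
move=> hF hG ->; apply: near_eq_is_derive (ud_I hF).
by apply: filterS hG => s ->.
Qed.

Lemma primB (f g : C) y : prim (f - g) y = prim f y - prim g y.
Proof.
by rewrite -RintegralB//; exact: cfct_int.
Qed.

Lemma is_derive_lin (f g : R -> R) (c t a b : R) : is_derive t (1 : R) f a -> is_derive t (1 : R) g b ->
  is_derive t (1 : R) (fun s => f s + c * g s) (a + c * b).
Proof. by move=> hf hg; apply: is_deriveD; apply: is_deriveZ. Qed.

Lemma ud_prim F t (f : C) : ud inI F t f -> ud inI (fun s => prim (F s)) t (prim f).
Proof.
move=> [_ _ h]; split; [exact: bdd_cfct|exact: bdd_cfct|] => e e0.
have e2 : 0 < e / 2 by lra.
apply: filterS (h _ e2) => s hs y hy.
have -> : prim (F s) y - prim (F t) y - (s - t) * prim f y = prim (F s - F t - cc (s - t) * f) y.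
  have p1 := primB (F s - F t) (cc (s - t) * f) y; have p2 := primB (F s) (F t) y.
  by rewrite p1 p2 primZ.
apply: le_trans (prim_abs _ hy) _.
have -> : e * `|s - t| = 2 * (e / 2 * `|s - t|) by field.
rewrite -[leLHS]ger0_norm; last by apply: I_ge0 => z _; rewrite absCE.
by apply: I_small => z hz; rewrite absCE !cfB cfM ccE normr_id; exact: hs.
Qed.

Lemma ud_sq F t (f : C) : ud inI F t f -> is_derive t (1 : R) (fun s => I (F s * F s)) (2 * I (F t * f)).
Proof.
move=> h; apply: (ud_I_eq (f := f * F t + F t * f) (F := fun s => F s * F s)) => //.
  by apply: ud_ext (udM h h) => [s y _|y _]; rewrite ?cfD !cfM.
by rewrite ID (cmulC f) -mulr2n mulr_natl.
Qed.

(* [F1] and [F2] are the first two space derivatives of [F], [Ft] its time derivative. *)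
Definition evolves F F1 F2 (Ft : R -> C) :=
  forall t, 0 < t -> [/\ der (F t) (F1 t), der (F1 t) (F2 t),
    ud inI F t (Ft t), uc inI F1 t & uc inI F2 t].

Variables (P P1 P2 Pt S S1 S2 St : R -> C).
Hypotheses (eP : evolves P P1 P2 Pt) (eS : evolves S S1 S2 St).
Hypotheses (dP : forall t, 0 < t -> dirich (P t)) (dS : forall t, 0 < t -> dirich (S t)).

Lemma sq_rate (t : R) : 0 < t -> is_derive t (1 : R) (fun s => I (P s * P s)) (2 * I (P t * Pt t)).
Proof.
by move=> t0; have [_ _ h _ _] := eP t0; exact: ud_sq.
Qed.

(** The difference of [|P1 s|^2] and [|P1 t|^2] is the integral of [(P1 s - P1 t) (P1 s + P1 t)],
    that is, minus that of [(P s - P t) (P2 s + P2 t)]. Only the time derivative of [P] and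
    continuity of [P2] are then involved, through [udM0]. *)
Lemma dirichlet_rate (t : R) : 0 < t ->
  is_derive t (1 : R) (fun s => I (P1 s * P1 s)) (- 2 * I (Pt t * P2 t)).
Proof.
move=> t0; have [h1 h2 h _ u2] := eP t0.
pose F s : C := P1 t * P1 t - (P s - P t) * (P2 s + P2 t).
have hF : ud inI F t (- (Pt t * (P2 t + P2 t))).
  have u : uc inI (fun s => P2 s + P2 t : C) t.
    case: u2 => _ u2; split; first exact: bdd_cfct.
    move=> e e0; apply: filterS (u2 e e0) => s hs y hy; rewrite !cfD.
    by rewrite opprD addrACA subrr addr0; exact: hs.
  have c1 : ud inI (fun=> P1 t * P1 t : C) t (0 : C).
    by apply: ud_ext (ud_cst t (bdd_cfct (P1 t * P1 t))) => // y _; rewrite cf0.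
  apply: ud_ext (udB c1 (udM0 h u)) => [s y _|y _]; first by rewrite /F !(cfB, cfM, cfD).
  by rewrite cfN cfM cf0 sub0r.
apply: ud_I_near hF _ _; last by rewrite IN cmulDr ID; lra.
near=> s; have s0 : 0 < s by near: s; exact: lt_nbhsr.
have [g1 g2 _ _ _] := eP s0; have [p0 p0'] := dP t0; have [q0 q0'] := dP s0.
have z0 : (P s - P t) (-1) = 0 by rewrite cfB p0 q0 subrr.
have z1 : (P s - P t) 1 = 0 by rewrite cfB p0' q0' subrr.
have := IBP0 (derB g1 h1) (derD g2 h2) z0 z1.
rewrite /F IB -[X in _ - X]opprK => <-; rewrite opprK -ID; congr I; ring.
Unshelve. all: by end_near. Qed.

Lemma cross_rate (t : R) : 0 < t -> is_derive t (1 : R) (fun s => I (P s * S1 s) - I (S s * P1 s))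
  (2 * I (Pt t * S1 t) - 2 * I (St t * P1 t)).
Proof.
move=> t0; have [h1 h2 h _ _] := eP t0; have [k1 _ kk u1 _] := eS t0.
pose F s : C := cc 2 * (P t * S1 t + (P s - P t) * S1 s) - cc 2 * (P1 t * (S s - S t)).
have hF : ud inI F t (cc 2 * (Pt t * S1 t) - cc 2 * (P1 t * St t)).
  have c (f : C) : ud inI (fun=> f) t (0 : C).
    by apply: ud_ext (ud_cst t (bdd_cfct f)) => // y _; rewrite cf0.
  have a1 := udM (c (cc 2)) (udD (c (P t * S1 t)) (udM0 h u1)).
  have a2 := udM (c (cc 2)) (udM (c (P1 t)) (udB kk (c (S t)))).
  apply: ud_ext (udB a1 a2) => [s y _|y _]; rewrite /F !(cfB, cfM, cfD) ?ccE ?cf0//; ring.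
apply: ud_I_near hF _ _; last by rewrite IB !IZ (cmulC (P1 t)).
near=> s; have s0 : 0 < s by near: s; exact: lt_nbhsr.
have [g1 _ _ _ _] := eP s0; have [l1 _ _ _ _] := eS s0.
have [p0 p0'] := dP t0; have [q0 q0'] := dP s0; have [r0 r0'] := dS s0; have [v0 v0'] := dS t0.
have y1 := IBP0 g1 l1 q0 q0'; have y2 := IBP0 h1 l1 p0 p0'; have y3 := IBP0 h1 k1 p0 p0'.
have y4 : I (P s * S1 s) - I (P t * S1 s) = I ((P s - P t) * S1 s) by rewrite cmulBl IB.
have y5 : I (P1 t * S s) - I (P1 t * S t) = I (P1 t * (S s - S t)) by rewrite cmulBr IB.
rewrite /F IB !IZ ID (cmulC (S s)); ilra.
Unshelve. all: by end_near. Qed.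

End Evolution.

Section FullEnergyRate.
Context {R : realType}.
Local Notation C := (@cfct R).
Variables (P P1 P2 Pt S S1 S2 St : R -> C).
Hypotheses (eP : evolves P P1 P2 Pt) (eS : evolves S S1 S2 St).
Hypotheses (dP : forall t, 0 < t -> dirich (P t)) (dS : forall t, 0 < t -> dirich (S t)).

Lemma energy0_rate (e t : R) : 0 < t -> is_derive t (1 : R) (fun s => E0 e (P s) (P1 s) (S s) (S1 s))
  (dE0 e (P t) (P1 t) (P2 t) (S t) (S1 t) (S2 t) (Pt t) (St t)).
Proof.
move=> t0.
have a1 := sq_rate eP t0; have a2 := sq_rate eS t0.
have b1 := dirichlet_rate eP dP t0; have b2 := dirichlet_rate eS dS t0.
have c1 := cross_rate eP eS dP dS t0.
have := is_derive_lin (e / 100) (is_derive_lin (e ^+ 2 / 100) (is_derive_lin 1 a1 a2) (is_derive_lin 1 b1 b2)) c1.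
rewrite (_ : (fun s => _) = (fun s => E0 e (P s) (P1 s) (S s) (S1 s))); last first.
  by apply/funext => s; rewrite /E0 !mul1r.
by move/is_derive_eq; apply; rewrite /dE0 !mul1r; lra.
Qed.

Variables (k e : R) (Kc Ks h Kc1 Ks1 : C) (KN : kernels k e Kc Ks h Kc1 Ks1).

(** [T] sees [V] only through differences, so a velocity of [V] constant in [y] has no effect. This
    discards the boundary value [W1 t (-1)] that arises in [ud_V]. *)
Lemma dQ_cst (V p q pt qt V1 : C) c : dQ V Kc Ks Kc1 Ks1 p q pt qt (V1 + cc c) = dQ V Kc Ks Kc1 Ks1 p q pt qt V1.
Proof.
rewrite /dQ; have e1 u v : I ((V1 + cc c) * u * v) = I (V1 * u * v) + c * I (u * v).
  by rewrite -IZ -ID; congr I; ring.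
rewrite !e1; have z1 : I (p * T Kc1 V p) = 0 by have := antic1 KN V p p; ilra.
have z2 : I (q * T Kc1 V q) = 0 by have := antic1 KN V q q; ilra.
by rewrite z1 z2 (syms1 KN V p q); ring.
Qed.

Variables (W W1 W2 : R -> C) (mu : R).
Hypothesis hW1 : forall t, 0 < t -> der (W1 t) (W2 t).
Hypothesis hWt : forall t, 0 < t -> ud inI W t (cc mu * W2 t).
Let V s : C := idC + prim (W s).

Lemma ud_V t : 0 < t -> ud inI V t (cc mu * W1 t + cc (- (mu * W1 t (-1)))).
Proof.
move=> t0; have c (f : C) : ud inI (fun=> f) t (0 : C).
  by apply: ud_ext (ud_cst t (bdd_cfct f)) => // y _; rewrite cf0.
apply: ud_ext (udD (c idC) (ud_prim (hWt t0))) => [s y _|y hy]; first by rewrite cfD.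
rewrite cf0 add0r cfD cfM !ccE primZ.
by have := der_FTC (hW1 t0) hy => ->; ring.
Qed.

Lemma Q_rate (t : R) : 0 < t -> is_derive t (1 : R) (fun s => Q Kc Ks (V s) (P s) (S s))
  (dQ (V t) Kc Ks Kc1 Ks1 (P t) (S t) (Pt t) (St t) (cc mu * W1 t)).
Proof.
move=> t0; have [_ _ p _ _] := eP t0; have [_ _ s _ _] := eS t0.
by rewrite -(dQ_cst _ _ _ _ _ _ (- (mu * W1 t (-1)))); exact: (Q_deriv KN (ud_V t0) p s).
Qed.

End FullEnergyRate.

(** * Classical solutions as families of continuous functions *)

Section Families.
Context {R : realType}.
Local Notation C := (@cfct R).

Lemma within_comp (T U X : topologicalType) (A : set T) (g : T -> U) (phi : X -> T) (x : X) :
  {within A, continuous g} -> {for x, continuous phi} -> (forall x, A (phi x)) ->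
  {for x, continuous (g \o phi)}.
Proof.
move=> /subspace_continuousP hg hphi hA.
apply: cvg_trans (hg _ (hA x)) => B /= hB.
suff : nbhs x (phi @^-1` [set z | A z -> B (g z)]) by apply: filterS => z /=; apply.
exact: hphi hB.
Qed.

Lemma mvt_bound (phi phi' : R -> R) (s t L e : R) :
  (forall x, `|x - t| <= `|s - t| -> is_derive x (1 : R) phi (phi' x)) ->
  (forall x, `|x - t| <= `|s - t| -> `|phi' x - L| <= e) ->
  `|phi s - phi t - (s - t) * L| <= e * `|s - t|.
Proof.
move=> hd hb.
suff [x hx E] : exists2 x, `|x - t| <= `|s - t| & phi s - phi t = phi' x * (s - t).
  rewrite E (mulrC (phi' x)) -mulrBr normrM mulrC; apply: ler_wpM2r => //; exact: hb.
have hc a b : (forall x, x \in `[a, b] -> `|x - t| <= `|s - t|) -> {within `[a, b], continuous phi}.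
  by move=> h; apply: derivable_within_continuous => x /h/hd [].
have [st|ts|->] := ltgtP s t; last by exists t; rewrite ?subrr ?mulr0.
- have hi (x : R) : x \in `[s, t] -> `|x - t| <= `|s - t|.
    by rewrite in_itv/= => /andP[x1 x2]; rewrite !ler0_norm ?subr_le0 ?(ltW st)//; lra.
  have [|x hx E] := @MVT R phi phi' s t st _ (hc _ _ hi).
    by move=> x hx; apply: hd; apply: hi; exact: subset_itv_oo_cc.
  by exists x; [apply: hi; exact: subset_itv_oo_cc|lra].
- have hi (x : R) : x \in `[t, s] -> `|x - t| <= `|s - t|.
    by rewrite in_itv/= => /andP[x1 x2]; rewrite !ger0_norm ?subr_ge0 ?(ltW ts)//; lra.
  have [|x hx E] := @MVT R phi phi' t s ts _ (hc _ _ hi).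
    by move=> x hx; apply: hd; apply: hi; exact: subset_itv_oo_cc.
  by exists x; [apply: hi; exact: subset_itv_oo_cc|].
Qed.

Lemma derivable_is_derive1 (f : R -> R) (x : R) : derivable f x 1 -> is_derive x (1 : R) f (derive1 f x).
Proof. by move=> h; apply: DeriveDef => //; rewrite derive1E. Qed.

Lemma slice_ex (g : R * R -> R) : {within @closed_dom R, continuous g} ->
  exists2 F : R -> C, (forall s y, 0 < s -> F s y = g (s, cl y)) & forall t, 0 < t -> uc inI F t.
Proof.
move=> hg.
have h s : exists h : C, 0 < s -> forall y, h y = g (s, cl y).
  have [s0|s0] := ltP 0 s; last by exists 0.
  have hc : continuous (fun y => g (s, cl y)).
    move=> y; apply: (within_comp (phi := fun y => (s, cl y)) hg) => [|x].
      by apply: (cvg_pair (cvg_cst s) (@cl_cont R y)).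
    by rewrite /closed_dom/=; split => //; exact: cl_in.
  by exists (mkC hc).
have [F hF] := choice h; exists F; first by move=> s y s0; exact: hF.
move=> t t0; split; first exact: bdd_cfct.
move=> e e0.
(* Clamping time below by [t / 2] and space to the channel keeps the argument inside [closed_dom],
   so [tube] applies without boundary restrictions. *)
pose G (p : R * R) := g (Num.max p.1 (t / 2), cl p.2).
have t2 : 0 < t / 2 by lra.
have hG (y : R) : -1 <= y <= 1 -> {for (t, y), continuous G}.
  move=> _; apply: (within_comp (phi := fun p : R * R => (Num.max p.1 (t / 2), cl p.2)) hg) => [|x].
    have h1 : {for (t, y), continuous (fun p : R * R => Num.max p.1 (t / 2))}.
      by apply: (@continuous_max R (R * R)%type (fun p => p.1 : R^o) (fun=> t / 2) (t, y)); [exact: cvg_fst|exact: cvg_cst].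
    have h2 : {for (t, y), continuous (fun p : R * R => cl p.2)}.
      by apply: (@continuous_comp _ _ _ (fun p : R * R => p.2) (@cl R)); [exact: cvg_snd|exact: cl_cont].
    exact: (cvg_pair h1 h2).
  by rewrite /closed_dom/=; split; [rewrite lt_max t2 orbT|exact: cl_in].
have := tube e0 hG.
apply: filter_app; near=> s => hs y hy.
have s2 : t / 2 < s by near: s; apply: lt_nbhsr; lra.
have m1 : Num.max s (t / 2) = s by apply/max_idPl; exact: ltW.
have m2 : Num.max t (t / 2) = t by apply/max_idPl; lra.
rewrite !hF//; last by lra.
by have := hs y hy; rewrite /G/= m1 m2; exact: ltW.
Unshelve. all: by end_near. Qed.

(** Differentiability in time becomes uniform in [y] through the mean value theorem at each fixed
    [y], because the continuous extension of the time derivative is uniformly continuous in time. *)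
Lemma classical_family (f : R -> R -> R) : classical f -> exists F F1 F2 Ft : R -> C,
  [/\ forall t y, 0 < t -> F t y = f t (cl y),
      forall t y, 0 < t -> -1 < y < 1 -> [/\ F1 t y = dy f t y, F2 t y = dy (dy f) t y & Ft t y = dt f t y] &
      evolves F F1 F2 Ft].
Proof.
move=> [hd hf [gt [cgt egt]] [g1 [cg1 eg1]] [g2 [cg2 eg2]]].
have [F hF uF] := slice_ex hf; have [Ft hFt uFt] := slice_ex cgt.
have [F1 hF1 uF1] := slice_ex cg1; have [F2 hF2 uF2] := slice_ex cg2.
have oc y : -1 < y < 1 -> cl y = y by move=> hy; apply: clE; lra.
have e1 t y : 0 < t -> -1 < y < 1 -> F1 t y = dy f t y by move=> t0 hy; rewrite hF1// oc// eg1.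
have e2 t y : 0 < t -> -1 < y < 1 -> F2 t y = dy (dy f) t y by move=> t0 hy; rewrite hF2// oc// eg2.
have et t y : 0 < t -> -1 < y < 1 -> Ft t y = dt f t y by move=> t0 hy; rewrite hFt// oc// egt.
have near_oo (y : R) : -1 < y < 1 -> \forall z \near y, -1 < z < 1.
  move=> hy; have : nbhs y `]-1, 1[%classic by apply: open_nbhs_nbhs; split; [exact: interval_open|rewrite /= in_itv].
  by apply: filterS => z; rewrite /= in_itv.
exists F, F1, F2, Ft; split; [exact: hF|by move=> t y t0 hy; split; [exact: e1|exact: e2|exact: et]|].
move=> t t0; split.
- move=> y hy; have [_ h _] := hd t y (conj t0 hy).
  apply: (@near_eq_is_derive _ _ _ (f t)).
    by apply: filterS (near_oo y hy) => z hz; rewrite hF// oc.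
  by rewrite (e1 t y t0 hy); exact: (derivable_is_derive1 h).
- move=> y hy; have [_ _ h] := hd t y (conj t0 hy).
  apply: (@near_eq_is_derive _ _ _ (dy f t)).
    by apply: filterS (near_oo y hy) => z hz; rewrite e1.
  by rewrite (e2 t y t0 hy); exact: (derivable_is_derive1 h).
- split; [exact: bdd_cfct|exact: bdd_cfct|] => e e0.
  have [_ /(_ e e0)/nbhs_ballP[r /= r0 hr]] := uFt t t0.
  have t2 : 0 < t / 2 by lra.
  near=> s.
  have s1 : `|s - t| < r by near: s; exact: near_norm_small.
  have s2 : `|s - t| < t / 2 by near: s; exact: near_norm_small.
  have main y : -1 < y < 1 -> `|F s y - F t y - (s - t) * Ft t y| <= e * `|s - t|.
    move=> hy; have s0 : 0 < s by move: s2; rewrite ltr_norml => /andP[]; lra.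
    rewrite !hF// oc//; apply: (mvt_bound (phi := fun s => f s y) (phi' := fun s => Ft s y)) => x /= hx.
      have x0 : 0 < x by move: (le_lt_trans hx s2); rewrite ltr_norml => /andP[]; lra.
      have [h _ _] := hd x y (conj x0 hy).
      by rewrite et//; exact: (derivable_is_derive1 h).
    apply: hr; last by rewrite /inI; lra.
    by rewrite /ball/= distrC; exact: le_lt_trans hx s1.
  move=> y hy.
  (* The estimate is known in the open channel and passes to the walls by continuity. *)
  pose D : C := F s - F t - cc (s - t) * Ft t.
  have := @cfct_le_oo R (absC D) (cc (e * `|s - t|)) _ y hy.
  rewrite absCE ccE !cfB cfM ccE; apply=> z hz.
  by rewrite absCE !ccE !cfB cfM ccE; exact: main.
- exact: uF1.
- exact: uF2.
Unshelve. all: by end_near. Qed.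

(* [prim] of the source gives a representative of [a'] that is continuous up to the boundary. *)
Lemma poisson_family (u : R -> R) (w : C) : {within `[-1, 1], continuous u} ->
  (forall y, -1 < y < 1 -> derivable u y 1) ->
  (forall y : R, -1 < y < 1 -> is_derive y (1 : R) (derive1 u) (w y)) ->
  exists a a1 : C, [/\ forall y, a y = u (cl y), der a a1 & der a1 w].
Proof.
move=> cu du du1.
pose a : C := mkC (cl_within cu).
pose a1 : C := prim w + cc (derive1 u 0 - prim w 0).
have near_oo (y : R) : -1 < y < 1 -> \forall z \near y, -1 < z < 1.
  move=> hy; have : nbhs y `]-1, 1[%classic by apply: open_nbhs_nbhs; split; [exact: interval_open|rewrite /= in_itv].
  by apply: filterS => z; rewrite /= in_itv.
have key y : -1 < y < 1 -> derive1 u y = a1 y.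
  move=> hy; pose v := derive1 u - prim w.
  have hv (z : R) : -1 < z < 1 -> is_derive z (1 : R) v 0.
    by move=> hz; rewrite -(subrr (w z)); apply: is_deriveB; [exact: du1|exact: der_prim].
  have cst x z : -1 < x -> z < 1 -> x < z -> v x = v z.
    move=> x1 z1 xz; have [||c _] := @MVT R v (fun=> 0) x z xz.
    - by move=> c; rewrite in_itv/= => /andP[c1 c2]; apply: hv; lra.
    - apply: derivable_within_continuous => c; rewrite in_itv/= => /andP[c1 c2].
      by case: (hv c); first lra.
    by rewrite mul0r => /eqP; rewrite subr_eq0 => /eqP.
  have E : v y = v 0.
    have [y0|y0|->//] := ltgtP y 0; [apply: cst|apply/esym; apply: cst]; lra.
  by move: E => /eqP; rewrite subr_eq => /eqP ->; rewrite cfD ccE addrC.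
exists a, a1; split; first by move=> y.
- move=> y hy; apply: (@near_eq_is_derive _ _ _ u).
    by apply: filterS (near_oo y hy) => z hz; change (u z = u (cl z)); rewrite clE//; lra.
  by rewrite -key//; exact: derivable_is_derive1 (du y hy).
- have := derD (der_prim w) (der_cc (derive1 u 0 - prim w 0)); rewrite addr0; exact.
Qed.

End Families.

(** * The background flow *)

Section Heat.
Context {R : realType}.
Local Notation C := (@cfct R).

Lemma le_sqrDe (a x : R) : 0 <= a -> (forall e, 0 < e -> x <= (a + e) ^+ 2) -> x <= a ^+ 2.
Proof.
move=> a0 h; apply/ler_addgt0Pr => e e0.
pose r := Num.min 1 (e / (2 * a + 1)).
have d0 : 0 < 2 * a + 1 by lra.
have r0 : 0 < r by rewrite lt_min ltr01 divr_gt0.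
have r1 : r <= 1 by rewrite ge_min lexx.
have re : r * (2 * a + 1) <= e by rewrite -ler_pdivlMr// ge_min lexx orbT.
apply: le_trans (h r r0) _.
have : r * r <= r * 1 by rewrite ler_pM2l.
by move: re; generalize r; intros; lra.
Qed.

Lemma le_of_rate_le0 (phi phi' : R -> R) (s t : R) : 0 < s -> s <= t ->
  (forall x : R, 0 < x -> is_derive x (1 : R) phi (phi' x)) -> (forall x, 0 < x -> phi' x <= 0) ->
  phi t <= phi s.
Proof.
move=> s0; rewrite le_eqVlt => /orP[/eqP->//|st] hd hn.
have [||c] := @MVT R phi phi' s t st.
- by move=> x; rewrite in_itv/= => /andP[x1 x2]; apply: hd; lra.
- apply: derivable_within_continuous => x; rewrite in_itv/= => /andP[x1 x2].
  by case: (hd x); first lra.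
rewrite in_itv/= => /andP[c1 c2] E; rewrite -subr_le0 E.
by apply: mulr_le0_ge0; [apply: hn; lra|lra].
Qed.

Lemma I_minkowski (u v : C) (a b : R) : 0 < a -> 0 < b -> I (u * u) <= a ^+ 2 -> I (v * v) <= b ^+ 2 ->
  I ((u + v) * (u + v)) <= (a + b) ^+ 2.
Proof.
move=> a0 b0 hu hv.
have ba : 0 < b / a by rewrite divr_gt0.
have y := I_young u v ba.
have -> : (u + v) * (u + v) = u * u + cc 2 * (u * v) + v * v by rewrite rmorphD rmorph1; ring.
rewrite 2!ID IZ.
have h1 : b / a * I (u * u) <= b / a * a ^+ 2 by rewrite ler_pM2l.
have h2 : (b / a)^-1 * I (v * v) <= (b / a)^-1 * b ^+ 2 by rewrite ler_pM2l// invr_gt0.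
have e1 : b / a * a ^+ 2 = a * b by field; rewrite gt_eqF.
have e2 : (b / a)^-1 * b ^+ 2 = a * b by field; rewrite !gt_eqF.
rewrite e1 in h1; rewrite e2 in h2; clear e1 e2.
have -> : (a + b) ^+ 2 = a ^+ 2 + 2 * (a * b) + b ^+ 2 by ring.
move: (a ^+ 2) (b ^+ 2) (a * b) hu hv h1 h2 y => A B AB; genI; intros; lra.
Qed.

Lemma ud_time_shift (X : Type) (D : X -> Prop) (F : R -> X -> R) (t h : R) f :
  ud D F (t + h) f -> ud D (fun s => F (s + h)) t f.
Proof.
move=> [b1 b2 hF]; split => // e e0.
have /nbhs_ballP[r /= r0 hr] := hF e e0.
near=> s.
have s1 : `|s - t| < r by near: s; exact: near_norm_small.
have -> : s - t = (s + h) - (t + h) by ring.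
by apply: hr; rewrite /ball/= (_ : t + h - (s + h) = t - s); [rewrite distrC|ring].
Unshelve. all: by end_near. Qed.

Variables (W W1 W2 : R -> C) (w0 w01 w02 : C) (mu m : R).
Hypotheses (mu0 : 0 < mu) (m0 : 0 < m).
Hypothesis eW : evolves W W1 W2 (fun t => cc mu * W2 t).
Hypothesis dW : forall t, 0 < t -> dirich (W t).
Hypotheses (h0 : der w0 w01) (h1 : der w01 w02) (dw0 : dirich w0) (hm : I (w02 * w02) <= m ^+ 2).
Hypothesis W_init : forall e t, 0 < e -> 0 < t -> exists2 s, 0 < s < t & I ((W s - w0) * (W s - w0)) <= e.

(** Formally [W - w0] solves a heat equation with source [mu w02], so its norm grows at rate at most
    [mu m]. To avoid the square root where the norm vanishes, its square [y] is compared with the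
    affine [c s = mu m s + e]: the function [y / c - c] does not increase. *)
Lemma heat_dist_init (t : R) : 0 < t -> I ((W t - w0) * (W t - w0)) <= (mu * m * t) ^+ 2.
Proof.
move=> t0; have mm : 0 < mu * m by rewrite mulr_gt0.
apply: le_sqrDe => [|e e0]; first by apply: mulr_ge0; exact: ltW.
pose c (s : R) := mu * m * s + e.
pose y s := I ((W s - w0) * (W s - w0)).
have c0 s : 0 < s -> 0 < c s by move=> s0; apply: addr_gt0 => //; exact: mulr_gt0.
have dc (s : R) : is_derive s (1 : R) c (mu * m).
  rewrite (_ : c = (fun s => cst e s + mu * m * id s)); last by apply/funext => x; rewrite /c addrC.
  have := is_derive_lin (mu * m) (is_derive_cst e s (1 : R)) (is_derive_id s (1 : R)).
  by move/is_derive_eq; apply; rewrite mulr1 add0r.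
have dy (s : R) : 0 < s -> is_derive s (1 : R) y (2 * I ((W s - w0) * (cc mu * W2 s))).
  move=> s0; have [_ _ u _ _] := eW s0.
  apply: (ud_sq (F := fun s => W s - w0)).
  apply: ud_ext (udB u (ud_cst s (bdd_cfct w0))) => [x z _|z _]; first by rewrite cfB.
  by rewrite subr0.
have yb s : 0 < s -> 2 * I ((W s - w0) * (cc mu * W2 s)) <= mu * m * ((c s)^-1 * y s + c s).
  move=> s0; have [d1 d2 _ _ _] := eW s0; have [p0 p1] := dW s0; have [q0 q1] := dw0.
  have z0 : (W s - w0) (-1) = 0 by rewrite cfB p0 q0 subrr.
  have z1 : (W s - w0) 1 = 0 by rewrite cfB p1 q1 subrr.
  have E := IBP0 (derB d1 h0) (derB d2 h1) z0 z1.
  have E2 : I ((W s - w0) * (W2 s - w02)) = I ((W s - w0) * W2 s) - I ((W s - w0) * w02) by rewrite cmulBr IB.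
  rewrite E2 in E.
  have -> : (W s - w0) * (cc mu * W2 s) = cc mu * ((W s - w0) * W2 s) by ring.
  rewrite IZ.
  have s1 : 0 < m / c s by rewrite divr_gt0// c0.
  have Y := I_young (W s - w0) w02 s1; rewrite -/(y s) in Y.
  have n := Isq_ge0 (W1 s - w01).
  have h2 : (m / c s)^-1 * I (w02 * w02) <= (m / c s)^-1 * m ^+ 2 by rewrite ler_pM2l// invr_gt0.
  have e2 : (m / c s)^-1 * m ^+ 2 = m * c s by field; rewrite !gt_eqF// c0.
  rewrite e2 in h2.
  rewrite mulrCA -!mulrA ler_pM2l//.
  have -> : m * ((c s)^-1 * y s + c s) = m / c s * y s + m * c s by ring.
  apply: le_trans (_ : 2 * I ((W s - w0) * w02) <= _).
    by clear Y h2 e2; ilra.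
  by apply: le_trans Y _; rewrite lerD2l.
pose phi s := (c s)^-1 * y s - c s.
have dphi (s : R) : 0 < s -> is_derive s (1 : R) phi
   ((c s)^-1 * (2 * I ((W s - w0) * (cc mu * W2 s))) - (c s)^-2 * (mu * m) * y s - mu * m).
  move=> s0; have cn : c s != 0 by rewrite gt_eqF// c0.
  have := is_deriveB (is_deriveM (is_deriveV cn (dc s)) (dy s s0)) (dc s).
  by move/is_derive_eq; apply; rewrite /GRing.scale/=; ring.
have np s : 0 < s -> (c s)^-1 * (2 * I ((W s - w0) * (cc mu * W2 s))) - (c s)^-2 * (mu * m) * y s - mu * m <= 0.
  move=> s0; have cs := c0 s s0.
  have := yb s s0; rewrite -(ler_pM2l (x := (c s)^-1)) ?invr_gt0//.
  have -> : (c s)^-1 * (mu * m * ((c s)^-1 * y s + c s)) = (c s)^-2 * (mu * m) * y s + mu * m.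
    by field; rewrite gt_eqF.
  lra.
have [s /andP[s0 st] hs] := W_init (exprn_gt0 2 e0) t0.
have := le_of_rate_le0 s0 (ltW st) dphi np.
rewrite /phi => H.
have ct := c0 t t0; have cs := c0 s s0.
have h2 : (c s)^-1 * y s <= c s.
  rewrite ler_pdivrMl// -expr2; apply: le_trans hs _.
  have ec : e <= c s by rewrite lerDr; apply: mulr_ge0; exact: ltW.
  by apply: lerXn2r; rewrite ?nnegrE ?(ltW e0) ?(ltW cs).
have : (c t)^-1 * y t <= c t by lra.
by rewrite ler_pdivrMl// -expr2 /c.
Qed.

Lemma heat_dist_time (s t h : R) : 0 < h -> 0 < s -> s <= t ->
  I ((W (t + h) - W t) * (W (t + h) - W t)) <= I ((W (s + h) - W s) * (W (s + h) - W s)).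
Proof.
move=> hh s0 st.
apply: (le_of_rate_le0 (phi := fun t => I ((W (t + h) - W t) * (W (t + h) - W t)))
  (phi' := fun t => 2 * I ((W (t + h) - W t) * (cc mu * W2 (t + h) - cc mu * W2 t))) s0 st) => x x0.
  have [_ _ u _ _] := eW x0; have [_ _ v _ _] := eW (addr_gt0 x0 hh).
  apply: (ud_sq (F := fun s => W (s + h) - W s)).
  by apply: ud_ext (udB (ud_time_shift v) u) => [r z _|z _]; rewrite cfB.
have [d1 d2 _ _ _] := eW x0; have [g1 g2 _ _ _] := eW (addr_gt0 x0 hh).
have [p0 p1] := dW x0; have [q0 q1] := dW (addr_gt0 x0 hh).
have z0 : (W (x + h) - W x) (-1) = 0 by rewrite cfB p0 q0 subrr.
have z1 : (W (x + h) - W x) 1 = 0 by rewrite cfB p1 q1 subrr.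
have E := IBP0 (derB g1 d1) (derB g2 d2) z0 z1.
have -> : (W (x + h) - W x) * (cc mu * W2 (x + h) - cc mu * W2 x) =
  cc mu * ((W (x + h) - W x) * (W2 (x + h) - W2 x)) by ring.
rewrite IZ -[I (_ * (W2 _ - _))]opprK -E mulrN mulrN oppr_le0.
by rewrite !mulr_ge0 ?Isq_ge0// ltW.
Qed.

(** Contraction carries the time increment back to a small time [s], where two uses of
    [heat_dist_init] give [mu m (2 s + h)]; then [s] tends to 0. *)
Lemma heat_speed (t h : R) : 0 < h -> 0 < t ->
  I ((W (t + h) - W t) * (W (t + h) - W t)) <= (mu * m * h) ^+ 2.
Proof.
move=> hh t0; have mm : 0 < mu * m by rewrite mulr_gt0.
apply: le_sqrDe => [|e e0]; first by apply: mulr_ge0; exact: ltW.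
pose s := Num.min t (e / (2 * (mu * m))).
have s0 : 0 < s by rewrite lt_min t0 divr_gt0// mulr_gt0.
have st : s <= t by rewrite ge_min lexx.
have se : mu * m * s * 2 <= e.
  have : s <= e / (2 * (mu * m)) by rewrite ge_min lexx orbT.
  by rewrite ler_pdivlMr ?mulr_gt0//; lra.
apply: le_trans (heat_dist_time hh s0 st) _.
have sh : 0 < s + h by exact: addr_gt0.
have -> : W (s + h) - W s = (W (s + h) - w0) + (w0 - W s) by ring.
have b1 := heat_dist_init sh; have := heat_dist_init s0.
have -> : (W s - w0) * (W s - w0) = (w0 - W s) * (w0 - W s) by ring.
move=> b2; apply: le_trans (I_minkowski _ _ b1 b2) _; [exact: mulr_gt0|exact: mulr_gt0|].
rewrite lerXn2r ?nnegrE//; last by lra.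
  by apply: addr_ge0; apply: mulr_ge0; exact: ltW.
by apply: addr_ge0; [apply: mulr_ge0|]; exact: ltW.
Qed.

(** Since [mu W2] is the time derivative of [W], the bound on difference quotients passes to the
    limit. An energy estimate for [W2] itself would call for more derivatives than a classical
    solution has. *)
Lemma heat_W2 (t : R) : 0 < t -> I (W2 t * W2 t) <= m ^+ 2.
Proof.
move=> t0; have mm : 0 < mu * m by rewrite mulr_gt0.
suff : I ((cc mu * W2 t) * (cc mu * W2 t)) <= (mu * m) ^+ 2.
  have -> : cc mu * W2 t * (cc mu * W2 t) = cc (mu ^+ 2) * (W2 t * W2 t) by ring.
  by rewrite IZ exprMn ler_pM2l// exprn_gt0.
apply: le_sqrDe => [|e e0]; first exact: ltW.
have [_ _ [_ _ u] _ _] := eW t0.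
have e2 : 0 < e / 2 by lra.
have /nbhs_ballP[r /= r0 hr] := u _ e2.
pose h := r / 2; have hh : 0 < h by rewrite /h; lra.
have hb : ball t r (t + h).
  rewrite /ball/= opprD addNKr normrN gtr0_norm// /h; lra.
have hs := hr _ hb.
pose v : C := cc h * (cc mu * W2 t) - (W (t + h) - W t).
have hv : I (v * v) <= (e * h) ^+ 2.
  have : I (v * v) <= I (cc ((e / 2 * h) ^+ 2)).
    apply: I_le => y hy; rewrite cfM ccE -expr2 -real_normK ?num_real//.
    rewrite lerXn2r ?nnegrE//; first by rewrite mulr_ge0// ltW.
    have := hs y hy; rewrite (_ : t + h - t = h); last by ring.
    rewrite (gtr0_norm hh); apply: le_trans; rewrite -normrN le_eqVlt; apply/orP; left; apply/eqP.
    by congr (`|_|); rewrite /v !cfB !cfM !ccE; ring.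
  rewrite I_cst => H; apply: le_trans H _.
  have : 0 <= (e * h) ^+ 2 by exact: sqr_ge0.
  have -> : 2 * (e / 2 * h) ^+ 2 = (e * h) ^+ 2 / 2 by field.
  by move: ((e * h) ^+ 2) => x; lra.
have := I_minkowski (mulr_gt0 mm hh) (mulr_gt0 e0 hh) (heat_speed hh t0) hv.
have -> : W (t + h) - W t + v = cc h * (cc mu * W2 t) by rewrite /v; ring.
have -> : cc h * (cc mu * W2 t) * (cc h * (cc mu * W2 t)) = cc (h ^+ 2) * (cc mu * W2 t * (cc mu * W2 t)) by ring.
have -> : (mu * m * h + e * h) ^+ 2 = h ^+ 2 * (mu * m + e) ^+ 2 by ring.
by rewrite IZ ler_pM2l// exprn_gt0.
Qed.

Lemma heat_bounds (t : R) : 0 < t -> [/\ I (W2 t * W2 t) <= m ^+ 2,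
  forall y, -1 <= y <= 1 -> W1 t y ^+ 2 <= 8 * m ^+ 2 &
  forall y, -1 <= y <= 1 -> W t y ^+ 2 <= 32 * m ^+ 2].
Proof.
move=> t0; have h := heat_W2 t0; have [d1 d2 _ _ _] := eW t0; have [p0 p1] := dW t0.
have i1 : I (W1 t) = 0 by rewrite (I_der d1) p0 p1 subrr.
have b1 y : -1 <= y <= 1 -> W1 t y ^+ 2 <= 8 * m ^+ 2.
  by move=> hy; have := sup_sq_zero d2 i1 hy; lra.
split => // y hy; have := sup_sq d1 p0 hy.
have : I (W1 t * W1 t) <= I (cc (8 * m ^+ 2)).
  by apply: I_le => z hz; rewrite cfM ccE -expr2; exact: b1.
rewrite I_cst; move: (I _) => x; lra.
Qed.

End Heat.

(** * The velocity [U] as a primitive of [1 + W] *)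

Section ShearFlow.
Context {R : realType}.
Local Notation C := (@cfct R).
Local Notation leb := (@lebesgue_measure R).

Let green_prim (w : C) : C := cc 2^-1 * ((idC - 1) * prim ((1 + idC) * w)
  + (idC + 1) * (cc (I ((idC - 1) * w)) - prim ((idC - 1) * w))).

(* [green y z] = (y z - 1 + |y - z|) / 2 is smooth on either side of the diagonal. *)
Lemma green_int (f : R -> R) (w : C) y : (forall z, -1 <= z <= 1 -> f z = w z) -> -1 <= y <= 1 ->
  \int[leb]_(z in @chan R) (green y z * f z) = green_prim w y.
Proof.
move=> fw hy.
pose g : C := cc 2^-1 * ((cc y * idC - 1 + absC (cc y - idC)) * w).
have gE z : g z = 2^-1 * ((y * z - 1 + `|y - z|) * w z).
  by rewrite /g !(cfM, cfD, cfB, cfN, ccE, idCE, absCE, cf1).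
have -> : \int[leb]_(z in @chan R) (green y z * f z) = I g.
  rewrite IE; apply: eq_Rintegral => z; rewrite inE /chan/= in_itv/= => hz.
  rewrite gE fw// /green mulrA; congr (_ * w z).
  have [yz|zy] := leP y z.
    by rewrite ler0_norm ?subr_le0//; field.
  by rewrite gtr0_norm ?subr_gt0//; field.
pose g1 : C := cc (2^-1 * (y - 1)) * ((1 + idC) * w).
pose g2 : C := cc (2^-1 * (y + 1)) * ((idC - 1) * w).
have a1 : prim g y = prim g1 y.
  apply: (prim_eq_l hy) => z /andP[z1 z2].
  by rewrite gE /g1 !(cfM, cfD, cfB, ccE, idCE, cf1) ger0_norm ?subr_ge0//; ring.
have a2 : I g - prim g y = I g2 - prim g2 y.
  apply: (prim_eq_r hy) => z /andP[z1 z2].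
  have -> : g2 z = 2^-1 * (y + 1) * ((z - 1) * w z) by rewrite /g2 cfM ccE cfM cfB idCE cf1.
  have n : `|y - z| = z - y by rewrite distrC ger0_norm ?subr_ge0.
  rewrite gE n; ring.
have -> : I g = prim g1 y + (I g2 - prim g2 y) by rewrite -a1 -a2; ring.
have -> : green_prim w y = 2^-1 * ((y - 1) * prim ((1 + idC) * w) y
    + (y + 1) * (I ((idC - 1) * w) - prim ((idC - 1) * w) y)).
  by rewrite /green_prim cfM ccE cfD cfM cfB idCE cf1 cfM cfD idCE cf1 cfB ccE.
have -> : prim g1 y = 2^-1 * (y - 1) * prim ((1 + idC) * w) y := primZ _ _ _.
have -> : prim g2 y = 2^-1 * (y + 1) * prim ((idC - 1) * w) y := primZ _ _ _.
have -> : I g2 = 2^-1 * (y + 1) * I ((idC - 1) * w) := IZ _ _.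
move: (prim ((1 + idC) * w) y) (prim ((idC - 1) * w) y) (I ((idC - 1) * w)) => x1 x2 x3; ring.
Qed.

(** The contributions of the moving limit cancel on the diagonal, and the weights [1 + z] and
    [z - 1] differ by 2, so a plain primitive of [w] remains, up to a constant. *)
Lemma green_prim_der (w : C) : der (green_prim w) (prim w + cc (2^-1 * I ((idC - 1) * w))).
Proof.
have d1 : der (idC - 1 : C) 1 by apply: der_eq (derB der_id (der_cc 1)) _; rewrite subr0.
have d2 : der (idC + 1 : C) 1 by apply: der_eq (derD der_id (der_cc 1)) _; rewrite addr0.
have p1 := der_prim ((1 + idC) * w); have p2 := der_prim ((idC - 1) * w).
have := derM (der_cc 2^-1) (derD (derM d1 p1) (derM d2 (derB (der_cc (I ((idC - 1) * w))) p2))).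
move/der_eq; apply.
have E : prim ((1 + idC) * w) - prim ((idC - 1) * w) = cc 2 * prim w.
  apply/cfctP => y; rewrite cfB -primB cfM ccE -primZ; congr (prim _ y).
  by rewrite rmorphD rmorph1; ring.
have h : cc 2^-1 * cc 2 = 1 :> C by rewrite -rmorphM mulVf ?rmorph1// pnatr_eq0.
have -> : prim w = cc 2^-1 * (cc 2 * prim w) by rewrite mulrA h mul1r.
rewrite -E rmorphM; ring.
Qed.

Lemma shear_interior (W : R -> R -> R) (t : R) (w w1 : C) : (forall z, -1 <= z <= 1 -> W t z = w z) ->
  der w w1 -> exists c, forall y, -1 < y < 1 ->
  shear W t y = (idC + prim w + cc c) y /\ dy (dy (shear W)) t y = w1 y.
Proof.
move=> hw dw; exists (2^-1 * I ((idC - 1) * w)).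
have near_oo (y : R) : -1 < y < 1 -> \forall z \near y, -1 < z < 1.
  move=> hy; have : nbhs y `]-1, 1[%classic by apply: open_nbhs_nbhs; split; [exact: interval_open|rewrite /= in_itv].
  by apply: filterS => z; rewrite /= in_itv.
have main y : -1 < y < 1 -> shear W t y = (idC + prim w + cc (2^-1 * I ((idC - 1) * w))) y.
  move=> hy; rewrite /shear -addrA [RHS]cfD idCE; congr (_ + _).
  rewrite derive1E; apply: derive_val; apply: near_eq_is_derive (green_prim_der w hy).
  by apply: filterS (near_oo y hy) => z hz; rewrite (green_int hw)//; lra.
have dmain y : -1 < y < 1 -> dy (shear W) t y = (1 + w) y.
  move=> hy; rewrite /dy derive1E; apply: derive_val.
  have d : der (idC + prim w + cc (2^-1 * I ((idC - 1) * w))) (1 + w + 0).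
    exact: derD (derD der_id (der_prim w)) (der_cc _).
  rewrite addr0 in d; apply: near_eq_is_derive (d y hy).
  by apply: filterS (near_oo y hy) => z hz; rewrite main.
move=> y hy; split; first exact: main.
rewrite {1}/dy derive1E; apply: derive_val.
have d : der (1 + w : C) (0 + w1) := derD (der_cc 1) dw.
rewrite add0r in d; apply: near_eq_is_derive (d y hy).
by apply: filterS (near_oo y hy) => z hz; rewrite -dmain.
Qed.

End ShearFlow.

(** * A Gronwall inequality with decaying forcing *)

Section Gronwall.
Context {R : realType}.

(** Half of the damping [a] is given up so that a forcing rate close to [a] produces no secular
    factor [t]: with [K = 2 B / a], the function [(E exp(L s) - K) exp(a s / 2)] does not
    increase. *)
Lemma gronwall (E E' : R -> R) (a b L B M : R) : 0 < a -> 0 <= B -> 0 <= L -> L <= b -> L <= a / 2 ->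
  (forall t : R, 0 < t -> is_derive t (1 : R) E (E' t)) ->
  (forall t, 0 < t -> 0 <= E t) ->
  (forall t, 0 < t -> E' t <= - a * E t + B * expR (- b * t)) ->
  (forall t, 0 < t -> exists2 s, 0 < s < t & E s <= M) ->
  forall t, 0 < t -> E t <= 2 * B / a * expR (- L * t) + expR 1 * M * expR (- (a / 2) * t).
Proof.
move=> a0 B0 L0 Lb La dE E0 hE hM t t0.
pose K := 2 * B / a; have K0 : 0 <= K by rewrite /K divr_ge0 ?mulr_ge0// ltW.
have dexp (r s : R) : is_derive s (1 : R) (fun s => expR (r * s)) (r * expR (r * s)).
  have h : is_derive s (1 : R) (fun s => r * s) r.
    have := is_deriveZ (r : R) (is_derive_id s (1 : R)).
    by move/is_derive_eq; apply; rewrite /GRing.scale/= mulr1.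
  have := is_derive1_comp (is_derive_expR (r * s)) h.
  by move/is_derive_eq; apply; rewrite mulrC.
pose phi s := (E s * expR (L * s) - K) * expR (a / 2 * s).
pose phi' s := ((E' s * expR (L * s) + E s * (L * expR (L * s))) * expR (a / 2 * s)
   + (E s * expR (L * s) - K) * (a / 2 * expR (a / 2 * s))).
have dphi (s : R) : 0 < s -> is_derive s (1 : R) phi (phi' s).
  move=> s0; have := is_deriveM (is_deriveB (is_deriveM (dE s s0) (dexp L s)) (is_derive_cst K s (1 : R))) (dexp (a / 2) s).
  by move/is_derive_eq; apply; rewrite /phi' /GRing.scale/= !fctE subr0; ring.
have nphi s : 0 < s -> phi' s <= 0.
  move=> s0.
  have -> : phi' s = (E' s * expR (L * s) + (L + a / 2) * (E s * expR (L * s)) - a / 2 * K) * expR (a / 2 * s).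
    by rewrite /phi'; ring.
  apply: mulr_le0_ge0; last exact: expR_ge0.
  have -> : a / 2 * K = B by rewrite /K; field; rewrite gt_eqF.
  have h1 : E' s * expR (L * s) <= (- a * E s + B * expR (- b * s)) * expR (L * s).
    by rewrite ler_wpM2r ?expR_ge0//; exact: hE.
  have h2 : expR (- b * s) * expR (L * s) <= 1.
    rewrite -expRD -[leRHS]expR0 ler_expR -mulrDl; apply: mulr_le0_ge0; [lra|exact: ltW].
  have h3 : B * (expR (- b * s) * expR (L * s)) <= B * 1 by exact: ler_wpM2l.
  have h4 : 0 <= (a / 2 - L) * (E s * expR (L * s)).
    by apply: mulr_ge0; [lra|apply: mulr_ge0; [exact: E0|exact: expR_ge0]].
  have h5 : E' s * expR (L * s) <= - a * (E s * expR (L * s)) + B * (expR (- b * s) * expR (L * s)).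
    by rewrite !mulrA -mulrDl.
  move: h3 h4 h5; move: (E s * expR (L * s)) (E' s * expR (L * s)) (expR (- b * s) * expR (L * s)) => x y z.
  move=> h3 h4 h5; lra.
(* The initial bound holds only at some arbitrarily small times; taking [s] below [1 / (L + a / 2)]
   limits the exponential weights at [s] to [expR 1]. *)
have [s /andP[s0 st] hs] := hM (Num.min t (L + a / 2)^-1) ltac:(rewrite lt_min t0 invr_gt0; lra).
have st' : s <= t by apply: ltW; apply: lt_le_trans st _; rewrite ge_min lexx.
have s1 : (L + a / 2) * s <= 1.
  have h : s <= (L + a / 2)^-1 by apply: ltW; apply: lt_le_trans st _; rewrite ge_min lexx orbT.
  by rewrite -ler_pdivlMl ?mulr1//; lra.
have := le_of_rate_le0 s0 st' dphi nphi; rewrite /phi => H.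
have M0 : 0 <= M := le_trans (E0 s s0) hs.
have hr : (E s * expR (L * s) - K) * expR (a / 2 * s) <= M * expR 1.
  apply: le_trans (_ : E s * (expR (L * s) * expR (a / 2 * s)) <= _).
    by rewrite mulrA; apply: ler_wpM2r; [exact: expR_ge0|rewrite gerBl].
  rewrite -expRD -mulrDl; by apply: (ler_pM (E0 s s0) (expR_ge0 _) hs); rewrite ler_expR.
have H2 := le_trans H hr.
have e1 : expR (L * t) * expR (- L * t) = 1 by rewrite -expRD -mulrDl subrr mul0r expR0.
have e2 : expR (a / 2 * t) * expR (- (a / 2) * t) = 1 by rewrite -expRD -mulrDl subrr mul0r expR0.
have l1 : expR (- L * t) <= 1.
  by rewrite -[leRHS]expR0 ler_expR mulNr oppr_le0; apply: mulr_ge0; [|exact: ltW].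
have p2 := expR_ge0 (- (a / 2) * t); have p1 := expR_ge0 (- L * t).
have H3 := ler_wpM2r p2 H2; rewrite -[leLHS]mulrA e2 mulr1 in H3.
have H4 : E t * expR (L * t) <= K + M * expR 1 * expR (- (a / 2) * t) by lra.
have H5 := ler_wpM2r p1 H4; rewrite -[leLHS]mulrA e1 mulr1 mulrDl in H5.
apply: le_trans H5 _; rewrite -/K lerD2l [expR 1 * M]mulrC.
by rewrite ler_piMr// !mulr_ge0// expR_ge0.
Qed.

End Gronwall.

(** * Decay of the modes *)

Section Decay.
Context {R : realType}.
Local Notation C := (@cfct R).

Variables (W W1 W2 : R -> C) (d : R) (c : R -> R) (k : R).
Hypotheses (d0 : 0 < d) (d_small : 1000 * 1000 * 1000 * 10 * d <= 1) (k1 : 1 <= k).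
Hypotheses (hW : forall t, 0 < t -> der (W t) (W1 t)) (hW1 : forall t, 0 < t -> der (W1 t) (W2 t)).
Hypothesis W_half : forall t y, 0 < t -> - (1 / 2) <= W t y <= 1 / 2.
Hypothesis W1_d : forall t, 0 < t -> forall y, -1 <= y <= 1 -> `|W1 t y| <= d.
Hypothesis W2_d : forall t, 0 < t -> I (W2 t * W2 t) <= d ^+ 2.
Variables (P P1 P2 S S1 S2 : R -> C).
Hypotheses (dP : forall t, 0 < t -> dirich (P t)) (dS : forall t, 0 < t -> dirich (S t)).
Let V t : C := idC + prim (W t).
Let U t : C := V t + cc (c t).
Let k0 : 0 < k. Proof. exact: lt_le_trans ltr01 k1. Qed.

Definition mode_energy (e : R) (p p1 q q1 : C) := nA e p1 q1 + nB p q.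

Lemma der_V t : der (V t) (1 + W t).
Proof. exact: derD der_id (der_prim _). Qed.

Lemma hVok (t : R) : 0 < t -> shear_ok (V t) (1 + W t).
Proof. by move=> t0; apply: shear_okV (der_V t) _ => y; exact: W_half. Qed.

Lemma Src0 e p p1 p2 q q1 q2 : Src e p p1 p2 q q1 q2 0 0 = 0 :> R.
Proof.
have I0 : I (0 : C) = 0 by have := IB (0 : C) 0; rewrite !subrr.
have z1 (u : C) : u * 0 = 0 by ring.
have z2 (u : C) : 0 * u = 0 by ring.
by rewrite /Src !z1 !z2 I0; ring.
Qed.

Lemma advection_diffusion_decay (e M : R) : 0 < e ->
  evolves P P1 P2 (fun t => cc k * (U t * S t) + cc (k * e ^+ 3) * P2 t) ->
  evolves S S1 S2 (fun t => - (cc k * (U t * P t)) + cc (k * e ^+ 3) * S2 t) ->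
  (forall t, 0 < t -> exists2 s, 0 < s < t & mode_energy e (P s) (P1 s) (S s) (S1 s) <= M) ->
  forall t, 0 < t -> mode_energy e (P t) (P1 t) (S t) (S1 t)
     <= 500 * expR 1 * M * expR (- (k * e / 3000 / 2) * t).
Proof.
move=> e0 eP eS hM t t0.
pose E s := E0 e (P s) (P1 s) (S s) (S1 s).
pose E' s := dE0 e (P s) (P1 s) (P2 s) (S s) (S1 s) (S2 s)
  (cc k * (U s * S s) + cc (k * e ^+ 3) * P2 s) (- (cc k * (U s * P s)) + cc (k * e ^+ 3) * S2 s).
have ke : 0 < k * e by rewrite mulr_gt0.
have bnd s := E0_bounds e (P s) (P1 s) (S s) (S1 s).
have pA s : 0 <= nA e (P1 s) (S1 s) by rewrite addr_ge0 ?Isq_ge0.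
have pB s : 0 <= nB (P s) (S s) by rewrite addr_ge0 ?Isq_ge0.
have pC s : 0 <= nC e (P2 s) (S2 s) by rewrite addr_ge0 ?Isq_ge0.
have a0 : 0 < k * e / 3000 by rewrite divr_gt0 ?ltr0n.
have dE (s : R) : 0 < s -> is_derive s (1 : R) E (E' s) by exact: energy0_rate eP eS dP dS _ _.
have Ege s : 0 < s -> 0 <= E s.
  by move=> _; have /andP[h _] := bnd s; apply: le_trans h; have := pA s; have := pB s; lra.
have rate s : 0 < s -> E' s <= - (k * e / 3000) * E s + 0 * expR (- 0 * s).
  move=> s0; rewrite mul0r addr0.
  have [p1 p2 _ _ _] := eP s s0; have [q1 q2 _ _ _] := eS s s0.
  have := dE0_id k e (c s) (hVok s0) p1 p2 (dP s0) q1 q2 (dS s0) 0 0.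
  rewrite !addr0 Src0 -/(U s) -/(E' s) addr0 => ->.
  have hb := BR_le e (P s) (P1 s) (P2 s) (S s) (S1 s) (S2 s) (hVok s0).
  have hb' := ler_wpM2l (ltW ke) hb.
  have /andP[_ hu] := bnd s; have hu' := ler_wpM2l (ltW ke) hu; rewrite -/(E s) in hu'.
  have q1' := mulr_ge0 (ltW ke) (pA s); have q2' := mulr_ge0 (ltW ke) (pB s).
  have q3' := mulr_ge0 (ltW ke) (pC s); clear hb hu.
  move: hb' hu' q1' q2' q3'; move: (BR _ _ _ _ _ _ _ _) (nA _ _ _) (nB _ _) (nC _ _ _) (E s) (k * e) => x1 x2 x3 x4 x5 x6.
  by move=> *; lra.
have hM2 (r : R) : 0 < r -> exists2 s, 0 < s < r & E s <= 2 * M.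
  move=> r0; have [s sr hs] := hM r r0; exists s => //.
  by have /andP[_ hu] := bnd s; apply: le_trans hu _; rewrite ler_pM2l.
have a2 : 0 <= k * e / 3000 / 2 by lra.
have := gronwall a0 (lexx 0) (lexx 0) (lexx 0) a2 dE Ege rate hM2 t0.
rewrite mulr0 mul0r mul0r add0r => H.
have /andP[hl _] := bnd t; rewrite -/(E t) in hl.
have -> : 500 * expR 1 * M * expR (- (k * e / 3000 / 2) * t) = 250 * (expR 1 * (2 * M) * expR (- (k * e / 3000 / 2) * t)) by ring.
have hA := pA t; have hB := pB t; rewrite /mode_energy.
move: H hl hA hB; move: (nA _ _ _) (nB _ _) (E t) (_ * expR (- (k * e / 3000 / 2) * t)) => x1 x2 x3 x4.
by move=> *; lra.
Qed.

(** The rate [1 / 3000] combines the [1 / 1000] of [energy_rate] with [E <= 3 (nA + nB)]. The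
    forcing [k / e] divided by the damping [k e] gives [e^-2], with constant [2 * 1003 * 3000], and
    the lower bound [4 / 1000] on [E] multiplies everything by 250. *)
Lemma mode_forced_decay (e b T0 L M : R) (A A1 B B1 F G : R -> C) : 0 < e -> 0 <= T0 -> 0 <= L -> L <= b -> L <= k * e / 3000 / 2 ->
  (forall t, 0 < t -> ud inI W t (cc (k * e ^+ 3) * W2 t)) ->
  (forall t, 0 < t -> [/\ der (A t) (A1 t), der (A1 t) (P t + cc (k ^+ 2) * A t) & dirich (A t)]) ->
  (forall t, 0 < t -> [/\ der (B t) (B1 t), der (B1 t) (S t + cc (k ^+ 2) * B t) & dirich (B t)]) ->
  (forall t, 0 < t -> I (F t * F t) + I (G t * G t) <= T0 * expR (- b * t)) ->
  evolves P P1 P2 (fun t => cc k * (U t * S t) + cc (k * e ^+ 3) * P2 t + cc k * (G t - W1 t * B t)) ->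
  evolves S S1 S2 (fun t => - (cc k * (U t * P t)) + cc (k * e ^+ 3) * S2 t + cc k * (W1 t * A t - F t)) ->
  (forall t, 0 < t -> exists2 s, 0 < s < t & mode_energy e (P s) (P1 s) (S s) (S1 s) <= M) ->
  forall t, 0 < t -> mode_energy e (P t) (P1 t) (S t) (S1 t)
     <= 1000 * 1000 * 1505 * (T0 / e ^+ 2 * expR (- L * t)) + 750 * expR 1 * M * expR (- (k * e / 3000 / 2) * t).
Proof.
move=> e0 T00 L0 Lb La hWt hA hB hT eP eS hM t t0.
have [Kc [Ks [h [Kc1 [Ks1 KN]]]]] := kernels_exist k0 e0.
pose kap : R := 1 / 1000 / 1000 / 10.
pose E s := E0 e (P s) (P1 s) (S s) (S1 s) + kap * Q Kc Ks (V s) (P s) (S s).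
pose pt s := cc k * (U s * S s) + cc (k * e ^+ 3) * P2 s + cc k * (G s - W1 s * B s).
pose qt s := - (cc k * (U s * P s)) + cc (k * e ^+ 3) * S2 s + cc k * (W1 s * A s - F s).
pose E' s := dE0 e (P s) (P1 s) (P2 s) (S s) (S1 s) (S2 s) (pt s) (qt s)
  + kap * dQ (V s) Kc Ks Kc1 Ks1 (P s) (S s) (pt s) (qt s) (cc (k * e ^+ 3) * W1 s).
have d1 : d <= 1 / 10 by have := d_small; have := d0; lra.
have ke : 0 < k * e by rewrite mulr_gt0.
have k_e : 0 < k / e by rewrite divr_gt0.
have bnd s := E0_bounds e (P s) (P1 s) (S s) (S1 s).
have pA s : 0 <= nA e (P1 s) (S1 s) by rewrite addr_ge0 ?Isq_ge0.
have pB s : 0 <= nB (P s) (S s) by rewrite addr_ge0 ?Isq_ge0.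
have a0 : 0 < k * e / 3000 by rewrite divr_gt0 ?ltr0n.
have dE (s : R) : 0 < s -> is_derive s (1 : R) E (E' s).
  move=> s0; have r1 := energy0_rate eP eS dP dS e s0; have r2 := Q_rate eP eS KN hW1 hWt s0.
  have r3 := is_derive_lin kap r1 r2; exact: r3.
have Qb s : 0 < s -> - nB (P s) (S s) <= Q Kc Ks (V s) (P s) (S s) <= 17 * nB (P s) (S s).
  by move=> s0; rewrite (Q_ge k0 e0 KN _ _ (hVok s0)) (Q_le k0 e0 KN _ _ (hVok s0)).
have Elo s : 0 < s -> 4 / 1000 * (nA e (P1 s) (S1 s) + nB (P s) (S s)) <= E s.
  move=> s0; have /andP[h1 _] := bnd s; have /andP[h2 _] := Qb s s0.
  move: (pA s) (pB s) h1 h2; rewrite /E /kap.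
  move: (nA _ _ _) (nB _ _) (E0 _ _ _ _ _) (Q _ _ _ _ _) => x1 x2 x3 x4.
  by move=> *; lra.
have Ehi s : 0 < s -> E s <= 3 * (nA e (P1 s) (S1 s) + nB (P s) (S s)).
  move=> s0; have /andP[_ h1] := bnd s; have /andP[_ h2] := Qb s s0.
  move: (pA s) (pB s) h1 h2; rewrite /E /kap.
  move: (nA _ _ _) (nB _ _) (E0 _ _ _ _ _) (Q _ _ _ _ _) => x1 x2 x3 x4.
  by move=> *; lra.
have Ege s : 0 < s -> 0 <= E s.
  by move=> s0; apply: le_trans (Elo s s0); have := pA s; have := pB s; move: (nA _ _ _) (nB _ _) => *; lra.
have rate s : 0 < s -> E' s <= - (k * e / 3000) * E s + (1003 * (k / e * T0)) * expR (- b * s).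
  move=> s0.
  have [p1 p2 _ _ _] := eP s s0; have [q1 q2 _ _ _] := eS s s0.
  have [ha ha1 ha0] := hA s s0; have [hb hb1 hb0] := hB s s0.
  have H := energy_rate d0 d1 (der_V s) (hW s0) (hW1 s0) (fun y => W_half y s0) (W1_d s0) (W2_d s0)
    (c s) k1 e0 KN (F s) (G s) p1 p2 (dP s0) q1 q2 (dS s0) ha ha1 ha0 hb hb1 hb0 d_small.
  have {}H : E' s <= - (1 / 1000) * (k * e * (nA e (P1 s) (S1 s) + nB (P s) (S s)))
     + 1003 * (k / e * (I (F s * F s) + I (G s * G s))) := H.
  apply: le_trans H _; apply: lerD.
    have := ler_wpM2l (ltW ke) (Ehi s s0); move: (nA _ _ _ + nB _ _) (E s) (k * e) => x1 x2 x3.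
    by move=> *; lra.
  have -> : 1003 * (k / e * T0) * expR (- b * s) = 1003 * (k / e * (T0 * expR (- b * s))) by ring.
  apply: ler_wpM2l; first by rewrite ler0n.
  by apply: ler_wpM2l; [exact: ltW|exact: hT].
have hM2 (r : R) : 0 < r -> exists2 s, 0 < s < r & E s <= 3 * M.
  move=> r0; have [s sr hs] := hM r r0; exists s => //.
  have s0 : 0 < s by case/andP: sr.
  by apply: le_trans (Ehi s s0) _; rewrite ler_pM2l.
have B0 : 0 <= 1003 * (k / e * T0) by apply: mulr_ge0; [rewrite ler0n|apply: mulr_ge0; [exact: ltW|]].
have := gronwall a0 B0 L0 Lb La dE Ege rate hM2 t0.
have -> : 2 * (1003 * (k / e * T0)) / (k * e / 3000) = 6018 * 1000 * (T0 / e ^+ 2).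
  by field; rewrite ?gt_eqF.
move=> H; have H2 := le_trans (Elo t t0) H; rewrite /mode_energy.
have -> : 750 * expR 1 * M * expR (- (k * e / 3000 / 2) * t) = 250 * (expR 1 * (3 * M) * expR (- (k * e / 3000 / 2) * t)) by ring.
move: H2; have -> : 6018 * 1000 * (T0 / e ^+ 2) * expR (- L * t) = 6018 * 1000 * (T0 / e ^+ 2 * expR (- L * t)) by ring.
have : 0 <= T0 / e ^+ 2 * expR (- L * t) by apply: mulr_ge0; [apply: divr_ge0 => //; exact: sqr_ge0|exact: expR_ge0].
move: (nA _ _ _ + nB _ _) (T0 / e ^+ 2 * _) (_ * expR (- (k * e / 3000 / 2) * t)) => x1 x2 x3.
by clear H; move=> *; lra.
Qed.

End Decay.

(** * Norms and initial data *)

Section Norms.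
Context {R : realType}.
Local Notation C := (@cfct R).
Local Notation leb := (@lebesgue_measure R).
Implicit Types (f g h : R -> R).

Lemma cfct_meas (F : C) (D : set (measurableTypeR R)) : measurable D -> measurable_fun D (F : R -> R).
Proof. by move=> mD; apply: measurable_funTS; apply: continuous_measurable_fun; exact: cfct_cont. Qed.

Lemma meas_oo f (F : C) : (forall y, -1 < y < 1 -> f y = F y) ->
  measurable_fun (`]-1, 1[%classic : set (measurableTypeR R)) f.
Proof.
move=> h; apply: (eq_measurable_fun (F : R -> R)); last by apply: cfct_meas; exact: measurable_itv.
by move=> y; rewrite inE/= in_itv/= => /h ->.
Qed.

Lemma meas_chan f (F : C) : (forall y, -1 < y < 1 -> f y = F y) -> measurable_fun (@chan R) f.
Proof. by move=> h; apply: (measurable_fun_itv_cc (b0 := false) (b1 := true)); exact: meas_oo h. Qed.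

Lemma chan_int h (H : C) : (forall y, -1 < y < 1 -> h y = H y) ->
  (\int[leb]_(y in @chan R) (h y)%:E = (I H)%:E)%E.
Proof.
move=> e; rewrite (@eq_integral_itv_bounded _ (-1) 1 (H : R -> R)).
- rewrite IE /Rintegral fineK//; apply: integrable_fin_num => //; exact: cfct_int.
- exact: meas_oo e.
- by apply: cfct_meas; exact: measurable_itv.
- by move=> y; rewrite in_itv/=; exact: e.
Qed.

Lemma L2sq_I f (F : C) : (forall y, -1 < y < 1 -> f y = F y) -> L2sq f = (I (F * F))%:E.
Proof. by move=> e; apply: chan_int => y /e ->; rewrite cfM expr2. Qed.

Lemma cL2sq_I (f : R -> R[i]) (F G : C) : (forall y, -1 < y < 1 -> complex.Re (f y) = F y) ->
  (forall y, -1 < y < 1 -> complex.Im (f y) = G y) -> cL2sq f = (I (F * F) + I (G * G))%:E.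
Proof. by move=> e1 e2; rewrite -ID; apply: chan_int => y hy; rewrite e1// e2// cfD !cfM !expr2. Qed.

Lemma L2sq_ge0 f : (0 <= L2sq f)%E.
Proof. by apply: integral_ge0 => y _; rewrite lee_fin sqr_ge0. Qed.

Lemma meas_sqr f : measurable_fun (@chan R) f -> measurable_fun (@chan R) (fun y => (f y ^+ 2)%:E).
Proof. by move=> mf; apply/measurable_EFinP; exact: measurable_funX. Qed.

Lemma L2sq_triangle f g : measurable_fun (@chan R) f -> measurable_fun (@chan R) g ->
  (L2sq f <= 2%:E * L2sq g + 2%:E * L2sq (fun y => (f y - g y)%R))%E.
Proof.
move=> mf mg.
have mfg : measurable_fun (@chan R) (fun y => f y - g y) by exact: measurable_funB.
have sq u y : (0 <= ((u y : R) ^+ 2)%:E)%E by rewrite lee_fin sqr_ge0.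
have mc : measurable (@chan R : set (measurableTypeR R)) by exact: measurable_itv.
rewrite -!ge0_integralZl_EFin//; try exact: meas_sqr.
rewrite -ge0_integralD//; try by apply: measurable_funeM; exact: meas_sqr.
- apply: ge0_le_integral => //; first exact: meas_sqr.
    by apply: emeasurable_funD; apply: measurable_funeM; exact: meas_sqr.
  move=> y _; rewrite -!EFinM -EFinD lee_fin.
  have := sqr_ge0 (f y - 2 * g y); lra.
- by move=> y _; rewrite -EFinM lee_fin mulr_ge0// sqr_ge0.
- by move=> y _; rewrite -EFinM lee_fin mulr_ge0// sqr_ge0.
Qed.

Lemma L2_integrable g : in_L2 g -> leb.-integrable (`[-1, 1]%classic : set (measurableTypeR R)) (EFin \o g).
Proof.
move=> [mg g2]; have mc : measurable (@chan R : set (measurableTypeR R)) by exact: measurable_itv.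
have i2 : leb.-integrable (`[-1, 1]%classic : set (measurableTypeR R)) (fun y => (g y ^+ 2)%:E).
  apply/integrableP; split; first exact: meas_sqr.
  apply: le_lt_trans g2; apply: ge0_le_integral => //.
  - by apply: measurableT_comp => //; exact: meas_sqr.
  - exact: meas_sqr.
  - by move=> y _; rewrite gee0_abs// lee_fin sqr_ge0.
have i1 : leb.-integrable (`[-1, 1]%classic : set (measurableTypeR R)) (EFin \o (cc 1 : C)) by exact: cfct_int.
apply: (le_integrable mc _ _ (integrableD mc i1 i2)); first exact/measurable_EFinP.
move=> y _; have p : 0 <= 1 + g y ^+ 2 by rewrite addr_ge0 ?sqr_ge0.
rewrite /= lee_fin ccE (ger0_norm p).
rewrite -(real_normK (num_real (g y))); have := sqr_ge0 (`|g y| - 1); have := normr_ge0 (g y); nra.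
Qed.

Lemma weak_deriv_cont f g : weak_deriv f g -> {within `[-1, 1], continuous f}.
Proof.
move=> [g2 hf]; have := L2_integrable g2 => ig.
have lt11 : (-1 : R) <= 1 by lra.
have hc := parameterized_integral_continuous lt11 ig.
apply/subspace_continuousP => x cx; have E := hf x cx.
suff : f @ within (`[-1, 1]%classic) (nbhs x) --> (f x : R) by [].
rewrite E.
have hx : (fun y => f (-1) + \int[leb]_(z in `[-1, y]) g z) y @[y --> within (`[-1, 1]%classic) (nbhs x)] -->
    f (-1) + \int[leb]_(z in `[-1, x]) g z.
  by apply: cvgD; [exact: cvg_cst|move/subspace_continuousP: hc; apply].
apply: cvg_trans hx; apply: fmap_within_eq => y; rewrite inE => cy.
by rewrite (hf y cy).
Qed.

Lemma weak_deriv_rep f g : weak_deriv f g -> exists F : C, forall y, -1 <= y <= 1 -> F y = f y.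
Proof.
by move=> /weak_deriv_cont/cl_within cf; exists (mkC cf) => y hy; change (f (cl y) = f y); rewrite clE.
Qed.

Lemma weak_deriv_rep1 f g (G : C) : weak_deriv f g -> (forall y, -1 <= y <= 1 -> G y = g y) ->
  exists2 F : C, (forall y, -1 <= y <= 1 -> F y = f y) & der F G.
Proof.
move=> [_ hf] hG; exists (cc (f (-1)) + prim G).
  move=> y hy; have cy : chan y by rewrite /chan/= in_itv/=.
  rewrite cfD ccE primE// (hf y cy).
  congr (_ + _); apply: eq_Rintegral => z; rewrite inE/= in_itv/= => /andP[z1 z2].
  by apply: hG; rewrite z1/=; case/andP: hy => _; exact: le_trans.
by apply: der_eq (derD (der_cc _) (der_prim G)) _; rewrite add0r.
Qed.

Lemma L2sq_near0 (u : R -> \bar R) (e : R) : (forall t, 0 <= u t)%E -> 0 < e -> u t @[t --> (0 : R)^'+] --> 0%E ->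
  \forall s \near (0 : R)^'+, (u s <= e%:E)%E.
Proof.
move=> u0 e0 /fine_cvgP[fu /cvgrPdist_le /(_ e e0)]; apply: filter_app; near=> s.
have fs : u s \is a fin_num by near: s.
rewrite /= sub0r normrN => h.
by rewrite -(fineK fs) lee_fin; apply: le_trans h; exact: ler_norm.
Unshelve. all: by end_near. Qed.

(** Convergence in [H^1] gives bounds only at positive times near 0; the triangle inequality in
    squared form costs the factor 2, which ends up in [C0]. *)
Lemma initial_component (f : R -> R -> R) (f0 df0 : R -> R) (F F1 : R -> C) :
  weak_deriv f0 df0 -> H1_initial f f0 df0 ->
  (forall t y, 0 < t -> F t y = f t (cl y)) ->
  (forall t y, 0 < t -> -1 < y < 1 -> F1 t y = dy f t y) ->
  exists a0 a1 : R, [/\ L2sq f0 = a0%:E, L2sq df0 = a1%:E, 0 <= a0 /\ 0 <= a1 &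
    forall e, 0 < e -> \forall s \near (0 : R)^'+, I (F s * F s) <= 2 * a0 + 2 * e /\ I (F1 s * F1 s) <= 2 * a1 + 2 * e].
Proof.
move=> wd [h0 h1] hF hF1; have [Z hZ] := weak_deriv_rep wd.
have e0 : L2sq f0 = (I (Z * Z))%:E by apply: L2sq_I => y hy; rewrite hZ//; lra.
have m0 : measurable_fun (@chan R) f0 by apply: (@meas_chan _ Z) => y hy; rewrite hZ//; lra.
have [[m1 fin1] _] := wd.
have f1 : L2sq df0 \is a fin_num by rewrite ge0_fin_numE// L2sq_ge0.
exists (I (Z * Z)), (fine (L2sq df0)); split => //; first by rewrite fineK.
  by split; [exact: Isq_ge0|exact: fine_ge0 (L2sq_ge0 _)].
move=> e ep.
have n0 := L2sq_near0 (fun t => L2sq_ge0 _) ep h0; have n1 := L2sq_near0 (fun t => L2sq_ge0 _) ep h1.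
near=> s; have s0 : 0 < s by near: s; exact: nbhs_right_gt.
have b0 : (L2sq (fun y => (f s y - f0 y)%R) <= e%:E)%E by near: s.
have b1 : (L2sq (fun y => (dy f s y - df0 y)%R) <= e%:E)%E by near: s.
have g0 y : -1 < y < 1 -> f s y = F s y by move=> hy; rewrite hF// clE//; lra.
have g1 y : -1 < y < 1 -> dy f s y = F1 s y by move=> hy; rewrite hF1.
have t0 := L2sq_triangle (meas_chan g0) m0; have t1 := L2sq_triangle (meas_chan g1) m1.
rewrite (L2sq_I g0) e0 in t0; rewrite (L2sq_I g1) -(fineK f1) in t1.
split.
- rewrite -lee_fin; apply: le_trans t0 _; rewrite !EFinD !EFinM; apply: leeD2l.
  by apply: lee_wpmul2l => //; rewrite lee_fin.
- rewrite -lee_fin; apply: le_trans t1 _; rewrite !EFinD !EFinM; apply: leeD2l.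
  by apply: lee_wpmul2l => //; rewrite lee_fin.
Unshelve. all: by end_near. Qed.

End Norms.

(** * Background bounds and the mode equations in real form *)

Section Background.
Context {R : realType}.
Local Notation C := (@cfct R).

Lemma evolves_ext (F F1 F2 Ft Gt : R -> C) : evolves F F1 F2 Ft ->
  (forall t y, 0 < t -> -1 < y < 1 -> Ft t y = Gt t y) -> evolves F F1 F2 Gt.
Proof.
move=> h e t t0; have [a b u v w] := h t t0; split => //.
by apply: ud_ext u => // y hy; apply: (cfct_eq_oo _ hy) => z; exact: e.
Qed.

Lemma Hnorm_le (m : R) (n j : nat) (D : nat -> R -> R) : 0 <= m -> (j <= n)%N ->
  (Hnorm n D <= m%:E)%E -> (L2sq (D j) <= (m ^+ 2)%:E)%E.
Proof.
move=> m0 jn; rewrite /Hnorm => h.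
set S := (\sum_(i < n.+1) L2sq (D i))%E in h.
have S0 : (0 <= S)%E by apply: sume_ge0 => i _; exact: L2sq_ge0.
have jS : (L2sq (D j) <= S)%E.
  rewrite /S (bigD1 (Ordinal (jn : (j < n.+1)%N)))//= leeDl//.
  by apply: sume_ge0 => i _; exact: L2sq_ge0.
apply: le_trans jS _; move: S0 h; case: S => [s| |]//=.
- rewrite !lee_fin => s0; rewrite powR12_sqrt// => h.
  rewrite -(sqr_sqrtr s0); apply: lerXn2r => //; rewrite ?nnegrE ?sqrtr_ge0//.
- by move=> _; rewrite invr_eq0 pnatr_eq0.
Qed.

Lemma background_flow (mu m : R) (Win : R -> R) (DWin : nat -> R -> R) (W : R -> R -> R) :
  0 < mu -> 0 < m -> in_H 4 Win DWin -> Win (-1) = 0 -> Win 1 = 0 ->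
  heat_flow mu Win (DWin 1%N) W -> (Hnorm 4 DWin <= m%:E)%E ->
  exists (F F1 F2 : R -> C) (c : R -> R), [/\ evolves F F1 F2 (fun t => cc mu * F2 t),
    forall t, 0 < t -> [/\ I (F2 t * F2 t) <= m ^+ 2,
      forall y, -1 <= y <= 1 -> F1 t y ^+ 2 <= 8 * m ^+ 2 & forall y, F t y ^+ 2 <= 32 * m ^+ 2] &
    forall t y, 0 < t -> -1 < y < 1 ->
      shear W t y = (idC + prim (F t) + cc (c t)) y /\ dy (dy (shear W)) t y = F1 t y].
Proof.
move=> mu0 m0 [D0 wd] Wl Wr [cW heq hbd _ [hini _]] hH.
have [F [F1 [F2 [Ft [hF hF12 eF]]]]] := classical_family cW.
have eF' : evolves F F1 F2 (fun t => cc mu * F2 t).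
  apply: evolves_ext eF _ => t y t0 hy; have [_ e2 et] := hF12 t y t0 hy.
  by rewrite et cfM ccE e2; have /eqP := heq t y (conj t0 hy); rewrite subr_eq0 => /eqP.
have cl1 : cl (-1) = -1 :> R by rewrite clE//; lra.
have clr : cl 1 = 1 :> R by rewrite clE//; lra.
have dF t : 0 < t -> dirich (F t).
  by move=> t0; have [b1 b2] := hbd t (ltW t0); split; rewrite hF// ?cl1 ?clr.
have [w02 h02] := weak_deriv_rep (wd 2%N isT).
have [w01 h01 d01] := weak_deriv_rep1 (wd 1%N isT) h02.
have [w0 h0 d0] := weak_deriv_rep1 (wd 0%N isT) h01.
have ch y : -1 <= y <= 1 -> @chan R y by move=> hy; rewrite /chan/= in_itv/=.
have hw0 y : -1 <= y <= 1 -> w0 y = Win y by move=> hy; rewrite h0// D0//; exact: ch.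
have dw0 : dirich w0 by split; rewrite hw0//; lra.
have hm : I (w02 * w02) <= m ^+ 2.
  have := Hnorm_le (ltW m0) (isT : (2 <= 4)%N) hH.
  by rewrite (@L2sq_I _ _ w02) ?lee_fin// => y hy; rewrite h02//; lra.
have W_init e t : 0 < e -> 0 < t -> exists2 s, 0 < s < t & I ((F s - w0) * (F s - w0)) <= e.
  move=> e0 t0; have n := L2sq_near0 (fun t => L2sq_ge0 _) e0 hini.
  have n2 : \forall s \near (0 : R)^'+, 0 < s < t /\ I ((F s - w0) * (F s - w0)) <= e.
    near=> s; have s0 : 0 < s by near: s; exact: nbhs_right_gt.
    have st : s < t by near: s; exact: nbhs_right_lt.
    split; first by rewrite s0.
    have : (L2sq (fun y => (W s y - Win y)%R) <= e%:E)%E by near: s.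
    rewrite (@L2sq_I _ _ (F s - w0)) ?lee_fin// => y hy.
    by rewrite cfB hF// clE ?hw0//; lra.
  by have [s [h1 h2]] := filter_ex n2; exists s.
have bnd t : 0 < t -> [/\ I (F2 t * F2 t) <= m ^+ 2,
      forall y, -1 <= y <= 1 -> F1 t y ^+ 2 <= 8 * m ^+ 2 & forall y, F t y ^+ 2 <= 32 * m ^+ 2].
  move=> t0; have [b1 b2 b3] := heat_bounds mu0 m0 eF' dF d0 d01 dw0 hm W_init t0.
  (* As [F t] is constant beyond the walls, the bound holds on the whole line, as the reciprocal of
     [1 + W] requires. *)
  split => // y; have -> : F t y = F t (cl y) by rewrite !hF// (clE (cl_in y)).
  exact: b3 (cl_in y).
have shear_t (t : R) : exists c, 0 < t -> forall y, -1 < y < 1 ->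
    shear W t y = (idC + prim (F t) + cc c) y /\ dy (dy (shear W)) t y = F1 t y.
  have [t0|t0] := ltP 0 t; last by exists 0.
  have [d1 _ _ _ _] := eF' t t0.
  have hWF z : -1 <= z <= 1 -> W t z = F t z by move=> hz; rewrite hF// clE.
  by have [c hc] := shear_interior hWF d1; exists c.
have [c hc] := choice shear_t.
by exists F, F1, F2, c; split => // t y t0 hy; exact: hc.
Unshelve. all: by end_near. Qed.

Lemma mode_equations (mu nu : R) (U : R -> R -> R) (k : int) (om psi th : R -> R -> R[i]) (t y : R) :
  mode_system mu nu U k om psi th -> 0 < t -> -1 < y < 1 ->
  let kr : R := k%:~R in let u := U t y in let u2 := dy (dy U) t y in
  [/\ dt (re om) t y = kr * u * im om t y - kr * u2 * im psi t y + mu * dy (dy (re om)) t y + kr * im th t y,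
      dt (im om) t y = - (kr * u * re om t y) + kr * u2 * re psi t y + mu * dy (dy (im om)) t y - kr * re th t y,
      dt (re th) t y = kr * u * im th t y + nu * dy (dy (re th)) t y,
      dt (im th) t y = - (kr * u * re th t y) + nu * dy (dy (im th)) t y &
      dy (dy (re psi)) t y = re om t y + kr ^+ 2 * re psi t y /\
      dy (dy (im psi)) t y = im om t y + kr ^+ 2 * im psi t y].
Proof.
move=> [_ _ heq _] t0 hy kr u u2.
have [e1 e2 e3] := heq t y (conj t0 hy).
have kE : (k%:~R : R[i]) = Complex kr 0 by rewrite -[RHS]/(kr%:C) /kr rmorph_int.
have c2 f : cdy (cdy f) t y = Complex (dy (dy (re f)) t y) (dy (dy (im f)) t y) by [].
have eta f : f t y = Complex (re f t y) (im f t y) by rewrite /re /im; case: (f t y).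
move: e1 e2 e3; rewrite kE !c2 /cdt /ik -/kr -/u -/u2 (eta om) (eta psi) (eta th) expr2.
move: (dt (re om) t y) (dt (im om) t y) (dt (re th) t y) (dt (im th) t y) => x1 x2 x3 x4.
move: (dy (dy (re om)) t y) (dy (dy (im om)) t y) (dy (dy (re th)) t y) (dy (dy (im th)) t y) => x5 x6 x7 x8.
move: (dy (dy (re psi)) t y) (dy (dy (im psi)) t y) => x9 x10.
move: (re om t y) (im om t y) (re th t y) (im th t y) (re psi t y) (im psi t y) => a b f g al be.
simpc => e1 e2 e3.
(* Zero is restated as a [Complex], so that the equation splits into its two components. *)
have e2' : Complex (x3 - kr * u * g - nu * x7) (x4 + kr * u * f - nu * x8) = Complex 0 0 := e2.
case: e1 => e11 e12; case: e2' => e21 e22; case: e3 => e31 e32.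
clear c2 eta heq kE e2; rewrite expr2; clearbody kr u u2.
by split; [lra|lra|lra|lra|split; lra].
Qed.

End Background.

(** * Layer width, mode energies and their initial values *)

Section Modes.
Context {R : realType}.
Local Notation C := (@cfct R).

(** The width [e] at which the transport rate [K e] across the layer balances the diffusion rate
    [kappa / e^2]. *)
Definition width (kappa K : R) : R := kappa `^ (1 / 3) * K `^ (- (1 / 3)).

Lemma width_gt0 kappa K : 0 < kappa -> 0 < K -> 0 < width kappa K.
Proof. by move=> k0 K0; rewrite mulr_gt0// powR_gt0. Qed.

Lemma powR_third3 (x : R) : 0 <= x -> (x `^ (1 / 3)) ^+ 3 = x.
Proof. by move=> x0; rewrite -powR_mulrn ?powR_ge0// -powRrM mul1r mulVf ?pnatr_eq0// powRr1. Qed.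

Lemma powR_third2 (x : R) : (x `^ (1 / 3)) ^+ 2 = x `^ (2 / 3).
Proof. by rewrite -powR_mulrn ?powR_ge0// -powRrM; congr (_ `^ _); field. Qed.

Lemma width3 kappa K : 0 < kappa -> 0 < K -> K * width kappa K ^+ 3 = kappa.
Proof.
move=> k0 K0; rewrite /width exprMn powRN exprVn !powR_third3 ?ltW//.
by field; rewrite gt_eqF.
Qed.

Lemma width2 kappa K : width kappa K ^+ 2 = kappa `^ (2 / 3) * K `^ (- (2 / 3)).
Proof. by rewrite /width exprMn !powRN exprVn !powR_third2. Qed.

Lemma width_rate kappa K : 0 < K -> K * width kappa K = kappa `^ (1 / 3) * K `^ (2 / 3).
Proof.
move=> K0; rewrite /width powRN -powR_third2.
have p := powR_gt0 (1 / 3) K0; rewrite -[X in X * _ = _](powR_third3 (ltW K0)).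
by move: p; move: (K `^ _) (kappa `^ _) => x y x0; field; rewrite gt_eqF.
Qed.

Lemma width_le kappa kappa' K : 0 < kappa -> kappa <= kappa' -> 0 < K -> width kappa K <= width kappa' K.
Proof.
move=> k0 kk K0; rewrite /width ler_pM2r ?powR_gt0//.
by apply: ge0_ler_powR; rewrite ?nnegrE ?divr_ge0// ltW// (lt_le_trans k0).
Qed.

Lemma decayE (kappa t c : R) (k : int) : 0 < absk k :> R -> decay kappa k t c = expR (- (absk k * width kappa (absk k) * c) * t).
Proof. by move=> K0; rewrite /decay width_rate//; congr expR; ring. Qed.

Lemma evolvesZ (s : R) (F F1 F2 Ft : R -> C) : evolves F F1 F2 Ft ->
  evolves (fun t => cc s * F t) (fun t => cc s * F1 t) (fun t => cc s * F2 t) (fun t => cc s * Ft t).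
Proof.
have dZ (f g : C) : der f g -> der (cc s * f) (cc s * g).
  by move=> h; apply: der_eq (derM (der_cc s) h) _; rewrite mul0r add0r.
have uZ (G : R -> C) t : uc inI G t -> uc inI (fun t => cc s * G t : C) t.
  move=> [_ h]; split; first exact: bdd_cfct.
  move=> e e0; have s0 : 0 < `|s| + 1 by have := normr_ge0 s; lra.
  have e1 : 0 < e / (`|s| + 1) by rewrite divr_gt0.
  apply: filterS (h _ e1) => r hr y hy; rewrite !cfM !ccE -mulrBr normrM.
  apply: le_trans (ler_wpM2l (normr_ge0 s) (hr y hy)) _.
  by rewrite mulrA ler_pdivrMr// [_ * e]mulrC ler_pM2l// lerDl.
move=> h t t0; have [a b u v w] := h t t0; split; [exact: dZ|exact: dZ| |exact: uZ|exact: uZ].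
apply: ud_ext (udM (ud_cst t (bdd_cst _ s)) u) => [r y _|y _]; rewrite !cfM ccE//.
by rewrite mul0r add0r.
Qed.

Lemma stream_family (u : R -> R) (p : C) (l : R) : {within `[-1, 1], continuous u} ->
  (forall y, -1 < y < 1 -> derivable u y 1) ->
  (forall y, -1 < y < 1 -> derivable (derive1 u) y 1) ->
  (forall y, -1 < y < 1 -> derive1 (derive1 u) y = p y + l * u y) ->
  exists a : C * C, [/\ forall y, a.1 y = u (cl y), der a.1 a.2 & der a.2 (p + cc l * a.1)].
Proof.
move=> cu du du1 E; pose a0 : C := mkC (cl_within cu).
have [||a [a1 [ha d1 d2]]] := @poisson_family _ u (p + cc l * a0) cu.
- exact: du.
- move=> y hy; apply: is_derive_eq (derivable_is_derive1 (du1 y hy)) _.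
  rewrite E// cfD cfM ccE; congr (_ + _ * _).
  by change (u y = u (cl y)); rewrite clE//; lra.
exists (a, a1); split => //=; rewrite (_ : a = a0)//.
by apply/cfctP => y; rewrite ha.
Qed.

Lemma cL2sqD (f : R -> R[i]) : measurable_fun (@chan R) (fun y => complex.Re (f y)) ->
  measurable_fun (@chan R) (fun y => complex.Im (f y)) ->
  (cL2sq f = L2sq (fun y => complex.Re (f y)) + L2sq (fun y => complex.Im (f y)))%E.
Proof.
move=> m1 m2; rewrite /L2sq -ge0_integralD//; try exact: meas_sqr.
- exact: measurable_itv.
- by move=> y _; rewrite lee_fin sqr_ge0.
- by move=> y _; rewrite lee_fin sqr_ge0.
Qed.

Lemma weak_deriv_meas (f g : R -> R) : weak_deriv f g -> measurable_fun (@chan R) f.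
Proof. by move=> /weak_deriv_rep[Z hZ]; apply: (@meas_chan _ _ Z) => y hy; rewrite hZ//; lra. Qed.

Definition represents (F F1 : R -> C) (f : R -> R -> R) :=
  (forall t y, 0 < t -> F t y = f t (cl y)) /\ (forall t y, 0 < t -> -1 < y < 1 -> F1 t y = dy f t y).

Lemma energy_mode (kappa : R) (k : int) (f : R -> R -> R[i]) (s t : R) (F F1 G G1 : R -> C) :
  s ^+ 2 = 1 -> 0 < t -> represents F F1 (re f) -> represents G G1 (im f) ->
  energy kappa k (f t) (cdy f t) =
    (mode_energy (width kappa (absk k)) (F t) (F1 t) (cc s * G t) (cc s * G1 t))%:E.
Proof.
move=> s2 t0 [hF hF1] [hG hG1]; rewrite /energy.
have sI (g : C) : I (cc s * g * (cc s * g)) = I (g * g).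
  have -> : cc s * g * (cc s * g) = cc (s ^+ 2) * (g * g) by ring.
  by rewrite s2 IZ mul1r.
rewrite (@cL2sq_I _ (f t) (F t) (G t)); first last.
- by move=> y hy; rewrite hG// clE//; lra.
- by move=> y hy; rewrite hF// clE//; lra.
rewrite (@cL2sq_I _ (cdy f t) (F1 t) (G1 t)); first last.
- by move=> y hy; rewrite hG1.
- by move=> y hy; rewrite hF1.
rewrite -EFinM -EFinD; congr EFin; rewrite /mode_energy nAE /nB width2 !sI.
by rewrite addrC.
Qed.

Lemma initial_energy (kappa : R) (k : int) (f : R -> R -> R[i]) (f0 df0 : R -> R[i]) (s : R) (F F1 G G1 : R -> C) :
  s ^+ 2 = 1 -> cweak_deriv f0 df0 -> cH1_initial f f0 df0 ->
  represents F F1 (re f) -> represents G G1 (im f) ->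
  exists phi : R, [/\ energy kappa k f0 df0 = phi%:E, 0 <= phi &
    forall e t, 0 < e -> 0 < t -> exists2 r, 0 < r < t &
     mode_energy (width kappa (absk k)) (F r) (F1 r) (cc s * G r) (cc s * G1 r) <= 2 * phi + e].
Proof.
move=> s2 [w1 w2] [i1 i2] [hF hF1] [hG hG1].
have sI (g : C) : I (cc s * g * (cc s * g)) = I (g * g).
  have -> : cc s * g * (cc s * g) = cc (s ^+ 2) * (g * g) by ring.
  by rewrite s2 IZ mul1r.
have [a0 [a1 [ea0 ea1 [pa0 pa1] ha]]] := initial_component w1 i1 hF hF1.
have [b0 [b1 [eb0 eb1 [pb0 pb1] hb]]] := initial_component w2 i2 hG hG1.
set w := width _ _; have ww : 0 <= w ^+ 2 by exact: sqr_ge0.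
exists (a0 + b0 + w ^+ 2 * (a1 + b1)); split.
- rewrite /energy cL2sqD; [|exact: weak_deriv_meas w1|exact: weak_deriv_meas w2].
  have [[[m1 _] _] [[m2 _] _]] := (w1, w2).
  by rewrite cL2sqD// ea0 eb0 ea1 eb1 /w width2.
- by rewrite !addr_ge0// mulr_ge0// addr_ge0.
move=> e t e0 t0.
have d0 : 0 < 4 + 4 * w ^+ 2 by lra.
(* The real and imaginary parts each lose [2 r] in the function and [2 r w^2] in the derivative. *)
pose r := e / (4 + 4 * w ^+ 2); have r0 : 0 < r by rewrite divr_gt0.
have rE : r * (4 + 4 * w ^+ 2) = e by rewrite /r divfK// gt_eqF.
have n1 := ha r r0; have n2 := hb r r0.
have n : \forall q \near (0 : R)^'+, 0 < q < t /\
    mode_energy w (F q) (F1 q) (cc s * G q) (cc s * G1 q) <= 2 * (a0 + b0 + w ^+ 2 * (a1 + b1)) + e.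
  near=> q.
  have q0 : 0 < q by near: q; exact: nbhs_right_gt.
  have qt : q < t by near: q; exact: nbhs_right_lt.
  split; first by rewrite q0.
  have [u1 u2] : I (F q * F q) <= 2 * a0 + 2 * r /\ I (F1 q * F1 q) <= 2 * a1 + 2 * r by near: q.
  have [u3 u4] : I (G q * G q) <= 2 * b0 + 2 * r /\ I (G1 q * G1 q) <= 2 * b1 + 2 * r by near: q.
  rewrite /mode_energy nAE /nB !sI.
  have u5 := ler_wpM2l ww (lerD u2 u4).
  by rewrite -rE; move: u5 u1 u3; genI; move: (w ^+ 2) (r) => ww2 rr; intros; lra.
by have [q [h1 h2]] := filter_ex n; exists q.
Unshelve. all: by end_near. Qed.

Lemma le_of_add_eps (A a b x : R) : 0 <= a -> (forall e, 0 < e -> x <= A + a * (b + e)) -> x <= A + a * b.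
Proof.
move=> a0 h; apply/ler_addgt0Pr => e e0.
have p : 0 < a + 1 by lra.
have r0 : 0 < e / (a + 1) by rewrite divr_gt0.
apply: le_trans (h _ r0) _; rewrite mulrDr addrA lerD2l.
by rewrite mulrA ler_pdivrMr// [_ * e]mulrC ler_pM2l// lerDl.
Qed.

End Modes.

(** * From the equations to the estimates for one mode *)

Section Assembly.
Context {R : realType}.
Local Notation C := (@cfct R).

(** Conjugating a mode changes the sign of its wave number. Multiplying every imaginary part by [s]
    therefore reduces negative [k] to [absk k] and leaves all norms unchanged. *)
Lemma sgr_int (k : int) : k != 0 -> let s : R := Num.sg k%:~R in
  [/\ s ^+ 2 = 1, k%:~R = s * absk k, s * k%:~R = absk k & 1 <= absk k :> R].
Proof.
move=> k0; have kr0 : (k%:~R : R) != 0 by rewrite intr_eq0.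
split.
- by rewrite sqr_sg kr0.
- exact: numEsg.
- by rewrite /absk normrEsg.
- by rewrite /absk -intr_norm -[1]/(1%:~R) ler_int -gtz0_ge1 normr_gt0.
Qed.

Lemma mode_estimates (m mu nu : R) (Win : R -> R) (DWin : nat -> R -> R) (W : R -> R -> R)
  (k : int) (om psi th : R -> R -> R[i]) (om0 dom0 th0 dth0 : R -> R[i]) :
  0 < m -> 1000 * 1000 * 1000 * 10 * (3 * m) <= 1 -> 0 < mu -> 0 < nu -> k != 0 ->
  in_H 4 Win DWin -> Win (-1) = 0 -> Win 1 = 0 -> heat_flow mu Win (DWin 1%N) W ->
  (Hnorm 4 DWin <= m%:E)%E ->
  cweak_deriv om0 dom0 -> cweak_deriv th0 dth0 -> cH1_initial om om0 dom0 -> cH1_initial th th0 dth0 ->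
  mode_system mu nu (shear W) k om psi th ->
  let K : R := absk k in let km := Num.min mu nu in
  exists phw pht : R, [/\ 0 <= phw /\ 0 <= pht, energy mu k om0 dom0 = phw%:E, energy nu k th0 dth0 = pht%:E &
    forall t, 0 < t -> exists ew et : R, [/\ energy mu k (om t) (cdy om t) = ew%:E,
      energy nu k (th t) (cdy th t) = et%:E,
      et <= 1000 * expR 1 * pht * expR (- (K * width nu K / 3000 / 2) * t) &
      ew <= 1000 * 1000 * 1505 * (1000 * expR 1 * pht / width km K ^+ 2
              * expR (- (K * width km K / 3000 / 2) * t))
            + 1500 * expR 1 * phw * expR (- (K * width mu K / 3000 / 2) * t)]].
Proof.
move=> m0 m_small mu0 nu0 k0 hWin Wl Wr hW hH wom wth iom ith sys K km.
have [s2 krE skE K1] := sgr_int k0; set s := Num.sg _ in s2 krE skE.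
have K0 : 0 < K := lt_le_trans ltr01 K1.
have [F [F1 [F2 [c [eF bF shE]]]]] := background_flow mu0 m0 hWin Wl Wr hW hH.
(* The sup bound [8 m^2] on the square of [F1] stays below [9 m^2 = d^2]. *)
pose d := 3 * m; have d0 : 0 < d by rewrite mulr_gt0.
have m1 : m <= 1 / 1000 by have := m_small; lra.
have mm : m * m <= 1 / 1000 * (1 / 1000) by apply: ler_pM => //; exact: ltW.
have sqle (x y : R) : 0 <= y -> x ^+ 2 <= y ^+ 2 -> `|x| <= y.
  by move=> y0 h; rewrite -(ger0_norm y0) -ler_sqr ?nnegrE// !real_normK ?num_real.
have F_half t y : 0 < t -> - (1 / 2) <= F t y <= 1 / 2.
  move=> t0; rewrite -ler_norml; apply: sqle; first by rewrite divr_ge0 ?ler0n.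
  have [_ _ h] := bF t t0; apply: le_trans (h y) _; rewrite expr2; lra.
have F1_d t : 0 < t -> forall y, -1 <= y <= 1 -> `|F1 t y| <= d.
  move=> t0 y hy; apply: sqle; first exact: ltW.
  have [_ h _] := bF t t0; apply: le_trans (h y hy) _; rewrite /d.
  have := sqr_ge0 m; lra.
have F2_d t : 0 < t -> I (F2 t * F2 t) <= d ^+ 2.
  move=> t0; have [h _ _] := bF t t0; apply: le_trans h _; rewrite /d.
  have := sqr_ge0 m; lra.
have dF t : 0 < t -> der (F t) (F1 t) by move=> t0; have [] := eF t t0.
have dF1 t : 0 < t -> der (F1 t) (F2 t) by move=> t0; have [] := eF t t0.
have [[[cr ci] [tr ti]] hpsi _ hbd] := sys.
have [P [P1 [P2 [Pt [hP hP12 eP]]]]] := classical_family cr.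
have [S [S1 [S2 [St [hS hS12 eS]]]]] := classical_family ci.
have [X [X1 [X2 [Xt [hX hX12 eX]]]]] := classical_family tr.
have [Y [Y1 [Y2 [Yt [hY hY12 eY]]]]] := classical_family ti.
have rP : represents P P1 (re om) by split => // t y t0 hy; have [] := hP12 t y t0 hy.
have rS : represents S S1 (im om) by split => // t y t0 hy; have [] := hS12 t y t0 hy.
have rX : represents X X1 (re th) by split => // t y t0 hy; have [] := hX12 t y t0 hy.
have rY : represents Y Y1 (im th) by split => // t y t0 hy; have [] := hY12 t y t0 hy.
have [phw [Ew pw hw]] := initial_energy mu k s2 wom iom rP rS.
have [pht [Et pt ht]] := initial_energy nu k s2 wth ith rX rY.
exists phw, pht; split => //.
have oc y : -1 < y < 1 -> cl y = y by move=> hy; apply: clE; lra.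
have cl1 : cl (-1) = -1 :> R by rewrite clE//; lra.
have clr : cl 1 = 1 :> R by rewrite clE//; lra.
have bd t y : 0 < t -> y = -1 \/ y = 1 ->
   [/\ re psi t y = 0 /\ im psi t y = 0, re om t y = 0 /\ im om t y = 0 & re th t y = 0 /\ im th t y = 0].
  by move=> t0 hy; have [e1 e2 e3] := hbd t y (ltW t0) hy; rewrite /re /im e1 e2 e3.
have drh (G : R -> C) (g : R -> R -> R) : (forall t y, 0 < t -> G t y = g t (cl y)) ->
    (forall t y, 0 < t -> y = -1 \/ y = 1 -> g t y = 0) -> forall t, 0 < t -> dirich (G t).
  by move=> e z t t0; split; rewrite e// ?cl1 ?clr; apply: z => //; [left|right].
have dP := drh _ _ hP (fun t y t0 hy => proj1 (let: And3 _ h _ := bd t y t0 hy in h)).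
have dS := drh _ _ hS (fun t y t0 hy => proj2 (let: And3 _ h _ := bd t y t0 hy in h)).
have dX := drh _ _ hX (fun t y t0 hy => proj1 (let: And3 _ _ h := bd t y t0 hy in h)).
have dY := drh _ _ hY (fun t y t0 hy => proj2 (let: And3 _ _ h := bd t y t0 hy in h)).
have dZ (G : R -> C) : (forall t, 0 < t -> dirich (G t)) -> forall t, 0 < t -> dirich (cc s * G t).
  by move=> h t t0; have [z1 z2] := h t t0; split; rewrite cfM ?z1 ?z2 mulr0.
pose V t : C := idC + prim (F t).
have uE t y : 0 < t -> -1 < y < 1 -> (V t + cc (c t)) y = shear W t y by move=> t0 hy; have [-> _] := shE t y t0 hy.
have ev1 (l n y : R) (U Z Z2 : C) : (cc l * (U * Z) + cc n * Z2) y = l * (U y * Z y) + n * Z2 y.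
  by rewrite cfD !cfM !ccE.
have ev2 (l n y : R) (U Z Z2 : C) : (- (cc l * (U * Z)) + cc n * Z2) y = - (l * (U y * Z y)) + n * Z2 y.
  by rewrite cfD cfN !cfM !ccE.
have eX' : evolves X X1 X2 (fun t => cc K * ((V t + cc (c t)) * (cc s * Y t)) + cc (K * width nu K ^+ 3) * X2 t).
  apply: evolves_ext eX _ => t y t0 hy; have [_ e2 ->] := hX12 t y t0 hy.
  have [_ _ -> _ _] := mode_equations sys t0 hy.
  by rewrite width3// ev1 uE// cfM ccE e2 hY// oc// krE -/K; ring.
have eY' : evolves (fun t => cc s * Y t) (fun t => cc s * Y1 t) (fun t => cc s * Y2 t)
   (fun t => - (cc K * ((V t + cc (c t)) * X t)) + cc (K * width nu K ^+ 3) * (cc s * Y2 t)).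
  apply: evolves_ext (evolvesZ s eY) _ => t y t0 hy; have [_ e2 e3] := hY12 t y t0 hy.
  have [_ _ _ e4 _] := mode_equations sys t0 hy; rewrite cfM ccE e3 e4.
  by rewrite width3// ev2 uE// cfM ccE e2 hX// oc// /K -skE; ring.
have wm : 0 < width mu K := width_gt0 mu0 K0.
have wn : 0 < width nu K := width_gt0 nu0 K0.
have km0 : 0 < km by rewrite lt_min mu0.
have wk : 0 < width km K := width_gt0 km0 K0.
have decX t : 0 < t -> mode_energy (width nu K) (X t) (X1 t) (cc s * Y t) (cc s * Y1 t)
   <= 1000 * expR 1 * pht * expR (- (K * width nu K / 3000 / 2) * t).
  move=> t0.
  have := @le_of_add_eps R 0 (500 * expR 1 * expR (- (K * width nu K / 3000 / 2) * t)) (2 * pht)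
    (mode_energy (width nu K) (X t) (X1 t) (cc s * Y t) (cc s * Y1 t)).
  rewrite !add0r => H; apply: le_trans (H _ _) _; last by rewrite le_eqVlt; apply/orP; left; apply/eqP; ring.
    by rewrite !mulr_ge0 ?expR_ge0 ?ler0n.
  move=> e e0; rewrite add0r.
  have H2 := advection_diffusion_decay K1 F_half dX (dZ _ dY) wn eX' eY' (M := 2 * pht + e) (fun t t0 => ht e t e0 t0) t0.
  apply: le_trans H2 _; rewrite le_eqVlt; apply/orP; left; apply/eqP; rewrite -/K; ring.
have K2 : (k%:~R : R) ^+ 2 = K ^+ 2 by rewrite krE exprMn s2 mul1r.
have streamA (t : R) : exists a : C * C, 0 < t ->
    [/\ forall y, a.1 y = re psi t (cl y), der a.1 a.2 & der a.2 (P t + cc (K ^+ 2) * a.1)].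
  have [t0|t0] := ltP 0 t; last by exists (0, 0).
  have [c1 _ dd] := hpsi t t0.
  have [|||a ha] := @stream_family R (re psi t) (P t) (K ^+ 2) c1.
  - by move=> y hy; have [h _ _ _] := dd y hy; exact: h.
  - by move=> y hy; have [_ _ h _] := dd y hy; exact: h.
  - move=> y hy; have [_ _ _ _ [e5 _]] := mode_equations sys t0 hy.
    by rewrite hP// oc// -K2; exact: e5.
  by exists a.
have streamB (t : R) : exists a : C * C, 0 < t ->
    [/\ forall y, a.1 y = im psi t (cl y), der a.1 a.2 & der a.2 (S t + cc (K ^+ 2) * a.1)].
  have [t0|t0] := ltP 0 t; last by exists (0, 0).
  have [_ c1 dd] := hpsi t t0.
  have [|||a ha] := @stream_family R (im psi t) (S t) (K ^+ 2) c1.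
  - by move=> y hy; have [_ h _ _] := dd y hy; exact: h.
  - by move=> y hy; have [_ _ _ h] := dd y hy; exact: h.
  - move=> y hy; have [_ _ _ _ [_ e5]] := mode_equations sys t0 hy.
    by rewrite hS// oc// -K2; exact: e5.
  by exists a.
have [A hA] := choice streamA; have [B hB] := choice streamB.
have hA' t : 0 < t -> [/\ der (A t).1 (A t).2, der (A t).2 (P t + cc (K ^+ 2) * (A t).1) & dirich (A t).1].
  move=> t0; have [a1 a2 a3] := hA t t0; split => //.
  have [[z1 _] _ _] := bd t (-1) t0 (or_introl erefl); have [[z2 _] _ _] := bd t 1 t0 (or_intror erefl).
  by split; rewrite a1 ?cl1 ?clr.
have hB' t : 0 < t -> [/\ der (cc s * (B t).1) (cc s * (B t).2),
    der (cc s * (B t).2) (cc s * S t + cc (K ^+ 2) * (cc s * (B t).1)) & dirich (cc s * (B t).1)].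
  move=> t0; have [a1 a2 a3] := hB t t0.
  have dsc (f g : C) : der f g -> der (cc s * f) (cc s * g).
    by move=> h; apply: der_eq (derM (der_cc s) h) _; rewrite mul0r add0r.
  split; first exact: dsc.
    by apply: der_eq (dsc _ _ a3) _; ring.
  have [[_ z1] _ _] := bd t (-1) t0 (or_introl erefl); have [[_ z2] _ _] := bd t 1 t0 (or_intror erefl).
  by split; rewrite cfM a1 ?cl1 ?clr ?z1 ?z2 mulr0.
have eP' : evolves P P1 P2 (fun t => cc K * ((V t + cc (c t)) * (cc s * S t)) + cc (K * width mu K ^+ 3) * P2 t
    + cc K * (cc s * Y t - F1 t * (cc s * (B t).1))).
  apply: evolves_ext eP _ => t y t0 hy; have [_ e2 ->] := hP12 t y t0 hy.
  have [-> _ _ _ _] := mode_equations sys t0 hy; have [_ ->] := shE t y t0 hy.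
  have [b1 _ _] := hB t t0.
  rewrite width3// [RHS]cfD ev1 uE// [(cc s * S t) y]cfM [(cc K * _) y]cfM cfB [(F1 t * _) y]cfM.
  rewrite [(cc s * Y t) y]cfM [(cc s * (B t).1) y]cfM !ccE e2 hS// hY// b1 oc// krE -/K; ring.
have eS' : evolves (fun t => cc s * S t) (fun t => cc s * S1 t) (fun t => cc s * S2 t)
   (fun t => - (cc K * ((V t + cc (c t)) * P t)) + cc (K * width mu K ^+ 3) * (cc s * S2 t)
    + cc K * (F1 t * (A t).1 - X t)).
  apply: evolves_ext (evolvesZ s eS) _ => t y t0 hy; have [_ e2 e3] := hS12 t y t0 hy.
  have [_ e4 _ _ _] := mode_equations sys t0 hy; have [_ e5] := shE t y t0 hy; rewrite e5 in e4.
  have [b1 _ _] := hA t t0.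
  rewrite width3// [RHS]cfD ev2 uE// [(cc K * _) y]cfM cfB [(F1 t * _) y]cfM [LHS]cfM [(cc s * S2 t) y]cfM.
  rewrite !ccE e3 e4 e2 hP// hX// b1 oc// /K -skE; ring.
move=> t t0; exists (mode_energy (width mu K) (P t) (P1 t) (cc s * S t) (cc s * S1 t)).
exists (mode_energy (width nu K) (X t) (X1 t) (cc s * Y t) (cc s * Y1 t)); split.
- exact: energy_mode s2 t0 rP rS.
- exact: energy_mode s2 t0 rX rY.
- exact: decX.
have T0 : 0 <= 1000 * expR 1 * pht by rewrite !mulr_ge0 ?expR_ge0 ?ler0n.
(* The forced estimate needs one rate below both that of [theta] and that of [omega]; as [width]
   increases with the diffusivity, the smaller diffusivity provides it. *)
have kL (w w' : R) : w <= w' -> K * w / 3000 / 2 <= K * w' / 3000 / 2.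
  by move=> h; have := ler_wpM2l (ltW K0) h; lra.
have wkm : width km K <= width mu K by apply: width_le => //; rewrite ge_min lexx.
have wkn : width km K <= width nu K by apply: width_le => //; rewrite ge_min lexx orbT.
have L0 : 0 <= K * width km K / 3000 / 2 by rewrite !divr_ge0 ?ler0n// mulr_ge0// ltW.
have hT t' : 0 < t' -> I (X t' * X t') + I (cc s * Y t' * (cc s * Y t')) <=
    1000 * expR 1 * pht * expR (- (K * width nu K / 3000 / 2) * t').
  by move=> t1; apply: le_trans (decX t' t1); rewrite /mode_energy lerDr addr_ge0 ?Isq_ge0.
have hWt t' : 0 < t' -> ud inI F t' (cc (K * width mu K ^+ 3) * F2 t').
  by move=> t1; rewrite width3//; have [] := eF t' t1.
have H : mode_energy (width mu K) (P t) (P1 t) (cc s * S t) (cc s * S1 t) <=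
    1000 * 1000 * 1505 * (1000 * expR 1 * pht / width mu K ^+ 2 * expR (- (K * width km K / 3000 / 2) * t))
    + 1500 * expR 1 * phw * expR (- (K * width mu K / 3000 / 2) * t).
  set Z := 1000 * 1000 * 1505 * _.
  have -> : 1500 * expR 1 * phw * expR (- (K * width mu K / 3000 / 2) * t) =
     750 * expR 1 * expR (- (K * width mu K / 3000 / 2) * t) * (2 * phw) by ring.
  apply: le_of_add_eps => [|e e0]; first by rewrite !mulr_ge0 ?expR_ge0 ?ler0n.
  have H2 := mode_forced_decay d0 m_small K1 dF dF1 F_half F1_d F2_d dP (dZ _ dS) wm T0 L0 (kL _ _ wkn) (kL _ _ wkm)
    hWt hA' hB' hT eP' eS' (M := 2 * phw + e) (fun t t0 => hw e t e0 t0) t0.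
  apply: le_trans H2 _; rewrite lerD2l le_eqVlt; apply/orP; left; apply/eqP; rewrite -/K; ring.
(* The estimate comes with the inverse square of the width for [mu], which is enlarged to that of
   the smaller diffusivity. *)
apply: le_trans H _; rewrite lerD2r; apply: ler_wpM2l; first by rewrite !mulr_ge0 ?ler0n.
apply: ler_wpM2r; first exact: expR_ge0.
apply: ler_wpM2l => //; rewrite lef_pV2 ?posrE ?exprn_gt0//.
by apply: lerXn2r => //; rewrite nnegrE ltW.
Qed.

End Assembly.

Theorem theorem1p1 (R : realType) :
  exists delta0 : R, 0 < delta0 < 1 / 2 /\
  exists C0 c0 : R, 0 < C0 /\ 0 < c0 /\
  forall (mu nu : R), 0 < mu -> 0 < nu ->
  forall (Win : R -> R) (DWin : nat -> R -> R) (W : R -> R -> R)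
    (omega psi theta : R -> R -> R -> R) (omega_in theta_in : R -> R -> R)
    (domega_in dtheta_in : int -> R -> R[i]),
  in_H 4 Win DWin ->
  Win (-1) = 0 -> Win 1 = 0 ->
  (forall x, omega_in x (-1) = 0 /\ omega_in x 1 = 0) ->
  heat_flow mu Win (DWin 1%N) W ->
  linearized_boussinesq mu nu (shear W) omega psi theta omega_in theta_in
    domega_in dtheta_in ->
  (Hnorm 4 DWin <= delta0%:E)%E ->
  forall (k : int) (t : R), k != 0 -> 0 < t ->
  let Phi_omega := energy mu k (mode_in omega_in k) (domega_in k) in
  let Phi_theta := energy nu k (mode_in theta_in k) (dtheta_in k) in
  (energy nu k (mode theta k t) (cdy (mode theta k) t)
     <= C0%:E * Phi_theta * (decay nu k t c0)%:E)%E /\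
  (energy mu k (mode omega k t) (cdy (mode omega k) t)
     <= C0%:E * Phi_omega * (decay mu k t c0)%:E
        + C0%:E
          * (Num.min mu nu `^ (- (2 / 3)) * absk k `^ (2 / 3))%:E
          * Phi_theta * (decay (Num.min mu nu) k t c0)%:E)%E.
Proof.
(* Chosen so that [3 m = 10^-10], the smallness demanded of [d = 3 m] by the energy estimate. *)
pose m : R := 1 / 1000 / 1000 / 1000 / 10 / 3.
have m0 : 0 < m by rewrite /m !divr_gt0 ?ltr0n.
have m1 : 1000 * 1000 * 1000 * 10 * (3 * m) <= 1 by rewrite /m; lra.
exists m; split; first by rewrite m0 /m; lra.
(* [C1] is the constant of the [theta] estimate, and [1000 * 1000 * 1505] is the amplification by
   the forcing, so [C0] dominates all three constants. *)
pose C1 : R := 1000 * expR 1; pose C0 : R := 1000 * 1000 * 1505 * C1.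
have C10 : 0 < C1 by rewrite mulr_gt0 ?expR_gt0 ?ltr0n.
have C00 : 0 < C0 by rewrite !mulr_gt0 ?ltr0n.
have C1_le : C1 <= C0 by rewrite /C0; move: C10; move: (C1) => x x0; lra.
have C2_le : 1500 * expR 1 <= C0 by rewrite /C0 /C1; move: (expR_gt0 (1 : R)); move: (expR 1) => x x0; lra.
exists C0, (1 / 3000 / 2); split; [exact: C00|split]; first by rewrite !divr_gt0 ?ltr0n.
move=> mu nu mu0 nu0 Win DWin W omega psi theta omega_in theta_in domega_in dtheta_in.
move=> hWin Wl Wr _ hW [_ _ hweak hinit hsys] hH k t k0 t0 Phi_omega Phi_theta.
have [w1 w2] := hweak k; have [i1 i2] := hinit k.
have [phw [pht [[pw pt] Ew Et H]]] := mode_estimates m0 m1 mu0 nu0 k0 hWin Wl Wr hW hH w1 w2 i1 i2 (hsys k).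
have [ew [et [-> -> Bt Bw]]] := H t t0.
have [_ _ _ K1] := @sgr_int R k k0; have K0 : 0 < absk k :> R := lt_le_trans ltr01 K1.
rewrite /Phi_omega /Phi_theta Ew Et !decayE//.
have rE (kappa : R) : absk k * width kappa (absk k) * (1 / 3000 / 2) = absk k * width kappa (absk k) / 3000 / 2 by ring.
have wE : (width (Num.min mu nu) (absk k) ^+ 2)^-1 = Num.min mu nu `^ (- (2 / 3)) * absk k `^ (2 / 3) :> R.
  by rewrite width2 invfM !powRN invrK.
rewrite -!EFinM -EFinD !lee_fin !rE; split.
  apply: le_trans Bt _; apply: ler_wpM2r; first exact: expR_ge0.
  apply: ler_wpM2r; [exact: pt|exact: C1_le].
rewrite -wE; apply: le_trans Bw _; rewrite addrC; apply: lerD.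
  apply: ler_wpM2r; first exact: expR_ge0.
  apply: ler_wpM2r; [exact: pw|exact: C2_le].
by rewrite /C0 le_eqVlt; apply/orP; left; apply/eqP; rewrite -/C1; ring.
Qed.
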